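(* We have $$\pi\,\mu_3(1+x+y)=15\,\mathrm{Ls}_4\!\left(\frac{2\pi}3\right)-18\,\mathrm{Lsc}_{2,3}\!\left(\frac\pi3\right)-15\,\mathrm{Cl}_4\!\left(\frac\pi3\right)-\frac14\pi^2\,\mathrm{Cl}_2\!\left(\frac\pi3\right)-17\pi\zeta(3).$$
   Context: The higher Mahler measure is $\mu_n(1+x+y)=\int_0^1\int_0^1\left(\log\left|1+e^{2\pi i t}+e^{2\pi i u}\right|\right)^n dt\,du$. The log-sine integrals are $\mathrm{Ls}_{n}(\sigma)=-\int_0^\sigma \log^{n-1}\left|2\sin\frac\theta2\right|d\theta$, and the log-sine-cosine integrals are $\mathrm{Lsc}_{m,n}(\sigma)=-\int_0^\sigma\log^{m-1}\left|2\sin\frac\theta2\right|\,\log^{n-1}\left|2\cos\frac\theta2\right|d\theta$. The Clausen functions of even order are $\mathrm{Cl}_{k}(\theta)=\sum_{n=1}^\infty\frac{\sin(n\theta)}{n^k}$ for $k=2,4$. $\zeta$ is the Riemann zeta function. *)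

(* Defs.v *)
From mathcomp Require Import all_boot all_order all_algebra.
From mathcomp Require Import all_classical all_reals all_analysis.
From mathcomp.real_closed Require Import complex.

Set Implicit Arguments.
Unset Strict Implicit.
Unset Printing Implicit Defensive.

Import Order.TTheory GRing.Theory Num.Theory.
Import numFieldNormedType.Exports.

Local Open Scope classical_set_scope.
Local Open Scope ring_scope.
Local Open Scope complex_scope.

(* All logarithms below are [ln : R -> R], for which [ln 0 = 0]; their
   arguments vanish only on Lebesgue-null sets. *)

Definition expi (R : realType) (x : R) : R[i] := cos x +i* sin x.

(* The n-th higher Mahler measure of a function P of two complex variables.
   [Normc.normc] is the complex modulus with values in R (the norm of the
   numDomainType R[i] has values in R[i]). *)
Definition higher_mahler (R : realType) (n : nat) (P : R[i] -> R[i] -> R[i])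
    : R :=
  \int[@lebesgue_measure R]_(u in `[0%R, 1%R])
    \int[@lebesgue_measure R]_(t in `[0%R, 1%R])
      (ln (Normc.normc (P (expi (2 * pi * t)) (expi (2 * pi * u))))) ^+ n.

(* Log-sine and log-sine-cosine integrals, for sigma >= 0 and n, m >= 1. *)
Definition Ls (R : realType) (n : nat) (sigma : R) : R :=
  - \int[@lebesgue_measure R]_(theta in `[0%R, sigma])
      (ln `|2 * sin (theta / 2)|) ^+ n.-1.

Definition Lsc (R : realType) (m n : nat) (sigma : R) : R :=
  - \int[@lebesgue_measure R]_(theta in `[0%R, sigma])
      ((ln `|2 * sin (theta / 2)|) ^+ m.-1 *
       (ln `|2 * cos (theta / 2)|) ^+ n.-1).

(* The Clausen function of even order k >= 2 (for odd k the sine is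
   conventionally replaced by a cosine). *)
Definition Cl (R : realType) (k : nat) (theta : R) : R :=
  limn (series (fun j : nat => sin (j.+1%:R * theta) / j.+1%:R ^+ k)).

(* The Riemann zeta function on the half-line s > 1. *)
Definition zeta (R : realType) (s : R) : R :=
  limn (series (fun j : nat => (j.+1%:R `^ s)^-1)).

(* Main.v *)
(* Since [1 + e^{2 pi i u} = 2 cos (pi u) e^{i pi u}], the inner integral of the
   Mahler measure is the mean over the circle of [ln^3 |1 + a e^{is}|] with
   [a = 2 cos (pi u)].  Differentiating such means in [a] turns them into
   integrals of [ln^j (1 - b^2) / b], and exchanging the order of integration
   over triangles expresses [pi mu_3] by the integrals of [ln^3 (2 sin x)] over
   [0, pi/3] and [0, pi/6], up to integrals of a quadratic polynomial times
   [ln (2 sin x)] or [ln (2 cos x)].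

   The substitution [r = sin t / sin (s - t)] maps log-sine integrals over
   [0, s/2] to integrals of [ln^k r] against the real and imaginary parts of
   [1 / (r + e^{is})], that is, to polylogarithms at [- e^{-is}], which are
   handled by their differential equations in [s].  At [s = 2 pi / 3] this gives
   one relation for [ln (2 sin x) ln^2 (2 cos x)] on [0, pi/6] and, in a variant
   where the circle around [- e^{is}] cuts the ray, one for [ln^3 (2 sin x)].
   The theorem is a linear combination of these relations and of the quadratic
   moments, which are polylogarithms as well. *)
Require Import Defs.
From mathcomp Require Import all_boot all_order all_algebra.
From mathcomp Require Import all_classical all_reals all_analysis.
From mathcomp Require Import measurable_realfun.
From mathcomp.real_closed Require Import complex.
From mathcomp Require Import ring lra.
Import Order.TTheory GRing.Theory Num.Theory.
Import numFieldNormedType.Exports.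
Local Open Scope classical_set_scope.
Local Open Scope ring_scope.

Set Implicit Arguments.
Unset Strict Implicit.
Unset Printing Implicit Defensive.

(** Write [P] for the integral of [lsin ^+ 3] over [[0, pi / 3]] and [I] for that of
    [lsin * lcos ^+ 2] over [[0, pi / 6]]. The Mahler side contributes [- 12 * P], the right-hand
    side [- 30 * P + 36 * I], and the first relation at [2 pi / 3] has leading part [6 * I = 3 * P]:
    the integral [P] is eliminated without being computed. The angle [2 pi / 3] serves twice. Since
    [sin (2 pi / 3 - t) = cos (t - pi / 6)], the reflected logarithm is an [lcos] centred at the
    midpoint [pi / 6] of [[0, pi / 3]]; and since [2 sin (pi / 6) = 1], the cut ray of the variant
    ends at [r = 1], so that a complete polylogarithm integral appears. Two analytic obstacles shape
    the development. Nearly all integrands have logarithmic endpoint singularities: they are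
    confined to one class [logb], closed under sums and products and contained in the integrable
    functions. The kernel [1 / (r + e^{is})] has a pole at [r = 1], [s = pi]: each power of [ln r]
    absorbs one factor [1 / (1 - r)]. Complex analysis is replaced by real identities between [kap],
    [rr] and their derivatives. *)

(* Hypotheses that are neither comparisons nor equations only slow [lra] down. *)
Ltac keep_comparisons := repeat match goal with H : ?P |- _ =>
    lazymatch type of P with Prop =>
      lazymatch P with is_true _ => fail | _ = _ => fail | _ => clear H end
    end
  end.
Ltac full_lra := lra.
Tactic Notation "lra" := keep_comparisons; full_lra.

(* Hides [is_derive] from type-class resolution, so that derivatives are
   computed by the structural rules below only. *)
Definition dv {R : realType} (f : R -> R) (x d : R) : Prop := is_derive x 1 f d.

(** * Structural rules for derivatives of real functions *)

Section derivative_rules.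
Context {R : realType}.
Implicit Types (f g : R -> R) (x d e k : R).

Lemma dv_eq f x d e : dv f x d -> d = e -> dv f x e.
Proof. by move=> h <-. Qed.

Lemma dv_cst k x : dv (fun _ : R => k) x 0.
Proof. exact: is_derive_cst. Qed.

Lemma dv_id x : dv (fun y : R => y) x 1.
Proof. exact: is_derive_id. Qed.

Lemma dvD f g x d e : dv f x d -> dv g x e -> dv (fun y => f y + g y) x (d + e).
Proof. by move=> ? ?; exact: is_deriveD. Qed.

Lemma dvN f x d : dv f x d -> dv (fun y => - f y) x (- d).
Proof. by move=> ?; exact: is_deriveN. Qed.

Lemma dvM f g x d e : dv f x d -> dv g x e ->
  dv (fun y => f y * g y) x (d * g x + f x * e).
Proof.
move=> hf hg; have h := is_deriveM hf hg; refine (dv_eq (h : dv (fun y => f y * g y) x _) _).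
by rewrite /GRing.scale /=; ring.
Qed.

Lemma dvX f n x d : dv f x d -> dv (fun y => f y ^+ n) x (n%:R * f x ^+ n.-1 * d).
Proof.
move=> hf; elim: n => [|n ih]; first by under eq_fun do rewrite expr0; apply: dv_eq (dv_cst 1 x) _; ring.
under eq_fun do rewrite exprS; apply: dv_eq (dvM hf ih) _.
by case: n {ih} => [|n] /=; rewrite ?exprS ?expr0 -[in RHS]natr1; ring.
Qed.

Lemma dvV f x d : dv f x d -> f x != 0 -> dv (fun y => (f y)^-1) x (- d / f x ^+ 2).
Proof.
move=> hf f0; have h := is_deriveV f0 hf; refine (dv_eq h _).
by rewrite /GRing.scale /=; field.
Qed.

Lemma dv_comp (G : R -> R) f x d e : dv G (f x) e -> dv f x d ->
  dv (fun y => G (f y)) x (e * d).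
Proof. by move=> hG hf; exact: is_derive1_comp. Qed.

Lemma dv_sin f x d : dv f x d -> dv (fun y => sin (f y)) x (cos (f x) * d).
Proof. by move=> hf; apply: dv_comp hf; exact: is_derive_sin. Qed.

Lemma dv_cos f x d : dv f x d -> dv (fun y => cos (f y)) x (- sin (f x) * d).
Proof. by move=> hf; apply: dv_comp hf; exact: is_derive_cos. Qed.

Lemma dv_expR f x d : dv f x d -> dv (fun y => expR (f y)) x (expR (f x) * d).
Proof. by move=> hf; apply: dv_comp hf; exact: is_derive_expR. Qed.

Lemma dv_ln f x d : dv f x d -> 0 < f x -> dv (fun y => ln (f y)) x (d / f x).
Proof.
move=> hf f0; apply: dv_eq; last exact: mulrC.
by apply: dv_comp hf; exact: is_derive1_ln.
Qed.

Lemma dv_cvg f x d : dv f x d -> f y @[y --> x] --> f x.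
Proof.
by move=> [hf _]; exact/differentiable_continuous/derivable1_diffP.
Qed.

Lemma dv_cvg_eq f x d l : dv f x d -> f x = l -> f y @[y --> x] --> l.
Proof. by move=> h <-; exact: dv_cvg h. Qed.

Lemma dv_near f g x d : (\forall y \near x, f y = g y) -> dv f x d -> dv g x d.
Proof. by move=> fg h; apply: (near_eq_is_derive _ h); rewrite ?oner_eq0. Qed.

Lemma near_oo (a b x : R) : a < x < b -> \forall y \near x, a < y < b.
Proof.
move=> axb; have : x \in `]a, b[ by rewrite in_itv.
by move/near_in_itvoo; apply: filterS => y; rewrite in_itv.
Qed.

End derivative_rules.

(* [pi] is defined as a double, which [field] would unfold in side conditions. *)
Ltac gen_pi := match goal with
  |- context [@pi ?R] => generalize (@pi_gt0 R); generalize (@pi R); intros ? ?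
  end.
Ltac fld := field; rewrite ?gt_eqF//=.

(** Extension point: it is rebound below so that [dv_auto] and [cvg_auto] also differentiate [lsin],
    [lcos] and [tan]. *)
Ltac dv_hook := fail.
Ltac dv_core := lazymatch goal with
  | |- dv (fun y => y) _ _ => exact: dv_id
  | |- dv (fun _ => ?k) _ _ => exact: dv_cst
  | |- dv (fun y => @?f y + @?g y) _ _ => eapply (@dvD _ f g)
  | |- dv (fun y => - @?f y) _ _ => eapply (@dvN _ f)
  | |- dv (fun y => @?f y * @?g y) _ _ => eapply (@dvM _ f g)
  | |- dv (fun y => @?f y ^+ ?n) _ _ => eapply (@dvX _ f n)
  | |- dv (fun y => (@?f y)^-1) _ _ => eapply (@dvV _ f)
  | |- dv (fun y => sin (@?f y)) _ _ => eapply (@dv_sin _ f)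
  | |- dv (fun y => cos (@?f y)) _ _ => eapply (@dv_cos _ f)
  | |- dv (fun y => expR (@?f y)) _ _ => eapply (@dv_expR _ f)
  | |- dv (fun y => ln (@?f y)) _ _ => eapply (@dv_ln _ f)
  end.
Ltac dv_step := first [ eassumption | dv_core | dv_hook ].
Ltac dv_auto := eapply dv_eq; [repeat (dv_step; cbv beta) | cbv beta].
(** Continuity is read off from differentiability: some derivative is computed and forgotten, and
    only the side conditions and the value of the limit remain. *)
Ltac cvg_auto := lazymatch goal with
  | |- context [fmap ?F (nbhs ?x)] =>
      eapply (@dv_cvg_eq _ F x); [repeat (dv_step; cbv beta) | try reflexivity]
  end.

(** * Logarithms of sine and cosine, special angles *)

Section trig.
Context {R : realType}.
Implicit Types x y : R.

Definition lsin x : R := ln (2 * sin x).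
Definition lcos x : R := ln (2 * cos x).

Lemma sin_pos x : 0 < x < pi -> 0 < sin x. Proof. exact: sin_gt0_pi. Qed.
Lemma cos_pos x : - (pi / 2) < x < pi / 2 -> 0 < cos x.
Proof. exact: cos_gt0_pihalf. Qed.

Lemma dv_lsin (f : R -> R) x d : dv f x d -> 0 < f x < pi ->
  dv (fun y => lsin (f y)) x (cos (f x) / sin (f x) * d).
Proof.
move=> hf h; have s0 := sin_pos h; rewrite /lsin; dv_auto; first by rewrite mulr_gt0.
by field; rewrite gt_eqF.
Qed.

Lemma dv_lcos (f : R -> R) x d : dv f x d -> - (pi / 2) < f x < pi / 2 ->
  dv (fun y => lcos (f y)) x (- (sin (f x) / cos (f x)) * d).
Proof.
move=> hf h; have s0 := cos_pos h; rewrite /lcos; dv_auto; first by rewrite mulr_gt0.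
by field; rewrite gt_eqF.
Qed.

Lemma dv_tan (f : R -> R) x d : dv f x d -> - (pi / 2) < f x < pi / 2 ->
  dv (fun y => tan (f y)) x ((1 + tan (f x) ^+ 2) * d).
Proof.
move=> hf h; have s0 := cos_pos h; rewrite /tan; dv_auto; first by rewrite gt_eqF.
by field; rewrite gt_eqF.
Qed.

Lemma sinBpi x : sin (pi - x) = sin x.
Proof. by rewrite sinB sinpi cospi mul0r mulN1r opprK add0r. Qed.

Lemma lsinBpi x : lsin (pi - x) = lsin x.
Proof. by rewrite /lsin sinBpi. Qed.

Lemma lcosN x : lcos (- x) = lcos x.
Proof. by rewrite /lcos cosN. Qed.

Lemma lsinD_pihalf x : lsin (x + pi / 2) = lcos x.
Proof. by rewrite /lsin /lcos sinDpihalf. Qed.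

Lemma lsinB_pihalf x : lsin (pi / 2 - x) = lcos x.
Proof. by rewrite -lcosN -lsinD_pihalf addrC. Qed.

Lemma lcosB_pihalf x : lcos (pi / 2 - x) = lsin x.
Proof. by rewrite -lsinB_pihalf; congr lsin; ring. Qed.

Lemma sin2x x : sin (2 * x) = 2 * sin x * cos x.
Proof. by rewrite mulr_natl sin_mulr2n -[RHS]mulrA [RHS]mulr_natl mulrC. Qed.

Lemma cos2x x : cos (2 * x) = 2 * cos x ^+ 2 - 1.
Proof. by rewrite mulr_natl cos_mulr2n -mulr_natl. Qed.

Lemma lsin_double x : 0 < x < pi / 2 -> lsin (2 * x) = lsin x + lcos x.
Proof.
move=> /andP[x0 xp]; have p0 := @pi_gt0 R.
have s0 : 0 < sin x by apply: sin_pos; rewrite x0; lra.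
have c0 : 0 < cos x by apply: cos_pos; rewrite xp andbT; lra.
rewrite /lsin /lcos -lnM ?posrE ?mulr_gt0// sin2x; congr ln; ring.
Qed.

(** The angle [2 pi / 3] is the supplement of [pi / 3], so [c = cos (pi / 3)] satisfies
    [2 c^2 - 1 = - c], that is [(2 c - 1) (c + 1) = 0], and [c] is positive. *)
Lemma cos_pi3 : cos (pi / 3) = 1 / 2 :> R.
Proof.
have p0 := @pi_gt0 R.
have c0 : 0 < cos (pi / 3 : R) by apply: cos_pos; apply/andP; split; lra.
have /eqP : cos (2 * (pi / 3)) = - cos (pi / 3 : R).
  rewrite (_ : 2 * (pi / 3) = - (pi / 3) + pi); last by field.
  by rewrite cosDpi cosN.
rewrite cos2x -subr_eq0 (_ : _ - _ = (2 * cos (pi / 3) - 1) * (cos (pi / 3) + 1)); last by ring.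
rewrite mulf_eq0 => /orP[|] /eqP h; lra.
Qed.

Lemma sin_pi6 : sin (pi / 6) = 1 / 2 :> R.
Proof. by rewrite -cos_pi3 -cosBpihalf -[in RHS]cosN; congr cos; field. Qed.

(** The zeros of [lsin] at [pi / 6] and of [lcos] at [pi / 3] are what kills the boundary terms at
    the inner endpoints of the later integrations by parts. *)
Lemma lsin_pi6 : lsin (pi / 6) = 0 :> R.
Proof. by rewrite /lsin sin_pi6 (_ : 2 * _ = 1) ?ln1//; field. Qed.

Lemma lcos_pi3 : lcos (pi / 3) = 0 :> R.
Proof. by rewrite /lcos cos_pi3 (_ : 2 * _ = 1) ?ln1//; field. Qed.

End trig.

Ltac dv_hook ::= lazymatch goal with
  | |- dv (fun y => lsin (@?f y)) _ _ => eapply (@dv_lsin _ f)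
  | |- dv (fun y => lcos (@?f y)) _ _ => eapply (@dv_lcos _ f)
  | |- dv (fun y => tan (@?f y)) _ _ => eapply (@dv_tan _ f)
  end.

(** * Integrals over open intervals and the improper fundamental theorem *)

Section interval_integral.
Context {R : realType}.
Notation mu := (@lebesgue_measure R).
Implicit Types (a b c x k : R) (f g : R -> R).

(** Open intervals are used throughout, so that pointwise hypotheses never have to speak of an
    endpoint where a logarithm is singular. *)
Definition integ a b f := mu.-integrable `]a, b[ (EFin \o f).
Definition itg a b f : R := \int[mu]_(x in `]a, b[) f x.
Definition contin a b f := forall x, a < x < b -> f y @[y --> x] --> f x.

Lemma contin_measurable a b f : contin a b f -> measurable_fun `]a, b[ f.
Proof.
move=> cf; apply: open_continuous_measurable_fun; first exact: interval_open.
by move=> x; rewrite inE /= in_itv /= => /cf.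
Qed.

Lemma itg_ext a b f g : (forall x, a < x < b -> f x = g x) ->
  itg a b f = itg a b g.
Proof.
by move=> fg; apply: eq_Rintegral => x; rewrite inE /= in_itv /= => /fg.
Qed.

Lemma integ_ext a b f g : (forall x, a < x < b -> f x = g x) ->
  integ a b f -> integ a b g.
Proof.
move=> fg; apply: eq_integrable => // x; rewrite inE /= in_itv /= => /fg.
by move=> ->.
Qed.

Lemma integ_cc a b f : integ a b f -> mu.-integrable `[a, b] (EFin \o f).
Proof.
move=> /integrableP[mf fi]; apply/integrableP.
have mf' : measurable_fun `[a, b] (EFin \o f).
  by apply: emeasurable_fun_itv_cc mf.
split => //; rewrite (integral_itv_bndoo true false)//.
exact: measurableT_comp.
Qed.

Lemma integ_ends a b f (s t : bool) : integ a b f ->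
  \int[mu]_(x in [set` Interval (BSide s a) (BSide t b)]) f x = itg a b f.
Proof.
move=> /integrableP[mf fi]; rewrite /itg /Rintegral.
by rewrite (integral_itv_bndoo s t)//.
Qed.

Lemma integ_sub a b a' b' f : a <= a' -> b' <= b -> integ a b f -> integ a' b' f.
Proof.
move=> aa bb; apply: integrableS => // x /=; rewrite !in_itv /= => /andP[h1 h2].
by rewrite (le_lt_trans aa h1) (lt_le_trans h2 bb).
Qed.

Lemma integD a b f g : integ a b f -> integ a b g -> integ a b (fun x => f x + g x).
Proof. by move=> hf hg; exact: (integrableD _ hf hg). Qed.

Lemma integZ a b k f : integ a b f -> integ a b (fun x => k * f x).
Proof. by move=> hf; exact: (integrableZl _ k hf). Qed.

Lemma integ_cst a b k : integ a b (fun=> k).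
Proof.
rewrite /integ; have [ab|ba] := ltP a b; last first.
  by rewrite set_itv_ge ?bnd_simp -?leNgt//; exact: integrable_set0.
apply: measurable_bounded_integrable => //.
- by rewrite /= lebesgue_measure_itv /= lte_fin ab -EFinB ltry.
- exact: bounded_cst.
Qed.

Lemma itgD a b f g : integ a b f -> integ a b g ->
  itg a b (fun x => f x + g x) = itg a b f + itg a b g.
Proof. by move=> hf hg; exact: RintegralD. Qed.

Lemma itgZ a b k f : integ a b f -> itg a b (fun x => k * f x) = k * itg a b f.
Proof. by move=> hf; exact: RintegralZl. Qed.

Lemma itgN a b f : integ a b f -> itg a b (fun x => - f x) = - itg a b f.
Proof.
by move=> hf; rewrite -[RHS]mulN1r -itgZ//; apply: itg_ext => x _; rewrite mulN1r.
Qed.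

Lemma integN a b f : integ a b f -> integ a b (fun x => - f x).
Proof.
by move=> /(integZ (-1)); apply: integ_ext => x _; rewrite mulN1r.
Qed.

Lemma itgB a b f g : integ a b f -> integ a b g ->
  itg a b (fun x => f x - g x) = itg a b f - itg a b g.
Proof. by move=> hf hg; rewrite itgD ?itgN//; exact: integN. Qed.

Lemma itg_cst a b k : a <= b -> itg a b (fun=> k) = k * (b - a).
Proof.
move=> ab; rewrite /itg Rintegral_cst//= lebesgue_measure_itv /= lte_fin.
by case: ltP => // ba; rewrite /= mulr0 (_ : b - a = 0) ?mulr0//; apply/eqP; rewrite subr_eq0 eq_le ab ba.
Qed.

Lemma itg_nil a b f : b <= a -> itg a b f = 0.
Proof.
move=> ba; rewrite /itg set_itv_ge ?Rintegral_set0//.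
by rewrite bnd_simp -leNgt.
Qed.

Lemma itg_split a b c f : a <= c <= b -> integ a b f ->
  itg a b f = itg a c f + itg c b f.
Proof.
move=> /andP[ac cb] hf.
have [ab|ab] := eqVneq a b.
  have -> : c = b by apply/eqP; rewrite eq_le cb -ab ac.
  by rewrite -ab itg_nil ?addr0.
have [cb'|bc] := ltP c b; last first.
  have ecb : c = b by apply/eqP; rewrite eq_le cb bc.
  by rewrite ecb (itg_nil _ (lexx b)) addr0.
have h := @Rintegral_itvB R f (BRight a) (BLeft b) c hf.
have {}h : itg a b f - \int[mu]_(x in `]a, c]) f x = itg c b f.
  by apply: h; rewrite bnd_simp.
rewrite -h (@integ_ends a c f false false); first by rewrite addrC subrK.
exact: integ_sub hf.
Qed.

Lemma integ_glue a b c f : a <= c <= b -> integ a c f -> integ c b f -> integ a b f.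
Proof.
move=> /andP[ac cb] h1 h2.
have [cb'|bc] := ltP c b; last first.
  by have <- : c = b by apply/eqP; rewrite eq_le cb bc.
have e : `]a, b[%classic = `]a, c]%classic `|` (`]c, b[%classic : set R).
  by rewrite -itv_bndbnd_setU// bnd_simp.
have mac : measurable (`]a, c]%classic : set (measurableTypeR R)) by exact: measurable_itv.
have h1' : mu.-integrable `]a, c] (EFin \o f).
  by apply: integrableS (integ_cc h1) => //= x /=; rewrite !in_itv /= => /andP[/ltW -> ->].
rewrite /integ e; move/integrableP : h1' => [m1 i1]; move/integrableP : h2 => [m2 i2].
have m12 : measurable_fun (`]a, c]%classic `|` `]c, b[%classic) (EFin \o f).
  by apply/measurable_funU.
apply/integrableP; split => //.
rewrite ge0_integral_setU//; first exact: lte_add_pinfty.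
- exact: measurableT_comp.
- apply/disj_setPS => x [] /=; rewrite !in_itv /= => /andP[_ xc] /andP[cx _].
  by move: cx; rewrite ltNge xc.
Qed.

Lemma le_itg a b f g : integ a b f -> integ a b g ->
  (forall x, a < x < b -> f x <= g x) -> itg a b f <= itg a b g.
Proof.
by move=> hf hg fg; apply: le_Rintegral => // x /=; rewrite in_itv /= => /fg.
Qed.

Lemma itg_ge0 a b f : (forall x, a < x < b -> 0 <= f x) -> 0 <= itg a b f.
Proof. by move=> f0; apply: Rintegral_ge0 => x /=; rewrite in_itv /= => /f0. Qed.

Lemma integ_norm a b f : integ a b f -> integ a b (fun x => `|f x|).
Proof. by move=> hf; exact: (integrable_abse hf). Qed.

Lemma itg_norm a b f : integ a b f -> `|itg a b f| <= itg a b (fun x => `|f x|).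
Proof. by move=> hf; exact: le_normr_Rintegral. Qed.

Lemma integ_le a b f g : contin a b f ->
  (forall x, a < x < b -> `|f x| <= g x) -> integ a b g -> integ a b f.
Proof.
move=> cf fg; apply: le_integrable => //.
  by apply/measurable_EFinP; exact: contin_measurable.
move=> x /=; rewrite in_itv /= => xab; rewrite lee_fin.
exact: le_trans (fg _ xab) (ler_norm _).
Qed.

Lemma prim_left a b f : a < b -> integ a b f -> itg a y f @[y --> b^'-] --> itg a b f.
Proof.
move=> ab hf; have hc := integ_cc hf.
rewrite -(@integ_ends a b f true false)//.
have := parameterized_integral_cvg_at_left ab hc; rewrite /parameterized_integral.
apply: cvg_trans; apply: near_eq_cvg; near=> y.
rewrite (@integ_ends a y f true false)//; apply: integ_sub hf => //.
Unshelve. all: end_near. Qed.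

Lemma prim0 a b f : a < b -> integ a b f -> itg a y f @[y --> a] --> (0 : R).
Proof.
move=> ab hf; have := parameterized_integral_cvg_left ab (integ_cc hf).
rewrite /parameterized_integral.
apply: cvg_trans; apply: near_eq_cvg; near=> y.
rewrite (@integ_ends a y f true false)//; apply: integ_sub hf => //.
by apply: ltW; near: y; exact: lt_nbhsl.
Unshelve. all: end_near. Qed.

Lemma dv_prim a b f x : a < x < b -> integ a b f -> f y @[y --> x] --> f x ->
  dv (fun y => itg a y f) x (f x).
Proof.
move=> /andP[ax xb] hf cf; have hc := integ_cc hf.
have [h1 h2] := @continuous_FTC1 R f (BLeft a) x b xb hc ax cf.
have : dv (fun y => \int[mu]_(t in `[a, y]) f t) x (f x).
  by split; [exact: h1|rewrite -derive1E].
apply: dv_near; near=> y.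
rewrite (@integ_ends a y f true false)//; apply: integ_sub hf => //.
by apply: ltW; near: y; exact: lt_nbhsl.
Unshelve. all: end_near. Qed.

Lemma prim_cvg a b f x : a < x < b -> integ a b f ->
  itg a y f @[y --> x] --> itg a x f.
Proof.
move=> /andP[ax xb] hf.
have h1 := prim_left ax (integ_sub (lexx a) (ltW xb) hf).
have h2 := prim0 xb (integ_sub (ltW ax) (lexx b) hf).
apply/left_right_continuousP; split => //.
have : itg a x f + itg x y f @[y --> x^'+] --> itg a x f + 0.
  by apply: cvgD; [exact: cvg_cst|exact: cvg_at_right_filter].
rewrite addr0; apply: cvg_trans; apply: near_eq_cvg; near=> y.
have xy : x < y by [].
rewrite -itg_split//; first by rewrite (ltW ax) (ltW xy).
by apply: integ_sub hf => //; apply: ltW; near: y; exact: nbhs_right_lt.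
Unshelve. all: end_near. Qed.

Lemma eq_dv_cst (F G h : R -> R) a b x y : a < x < b -> a < y < b ->
  (forall t, a < t < b -> dv F t (h t)) -> (forall t, a < t < b -> dv G t (h t)) ->
  F x - G x = F y - G y.
Proof.
wlog xy : x y / x < y => [hw|] hx hy hF hG.
  have [/hw|/hw H|->//] := ltgtP x y; first exact.
  exact/esym/H.
have sub t : x <= t <= y -> a < t < b.
  move: hx hy => /andP[ax _] /andP[_ yb] /andP[xt ty].
  by rewrite (lt_le_trans ax xt) (le_lt_trans ty yb).
have dFG t : a < t < b -> dv (fun u => F u - G u) t 0.
  move=> ht; apply: dv_eq (dvD (hF t ht) (dvN (hG t ht))) _; exact: subrr.
have [||c _] := @MVT R (fun t => F t - G t) (fun=> 0) x y xy.
- by move=> t; rewrite in_itv /= => /andP[/ltW ? /ltW ?]; apply/dFG/sub/andP.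
- apply: derivable_within_continuous => t; rewrite in_itv /= => /sub /dFG [].
  by [].
- by rewrite mul0r => /eqP; rewrite subr_eq0 => /eqP.
Qed.

(** Improper form: [F] only needs one-sided limits. It differs from [itg a x f] by a constant on the
    interior, and this primitive tends to [0] at [a] and to the full integral at [b]. *)
Lemma FTC a b f (F : R -> R) (la lb : R) : a < b -> integ a b f -> contin a b f ->
  (forall x, a < x < b -> dv F x (f x)) ->
  F x @[x --> a^'+] --> la -> F x @[x --> b^'-] --> lb ->
  itg a b f = lb - la.
Proof.
move=> ab hf cf dF Fa Fb.
have dG x : a < x < b -> dv (fun y => itg a y f) x (f x).
  by move=> h; apply: (@dv_prim a b) => //; exact: cf.
have hm : a < (a + b) / 2 < b by lra.
set m := (a + b) / 2 in hm.
have key x : a < x < b -> F x = itg a x f + (F m - itg a m f).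
  by move=> hx; have := eq_dv_cst hx hm dF dG; lra.
have ea : la = F m - itg a m f.
  apply: (cvg_unique _ Fa) => //=; rewrite -[X in _ --> X]add0r.
  have : itg a x f + (F m - itg a m f) @[x --> a^'+] --> 0 + (F m - itg a m f).
    apply: cvgD; last exact: cvg_cst.
    exact/cvg_at_right_filter/(prim0 ab hf).
  apply: cvg_trans; apply: near_eq_cvg; near=> x; rewrite [RHS]key//.
  by apply/andP; split => //; near: x; exact: nbhs_right_lt.
have eb : lb = itg a b f + (F m - itg a m f).
  apply: (cvg_unique _ Fb) => //=.
  have : itg a x f + (F m - itg a m f) @[x --> b^'-] --> itg a b f + (F m - itg a m f).
    apply: cvgD; last exact: cvg_cst.
    exact: prim_left.
  apply: cvg_trans; apply: near_eq_cvg; near=> x; rewrite [RHS]key//.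
  by apply/andP; split => //; near: x; exact: nbhs_left_gt.
by rewrite ea eb; ring.
Unshelve. all: end_near. Qed.

Lemma contin_within a b f a' b' : a < a' -> b' < b -> contin a b f ->
  {within `[a', b'], continuous f}.
Proof.
move=> aa bb cf; apply: continuous_in_subspaceT => x.
rewrite inE /= in_itv /= => /andP[h1 h2]; apply: cf.
by rewrite (lt_le_trans aa h1) (le_lt_trans h2 bb).
Qed.

(** Monotone convergence along an exhaustion by compact intervals: on each of them the fundamental
    theorem bounds the integral by the oscillation of [F], at most [2 * M]. *)
Lemma integ_ge0 a b f (F : R -> R) (M : R) : contin a b f ->
  (forall x, a < x < b -> 0 <= f x) ->
  (forall x, a < x < b -> dv F x (f x)) -> (forall x, a < x < b -> `|F x| <= M) ->
  integ a b f.
Proof.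
move=> cf f0 dF FM; have [ab|ba] := ltP a b; last first.
  by rewrite /integ set_itv_ge ?bnd_simp -?leNgt//; exact: integrable_set0.
have mf := contin_measurable cf.
(* The margin never exceeds a third of the length, so every compact interval is nondegenerate
   already for [n = 0]. *)
pose d (n : nat) : R := (b - a) / 3 / n.+1%:R.
pose I (n : nat) : set R := `[a + d n, b - d n]%classic.
have d0 (n : nat) : 0 < d n by rewrite /d divr_gt0// divr_gt0// subr_gt0.
have d1 (n : nat) : d n <= (b - a) / 3.
  rewrite /d ler_pdivrMr// ler_peMr//; last by rewrite (ler_nat R 1).
  by rewrite ltW// divr_gt0// subr_gt0.
have IJ n : I n `<=` `]a, b[%classic.
  move=> x; rewrite /I /= !in_itv /= => /andP[h1 h2].
  by have := d0 n; have := d1 n; move=> ? ?; apply/andP; split; lra.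
have UI : \bigcup_n I n = `]a, b[%classic.
  apply/seteqP; split; first by move=> x [n _ /IJ].
  move=> x; rewrite /= in_itv /= => /andP[ax xb].
  pose e := Num.min (x - a) (b - x).
  have e0 : 0 < e by rewrite lt_min !subr_gt0 ax xb.
  have [n hn] : exists n : nat, d n < e.
    rewrite /d; have c0 : 0 < e / ((b - a) / 3) by rewrite divr_gt0// divr_gt0// subr_gt0.
    have [n _ hn] := near_infty_natSinv_lt (PosNum c0).
    exists n; have /= := hn n (leqnn n); rewrite ltr_pdivlMr ?divr_gt0 ?subr_gt0//.
    by rewrite mulrC.
  exists n => //; rewrite /I /= in_itv /=.
  by move: hn; rewrite lt_min => /andP[h1 h2]; apply/andP; split; lra.
have ndI : nondecreasing_seq I.
  apply/nondecreasing_seqP => n; apply/subsetPset => x; rewrite /I /= !in_itv /= => /andP[h1 h2].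
  have h : d n.+1 <= d n.
    rewrite /d ler_pM2l ?divr_gt0 ?subr_gt0// lef_pV2 ?posrE// ler_nat//.
  by apply/andP; split; lra.
have mI n : measurable (I n) by exact: measurable_itv.
apply/integrableP; split; first exact/measurable_EFinP.
have -> : (\int[mu]_(x in `]a, b[) `|(EFin \o f) x| = \int[mu]_(x in \bigcup_n I n) (f x)%:E)%E.
  rewrite UI; apply: eq_integral => x; rewrite inE /= in_itv /= => /f0 h.
  by rewrite ger0_norm.
have cv : (\int[mu]_(x in I n) (f x)%:E @[n --> \oo] --> \int[mu]_(x in \bigcup_n I n) (f x)%:E)%E.
  apply: ge0_nondecreasing_set_cvg_integral => //.
  - move=> n; apply/measurable_EFinP; apply: measurable_funS mf => //.
  - by move=> n x /IJ; rewrite /= in_itv /= => /f0; rewrite lee_fin.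
have le n : (\int[mu]_(x in I n) (f x)%:E <= (2 * M)%:E)%E.
  have dn := d0 n; have dn1 := d1 n.
  have lt : a + d n < b - d n by lra.
  rewrite (@continuous_FTC2 R f F)//; last first.
  - move=> x; rewrite in_itv /= => hx; have hx' : a < x < b by lra.
    by rewrite derive1E; have [_ ->] := dF x hx'.
  - have dif x : a < x < b -> derivable F x 1 by move=> /dF [].
    split; first by move=> x; rewrite in_itv /= => hx; apply: dif; lra.
    + apply: cvg_at_right_filter; apply: (@dv_cvg _ F _ (f (a + d n))).
      by apply: dF; lra.
    + apply: cvg_at_left_filter; apply: (@dv_cvg _ F _ (f (b - d n))).
      by apply: dF; lra.
  - by apply: (contin_within _ _ cf); lra.
  rewrite -EFinB lee_fin.
  have := FM (a + d n); have := FM (b - d n).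
  move=> /(_ ltac:(lra)) /ler_normlP[h1 h2] /(_ ltac:(lra)) /ler_normlP[h3 h4]; lra.
apply: le_lt_trans (ltry (2 * M)).
rewrite -(cvg_lim _ cv)//; apply: lime_le; first by apply/cvg_ex; eexists; exact: cv.
exact: nearW.
Qed.

End interval_integral.

(** * Functions with at most logarithmic growth at the endpoints *)

Section logb.
Context {R : realType}.
Implicit Types (a b c x k : R) (f g h : R -> R).

(** The summand [1] keeps the weight at least [1], so its powers grow with the exponent and bounds
    with different exponents can be added. *)
Definition logw a b x : R := 1 + `|ln (x - a)| + `|ln (b - x)|.

(* Continuous with at most power-of-logarithm blow-up at both ends; these
   functions form a ring and are integrable. *)
Definition logb a b f := contin a b f /\
  exists (C : R) (n : nat), 0 <= C /\ forall x, a < x < b -> `|f x| <= C * logw a b x ^+ n.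

Lemma logw_ge1 a b x : 1 <= logw a b x.
Proof. by rewrite /logw -addrA lerDl addr_ge0. Qed.

Lemma logw_ge0 a b x : 0 <= logw a b x.
Proof. exact: le_trans ler01 (logw_ge1 _ _ _). Qed.

Lemma contin_ext a b f g : (forall x, a < x < b -> f x = g x) ->
  contin a b f -> contin a b g.
Proof.
move=> fg cf x xab; rewrite -fg//; apply: cvg_trans (cf x xab).
by apply: near_eq_cvg; apply: filterS (near_oo xab) => y /fg.
Qed.

Lemma logb_ext a b f g : (forall x, a < x < b -> f x = g x) ->
  logb a b f -> logb a b g.
Proof.
move=> fg [cf [C [n [C0 h]]]]; split; first exact: contin_ext cf.
by exists C, n; split => // x xab; rewrite -fg//; exact: h.
Qed.

Lemma logb_le a b f g : contin a b f ->
  (forall x, a < x < b -> `|f x| <= g x) -> logb a b g -> logb a b f.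
Proof.
move=> cf fg [_ [C [n [C0 h]]]]; split => //; exists C, n; split => // x xab.
exact: le_trans (fg x xab) (le_trans (ler_norm _) (h x xab)).
Qed.

Lemma logb_cst a b k : logb a b (fun=> k).
Proof.
split; first by move=> x _; exact: cvg_cst.
by exists `|k|, 0%N; split => // x _; rewrite expr0 mulr1.
Qed.

Lemma logb_bounded a b f k : contin a b f -> (forall x, a < x < b -> `|f x| <= k) ->
  logb a b f.
Proof. by move=> cf fk; apply: (logb_le cf fk (logb_cst a b k)). Qed.

Lemma logbD a b f g : logb a b f -> logb a b g -> logb a b (fun x => f x + g x).
Proof.
move=> [cf [C [n [C0 hf]]]] [cg [D [m [D0 hg]]]]; split.
  by move=> x xab; apply: cvgD; [exact: cf|exact: cg].
exists (C + D), (n + m)%N; split; first exact: addr_ge0.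
move=> x xab; apply: le_trans (ler_normD _ _) _; rewrite mulrDl.
apply: lerD.
- apply: le_trans (hf x xab) _; apply: ler_wpM2l => //.
  by apply: ler_weXn2l; [exact: logw_ge1|exact: leq_addr].
- apply: le_trans (hg x xab) _; apply: ler_wpM2l => //.
  by apply: ler_weXn2l; [exact: logw_ge1|exact: leq_addl].
Qed.

Lemma logbM a b f g : logb a b f -> logb a b g -> logb a b (fun x => f x * g x).
Proof.
move=> [cf [C [n [C0 hf]]]] [cg [D [m [D0 hg]]]]; split.
  by move=> x xab; apply: cvgM; [exact: cf|exact: cg].
exists (C * D), (n + m)%N; split; first exact: mulr_ge0.
move=> x xab; rewrite normrM exprD mulrACA.
by apply: ler_pM => //; [exact: hf|exact: hg].
Qed.

Lemma logbN a b f : logb a b f -> logb a b (fun x => - f x).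
Proof.
by move=> hf; apply: logb_ext (logbM (logb_cst a b (-1)) hf) => x _; rewrite mulN1r.
Qed.

Lemma logbX a b f n : logb a b f -> logb a b (fun x => f x ^+ n).
Proof.
move=> hf; elim: n => [|n ih]; first exact: logb_ext (logb_cst a b 1).
by apply: logb_ext (logbM hf ih) => x _; rewrite exprS.
Qed.

Lemma logb_norm a b f : logb a b f -> logb a b (fun x => `|f x|).
Proof.
move=> [cf [C [n [C0 hf]]]]; split.
  by move=> x xab; apply: cvg_norm; exact: cf.
by exists C, n; split => // x xab; rewrite normr_id; exact: hf.
Qed.

Lemma logb_seg a b f : (forall x, a <= x <= b -> f y @[y --> x] --> f x) ->
  logb a b f.
Proof.
move=> cf; have [ab|ba] := leP a b; last first.
  split; first by move=> x h; lra.
  by exists 0, 0%N; split => // x h; lra.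
have cn : {within `[a, b], continuous (fun x => `|f x|)}.
  apply: continuous_in_subspaceT => x; rewrite inE /= in_itv /= => /cf h.
  exact: cvg_norm.
have [c _ hc] := EVT_max ab cn.
apply: (@logb_bounded _ _ _ `|f c|).
  by move=> x /andP[/ltW ax /ltW xb]; apply: cf; rewrite ax.
by move=> x /andP[/ltW ax /ltW xb]; apply: hc; rewrite in_itv /= ax.
Qed.

(** On the smaller interval the distances to the old endpoints lie between the distances to the new
    ones and [b - a], so the old weight is at most a constant times the new one. *)
Lemma logb_sub a b a' b' f : a <= a' -> b' <= b -> logb a b f -> logb a' b' f.
Proof.
move=> aa bb [cf [C [n [C0 hf]]]]; split.
  by move=> x xab; apply: cf; lra.
pose K := 1 + 2 * `|ln (b - a)|.
have n0 := normr_ge0 (ln (b - a)).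
exists (C * K ^+ n), n; split; first by rewrite mulr_ge0// exprn_ge0// /K; lra.
move=> x xab; apply: le_trans (hf x _) _; first by lra.
rewrite -mulrA -exprMn; apply: ler_wpM2l => //.
have lnb s t : 0 < s -> s <= t -> t <= b - a -> `|ln t| <= `|ln s| + `|ln (b - a)|.
  move=> s0 st tb; have t0 : 0 < t by lra.
  have l1 : ln s <= ln t by rewrite ler_ln ?posrE.
  have l2 : ln t <= ln (b - a) by rewrite ler_ln ?posrE//; lra.
  have := ler_norm (ln (b - a)); have := ler_norm (- ln s); rewrite normrN.
  have := normr_ge0 (ln s).
  by case: (ltP (ln t) 0) => [/ltr0_norm ->|/ger0_norm ->]; lra.
have h1 := @lnb (x - a') (x - a) ltac:(lra) ltac:(lra) ltac:(lra).
have h2 := @lnb (b' - x) (b - x) ltac:(lra) ltac:(lra) ltac:(lra).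
have w0 : logw a b x <= K * logw a' b' x.
  rewrite /K /logw.
  have p1 := normr_ge0 (ln (x - a')); have p2 := normr_ge0 (ln (b' - x)).
  have : 0 <= `|ln (b - a)| * (`|ln (x - a')| + `|ln (b' - x)|) by rewrite mulr_ge0// addr_ge0.
  by lra.
by apply: lerXn2r => //; rewrite nnegrE; [exact: logw_ge0|apply: le_trans w0; exact: logw_ge0].
Qed.

Lemma logb_shift a b k f : logb a b f -> logb (a - k) (b - k) (fun x => f (x + k)).
Proof.
move=> [cf [C [n [C0 hf]]]]; split.
  move=> x xab; apply: (@cvg_comp _ _ _ (fun y => y + k) f _ (nbhs (x + k))); last by apply: cf; lra.
  by apply: cvgD; [exact: cvg_id|exact: cvg_cst].
exists C, n; split => // x xab; have := hf (x + k) ltac:(lra).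
by rewrite /logw (_ : x + k - a = x - (a - k)) 1?(_ : b - (x + k) = b - k - x)//; ring.
Qed.

Lemma logb_refl a b k f : logb a b f -> logb (k - b) (k - a) (fun x => f (k - x)).
Proof.
move=> [cf [C [n [C0 hf]]]]; split.
  move=> x xab; apply: (@cvg_comp _ _ _ (fun y => k - y) f _ (nbhs (k - x))); last by apply: cf; lra.
  by apply: cvgB; [exact: cvg_cst|exact: cvg_id].
exists C, n; split => // x xab; have := hf (k - x) ltac:(lra).
rewrite /logw (_ : k - x - a = k - a - x); last by ring.
by rewrite (_ : b - (k - x) = x - (k - b)); [rewrite addrAC|ring].
Qed.

(** A zero of order at most one at each end costs only [ln (x - a)] and [ln (b - x)]; the upper
    bound [M] controls the logarithm from above. *)
Lemma logb_ln a b h (M c : R) : 0 < c -> contin a b h ->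
  (forall x, a < x < b -> c * (x - a) * (b - x) <= h x <= M) ->
  logb a b (fun x => ln (h x)).
Proof.
move=> c0 ch hM; have h0 x : a < x < b -> 0 < h x.
  move=> xab; have /andP[h1 _] := hM x xab; apply: lt_le_trans h1.
  by rewrite !mulr_gt0//; lra.
split.
  move=> x xab; apply: continuous_comp; first exact: ch.
  by apply: continuous_ln; exact: h0.
exists (1 + `|ln M| + `|ln c|), 1%N.
have nM := normr_ge0 (ln M); have nc := normr_ge0 (ln c).
split; first by lra.
move=> x xab; rewrite expr1; have /andP[h1 h2] := hM x xab; have h3 := h0 x xab.
have xa0 : 0 < x - a by lra.
have bx0 : 0 < b - x by lra.
have l1 : ln (h x) <= ln M by rewrite ler_ln ?posrE//; lra.
have l2 : ln c + ln (x - a) + ln (b - x) <= ln (h x).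
  by rewrite -!lnM ?posrE ?mulr_gt0// ler_ln ?posrE ?mulr_gt0.
have := ler_norm (ln M); have := ler_norm (- ln c); rewrite normrN.
have := ler_norm (- ln (x - a)); have := ler_norm (- ln (b - x)); rewrite !normrN.
rewrite /logw; have n1 := normr_ge0 (ln (x - a)); have n2 := normr_ge0 (ln (b - x)).
have p0 : 0 <= (`|ln M| + `|ln c|) * (`|ln (x - a)| + `|ln (b - x)|).
  by rewrite mulr_ge0// addr_ge0.
by case: (ltP (ln (h x)) 0) => [/ltr0_norm ->|/ger0_norm ->]; lra.
Qed.

(** The right-hand side is [K t^(- 1 / q)] written with [expR]: any power of a logarithm is beaten
    by any small negative power of [t] on a bounded range. *)
Lemma log_pow_bound (d : R) (n q : nat) : (0 < q)%N -> exists2 K : R, 0 <= K &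
  forall t : R, 0 < t <= d -> (1 + 2 * `|ln t|) ^+ n <= K * expR (- (ln t / q%:R)).
Proof.
move=> q0; have q1 : 0 < q%:R :> R by rewrite ltr0n.
(* Taking [n.+1] keeps [m] positive for [n = 0]. From [y <= m e^{y / m}], the choice of [m] turns
   the [N]-th power of the exponential into [e^{y / (2 q)}], and the factor [2] in [y] then yields
   the exponent [1 / q]. *)
pose N := n.+1; pose m : R := 2 * N%:R * q%:R.
have m0 : 0 < m by rewrite !mulr_gt0// ltr0n.
exists (m ^+ N * (expR (1 / (2 * q%:R)) * expR (2 * `|ln d| / q%:R))).
  by rewrite mulr_ge0 ?exprn_ge0 ?ltW// mulr_gt0 ?expR_gt0.
move=> t /andP[t0 td]; set y := 1 + _.
have y1 : 1 <= y by rewrite /y lerDl mulr_ge0.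
apply: le_trans (_ : y ^+ N <= _); first by apply: ler_weXn2l.
have : y <= m * expR (y / m).
  rewrite -ler_pdivrMl// mulrC; apply: le_trans (expR_ge1Dx _).
  by rewrite lerDr.
move=> h; apply: le_trans (_ : (m * expR (y / m)) ^+ N <= _).
  by apply: lerXn2r; rewrite ?nnegrE//; [lra|apply: le_trans h; lra].
rewrite exprMn -!mulrA; apply: ler_wpM2l; first by rewrite exprn_ge0 ?ltW.
rewrite -expRM_natl -!expRD ler_expR.
have -> : N%:R * (y / m) = y / (2 * q%:R).
  by rewrite /m; field; rewrite !gt_eqF//= ltr0n.
have ltd : ln t <= `|ln d|.
  by apply: le_trans (ler_norm _); rewrite ler_ln ?posrE//; lra.
rewrite /y -(ler_pM2r (_ : 0 < 2 * q%:R)); last by rewrite mulr_gt0.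
rewrite divfK; last by rewrite gt_eqF// mulr_gt0.
have -> : (1 / (2 * q%:R) + (2 * (`|ln d| / q%:R) + - (ln t / q%:R))) * (2 * q%:R) = 1 + 4 * `|ln d| - 2 * ln t.
  by field; rewrite gt_eqF.
have := normr_ge0 (ln d).
by case: (ltP (ln t) 0) => [/ltr0_norm ->|/ger0_norm ->]; lra.
Qed.

(** The integrand is [(x - a)^(- 1 / 2)]; its primitive [2 (x - a)^(1 / 2)] is bounded, which is all
    that [integ_ge0] asks for. *)
Lemma integ_invsqrt_left a b : integ a b (fun x => expR (- (ln (x - a) / 2))).
Proof.
apply: (@integ_ge0 _ _ _ _ (fun x => 2 * expR (ln (x - a) / 2)) (2 * expR (ln (b - a) / 2))).
- by move=> x xab; cvg_auto; lra.
- by move=> x _; exact: expR_ge0.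
- move=> x xab; have xa : 0 < x - a by lra.
  dv_auto => //.
  have e : expR (ln (x - a) / 2) = (x - a) * expR (- (ln (x - a) / 2)).
    by rewrite -{2}(@lnK _ (x - a)) ?posrE// -expRD; congr expR; field.
  by rewrite e; field; rewrite gt_eqF.
- move=> x xab; rewrite ger0_norm ?mulr_ge0 ?expR_ge0//.
  by rewrite ler_pM2l// ler_expR ler_pM2r ?invr_gt0// ler_ln ?posrE//; lra.
Qed.

Lemma integ_invsqrt_right a b : integ a b (fun x => expR (- (ln (b - x) / 2))).
Proof.
apply: (@integ_ge0 _ _ _ _ (fun x => - (2 * expR (ln (b - x) / 2))) (2 * expR (ln (b - a) / 2))).
- by move=> x xab; cvg_auto; lra.
- by move=> x _; exact: expR_ge0.
- move=> x xab; have xa : 0 < b - x by lra.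
  dv_auto => //.
  have e : expR (ln (b - x) / 2) = (b - x) * expR (- (ln (b - x) / 2)).
    by rewrite -{2}(@lnK _ (b - x)) ?posrE// -expRD; congr expR; field.
  by rewrite e; field; rewrite gt_eqF.
- move=> x xab; rewrite normrN ger0_norm ?mulr_ge0 ?expR_ge0//.
  by rewrite ler_pM2l// ler_expR ler_pM2r ?invr_gt0// ler_ln ?posrE//; lra.
Qed.

(** The larger of the two logarithms dominates; this separates the singularities at the two ends. *)
Lemma logw_pow a b x n : logw a b x ^+ n <=
  (1 + 2 * `|ln (x - a)|) ^+ n + (1 + 2 * `|ln (b - x)|) ^+ n.
Proof.
have p1 := normr_ge0 (ln (x - a)); have p2 := normr_ge0 (ln (b - x)).
have [h|h] := leP `|ln (x - a)| `|ln (b - x)|.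
- apply: le_trans (_ : (1 + 2 * `|ln (b - x)|) ^+ n <= _); last by rewrite lerDr exprn_ge0//; lra.
  by apply: lerXn2r; rewrite ?nnegrE /logw; lra.
- apply: le_trans (_ : (1 + 2 * `|ln (x - a)|) ^+ n <= _); last by rewrite lerDl exprn_ge0//; lra.
  by apply: lerXn2r; rewrite ?nnegrE /logw; lra.
Qed.

Lemma integ_logb a b f : logb a b f -> integ a b f.
Proof.
move=> [cf [C [n [C0 hf]]]].
have [K K0 hK] := @log_pow_bound (b - a) n 2 isT.
apply: (@integ_le _ _ _ _ (fun x => C * K * (expR (- (ln (x - a) / 2)) + expR (- (ln (b - x) / 2))))) => //; last first.
  by apply: integZ; apply: integD; [exact: integ_invsqrt_left|exact: integ_invsqrt_right].
move=> x xab; apply: le_trans (hf x xab) _; rewrite -mulrA; apply: ler_wpM2l => //.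
apply: le_trans (logw_pow _ _ _ _) _; rewrite mulrDr.
by apply: lerD; apply: hK; lra.
Qed.

Lemma logb_prim a b f : integ a b f -> logb a b (fun x => itg a x f).
Proof.
move=> hf; apply: (@logb_bounded _ _ _ (itg a b (fun x => `|f x|))).
  by move=> x xab; apply: (@prim_cvg _ a b).
move=> x /andP[ax xb]; have hx : integ a x f by apply: integ_sub hf => //; exact: ltW.
apply: le_trans (itg_norm hx) _.
rewrite (@itg_split _ a b x) ?(ltW ax) ?(ltW xb)//; last exact: integ_norm.
by rewrite lerDl; apply: itg_ge0.
Qed.

(** Near [a] the factor [f] is [O((x - a)^(- 1 / 4))] and the primitive is [O((x - a)^(1 / 2))].
    With [h] constant this also gives that [x - a] times any function of the class tends to [0],
    which settles most boundary terms below. *)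
Lemma logb_mul_prim0 a b f h : a < b -> logb a b f -> logb a b h ->
  f x * itg a x h @[x --> a^'+] --> (0 : R).
Proof.
move=> ab [cf [C [n [C0 hf]]]] lh; have [ch [D [m [D0 hh]]]] := lh.
have ih := integ_logb lh.
(* On the left half the logarithm of [b - x] is bounded; [Q] collects these bounds, and the weight
   reduces to a multiple of [1 + 2 |ln (x - a)|]. *)
pose e := (b - a) / 2; pose Q := 1 + `|ln (b - a)| + `|ln e|.
have e0 : 0 < e by rewrite /e; lra.
have Q1 : 1 <= Q by rewrite /Q -addrA lerDl addr_ge0.
have wQ x : a < x < a + e -> logw a b x <= Q * (1 + 2 * `|ln (x - a)|).
  move=> /andP[ax xe].
  have l1 : ln (b - x) <= ln (b - a) by rewrite ler_ln ?posrE; rewrite /e in xe; lra.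
  have l2 : ln e <= ln (b - x) by rewrite ler_ln ?posrE; rewrite /e in xe *; lra.
  have p1 := normr_ge0 (ln (x - a)).
  have q0 : 0 <= (`|ln (b - a)| + `|ln e|) * `|ln (x - a)| by rewrite mulr_ge0// addr_ge0.
  have := ler_norm (ln (b - a)); have := ler_norm (- ln e); rewrite normrN.
  have := normr_ge0 (ln (b - a)); have := normr_ge0 (ln e).
  rewrite /logw /Q.
  by case: (ltP (ln (b - x)) 0) => [/ltr0_norm ->|/ger0_norm ->]; lra.
have wp x p : a < x < a + e -> logw a b x ^+ p <= Q ^+ p * (1 + 2 * `|ln (x - a)|) ^+ p.
  move=> xa; rewrite -exprMn; apply: lerXn2r; rewrite ?nnegrE ?logw_ge0//; last exact: wQ.
  by apply: le_trans (wQ _ xa); exact: logw_ge0.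
(* Exponent [1 / 4] for [f] against [1 / 2] for [h]: after integrating [h], a factor
   [(x - a)^(1 / 4)] is left over. *)
have [K K0 hK] := @log_pow_bound e n 4 isT.
have [L L0 hL] := @log_pow_bound e m 2 isT.
pose Z := C * (Q ^+ n * K) * (D * (Q ^+ m * L) * 2).
have Q0 p : 0 <= Q ^+ p by rewrite exprn_ge0//; lra.
have Z0 : 0 <= Z by rewrite /Z !mulr_ge0.
have key x : a < x < a + e -> `|f x * itg a x h| <= Z * expR (ln (x - a) / 4).
  move=> xa; have xb : a < x < b by rewrite /e in xa; lra.
  have fx : `|f x| <= C * (Q ^+ n * K) * expR (- (ln (x - a) / 4)).
    apply: le_trans (hf x xb) _; rewrite -!mulrA; apply: ler_wpM2l => //.
    apply: le_trans (wp _ _ xa) _; apply: ler_wpM2l => //; apply: hK; lra.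
  have hx : `|itg a x h| <= D * (Q ^+ m * L) * 2 * expR (ln (x - a) / 2).
    have ihx : integ a x h by apply: integ_sub ih; lra.
    apply: le_trans (itg_norm ihx) _.
    apply: le_trans (_ : itg a x (fun y => D * (Q ^+ m * L) * expR (- (ln (y - a) / 2))) <= _).
      apply: le_itg; [exact: integ_norm|by apply: integZ; exact: integ_invsqrt_left|].
      move=> y ya; apply: le_trans (hh y _) _; first by lra.
      rewrite -!mulrA; apply: ler_wpM2l => //.
      apply: le_trans (wp _ _ _) _; first by lra.
      by apply: ler_wpM2l => //; apply: hL; lra.
    rewrite itgZ; last exact: integ_invsqrt_left.
    rewrite -!mulrA; do 3 (apply: ler_wpM2l => //).
    rewrite (@FTC _ a x _ (fun x => 2 * expR (ln (x - a) / 2)) 0 (2 * expR (ln (x - a) / 2))) ?subr0//.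
    - by lra.
    - exact: integ_invsqrt_left.
    - by move=> y ya; cvg_auto; lra.
    - move=> y ya; have y0 : 0 < y - a by lra.
      dv_auto => //.
      have ee : expR (ln (y - a) / 2) = (y - a) * expR (- (ln (y - a) / 2)).
        by rewrite -{2}(@lnK _ (y - a)) ?posrE// -expRD; congr expR; field.
      by rewrite ee; field; rewrite gt_eqF.
    - apply/cvgrPdist_le => /= eps eps0; near=> y.
      have ya : 0 < y - a by rewrite subr_gt0.
      rewrite sub0r normrN ger0_norm ?mulr_ge0 ?expR_ge0//.
      rewrite -ler_pdivlMl// -ler_ln ?posrE ?expR_gt0 ?mulr_gt0 ?invr_gt0// expRK.
      rewrite ler_pdivrMr// -(@expRK _ (_ * 2)) ler_ln ?posrE ?expR_gt0//.
      rewrite lerBlDl ltW//; near: y; apply: nbhs_right_lt.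
      by rewrite ltrDl expR_gt0.
    - by apply: cvg_at_left_filter; cvg_auto; lra.
  rewrite normrM; apply: le_trans (ler_pM _ _ fx hx) _ => //.
  have -> : expR (ln (x - a) / 4) = expR (- (ln (x - a) / 4)) * expR (ln (x - a) / 2).
    by rewrite -expRD; congr expR; field.
  by rewrite /Z le_eqVlt; apply/orP; left; apply/eqP; ring.
apply/cvgrPdist_le => /= eps eps0; near=> y.
have ya : 0 < y - a by rewrite subr_gt0.
rewrite sub0r normrN; apply: le_trans (key y _) _.
  apply/andP; split; first by rewrite -subr_gt0.
  by near: y; apply: nbhs_right_lt; rewrite ltrDl.
have Zp : 0 < Z + 1 by lra.
apply: le_trans (_ : (Z + 1) * expR (ln (y - a) / 4) <= _).
  by apply: ler_wpM2r; [exact: expR_ge0|lra].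
rewrite -ler_pdivlMl// -ler_ln ?posrE ?expR_gt0 ?mulr_gt0 ?invr_gt0// expRK.
rewrite ler_pdivrMr// -(@expRK _ (_ * 4)) ler_ln ?posrE ?expR_gt0//.
rewrite lerBlDl ltW//; near: y; apply: nbhs_right_lt.
by rewrite ltrDl expR_gt0.
Unshelve. all: end_near. Qed.

End logb.

Lemma logb_id {R : realType} (a b : R) : logb a b (fun x => x).
Proof. by apply: logb_seg => x _; exact: cvg_id. Qed.

Ltac logb_hook := fail.
Ltac logb_core := lazymatch goal with
  | |- logb _ _ (fun _ => ?k) => apply logb_cst
  | |- logb _ _ (fun x => x) => apply logb_id
  | |- logb _ _ (fun x => @?f x + @?g x) => apply (@logbD _ _ _ f g)
  | |- logb _ _ (fun x => - @?f x) => apply (@logbN _ _ _ f)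
  | |- logb _ _ (fun x => @?f x * @?g x) => apply (@logbM _ _ _ f g)
  | |- logb _ _ (fun x => @?f x ^+ ?n) => apply (@logbX _ _ _ f n)
  end.
Ltac logb_auto := repeat (first [ assumption | logb_core | logb_hook ]; cbv beta).

(** * Substitution, parameter integrals and exchange of order over a triangle *)

Section integral_tools.
Context {R : realType}.
Notation mu := (@lebesgue_measure R).
Implicit Types (a b c x k : R) (f g h : R -> R).

Lemma FTC_logb a b f (F : R -> R) (la lb : R) : a < b -> logb a b f ->
  (forall x, a < x < b -> dv F x (f x)) ->
  F x @[x --> a^'+] --> la -> F x @[x --> b^'-] --> lb -> itg a b f = lb - la.
Proof. by move=> ab hf; apply: FTC => //; [exact: integ_logb|exact: hf.1]. Qed.

Lemma dv_prim_logb a b f x : a < x < b -> logb a b f ->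
  dv (fun y => itg a y f) x (f x).
Proof. by move=> xab hf; apply: (@dv_prim _ a b) => //; [exact: integ_logb|exact: hf.1]. Qed.

(** The strict inequality puts [phi x] into the punctured one-sided neighbourhood, where limits of
    primitives are known; the next three lemmas are its mirror images. *)
Lemma at_left_comp (phi : R -> R) b d c : c < b ->
  phi x @[x --> b^'-] --> d -> (forall x, c < x < b -> phi x < d) ->
  phi x @[x --> b^'-] --> d^'-.
Proof.
move=> cb hphi lt P [e /= e0 he]; change (\forall x \near b^'-, P (phi x)).
have h1 : \forall x \near b^'-, `|d - phi x| < e by move/cvgrPdist_lt : hphi; apply.
near=> x; apply: he; first by rewrite /=; near: x.
by apply: lt; apply/andP; split => //; near: x; exact: nbhs_left_gt.
Unshelve. all: end_near. Qed.

Lemma at_right_comp (phi : R -> R) a c d : a < d ->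
  phi x @[x --> a^'+] --> c -> (forall x, a < x < d -> c < phi x) ->
  phi x @[x --> a^'+] --> c^'+.
Proof.
move=> cb hphi lt P [e /= e0 he]; change (\forall x \near a^'+, P (phi x)).
have h1 : \forall x \near a^'+, `|c - phi x| < e by move/cvgrPdist_lt : hphi; apply.
near=> x; apply: he; first by rewrite /=; near: x.
by apply: lt; apply/andP; split => //; near: x; exact: nbhs_right_lt.
Unshelve. all: end_near. Qed.

Lemma at_leftr_comp (phi : R -> R) b d c : c < b ->
  phi x @[x --> b^'-] --> d -> (forall x, c < x < b -> d < phi x) ->
  phi x @[x --> b^'-] --> d^'+.
Proof.
move=> cb hphi lt P [e /= e0 he]; change (\forall x \near b^'-, P (phi x)).
have h1 : \forall x \near b^'-, `|d - phi x| < e by move/cvgrPdist_lt : hphi; apply.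
near=> x; apply: he; first by rewrite /=; near: x.
by apply: lt; apply/andP; split => //; near: x; exact: nbhs_left_gt.
Unshelve. all: end_near. Qed.

Lemma at_rightl_comp (phi : R -> R) a c d : a < d ->
  phi x @[x --> a^'+] --> c -> (forall x, a < x < d -> phi x < c) ->
  phi x @[x --> a^'+] --> c^'-.
Proof.
move=> cb hphi lt P [e /= e0 he]; change (\forall x \near a^'+, P (phi x)).
have h1 : \forall x \near a^'+, `|c - phi x| < e by move/cvgrPdist_lt : hphi; apply.
near=> x; apply: he; first by rewrite /=; near: x.
by apply: lt; apply/andP; split => //; near: x; exact: nbhs_right_lt.
Unshelve. all: end_near. Qed.

(** The primitive of [f] composed with [phi] is a primitive of the transformed integrand, and its
    limits at both ends are known from those of [phi]. *)
Lemma subst_inc a b c d (phi phi' : R -> R) f : a < b -> c < d ->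
  (forall x, a < x < b -> dv phi x (phi' x)) ->
  (forall x, a < x < b -> c < phi x < d) ->
  phi x @[x --> a^'+] --> c -> phi x @[x --> b^'-] --> d ->
  logb c d f -> logb a b (fun x => f (phi x) * phi' x) ->
  itg a b (fun x => f (phi x) * phi' x) = itg c d f.
Proof.
move=> ab cd dphi bphi pa pb lf lg.
rewrite (@FTC_logb _ _ _ (fun x => itg c (phi x) f) 0 (itg c d f)) ?subr0//.
- move=> x xab; apply: (@dv_comp _ (fun y => itg c y f) phi x _ _ _ (dphi x xab)).
  by apply: dv_prim_logb lf; exact: bphi.
- apply: (cvg_comp _ (fun y => itg c y f) (at_right_comp ab pa _)).
    by move=> x /bphi /andP[].
  exact/cvg_at_right_filter/(prim0 cd (integ_logb lf)).
- apply: (cvg_comp _ (fun y => itg c y f) (at_left_comp ab pb _)).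
    by move=> x /bphi /andP[].
  exact: (prim_left cd (integ_logb lf)).
Qed.

Lemma subst_dec a b c d (phi phi' : R -> R) f : a < b -> c < d ->
  (forall x, a < x < b -> dv phi x (phi' x)) ->
  (forall x, a < x < b -> c < phi x < d) ->
  phi x @[x --> a^'+] --> d -> phi x @[x --> b^'-] --> c ->
  logb c d f -> logb a b (fun x => f (phi x) * phi' x) ->
  itg a b (fun x => f (phi x) * phi' x) = - itg c d f.
Proof.
move=> ab cd dphi bphi pa pb lf lg.
rewrite (@FTC_logb _ _ _ (fun x => itg c (phi x) f) (itg c d f) 0) ?sub0r//.
- move=> x xab; apply: (@dv_comp _ (fun y => itg c y f) phi x _ _ _ (dphi x xab)).
  by apply: dv_prim_logb lf; exact: bphi.
- apply: (cvg_comp _ (fun y => itg c y f) (at_rightl_comp ab pa _)).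
    by move=> x /bphi /andP[].
  exact: (prim_left cd (integ_logb lf)).
- apply: (cvg_comp _ (fun y => itg c y f) (at_leftr_comp ab pb _)).
    by move=> x /bphi /andP[].
  exact/cvg_at_right_filter/(prim0 cd (integ_logb lf)).
Qed.

Lemma itg_refl a b k f : logb a b f ->
  itg (k - b) (k - a) (fun x => f (k - x)) = itg a b f.
Proof.
move=> hf; have [ab|ba] := ltP a b; last by rewrite !itg_nil//; lra.
have l0 := logb_refl k hf.
have l1 : logb (k - b) (k - a) (fun x => f (k - x) * (-1)).
  by apply: logbM => //; exact: logb_cst.
have := @subst_dec (k - b) (k - a) a b (fun x => k - x) (fun=> -1) f.
move=> /(_ ltac:(lra) ab) /(_ ltac:(move=> x _; dv_auto; ring)).
move=> /(_ ltac:(move=> x h; lra)).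
have ca : k - x @[x --> (k - b)^'+] --> b by apply: cvg_at_right_filter; cvg_auto; ring.
have cb : k - x @[x --> (k - a)^'-] --> a by apply: cvg_at_left_filter; cvg_auto; ring.
move=> /(_ ca cb hf l1) h; apply: oppr_inj; rewrite -h -itgN; last exact: integ_logb.
by apply: itg_ext => x _; rewrite mulrN1.
Qed.

Lemma itg_shift a b k f : logb a b f ->
  itg (a - k) (b - k) (fun x => f (x + k)) = itg a b f.
Proof.
move=> hf; have [ab|ba] := ltP a b; last by rewrite !itg_nil//; lra.
have l0 := logb_shift k hf.
have l1 : logb (a - k) (b - k) (fun x => f (x + k) * 1).
  by apply: logbM => //; exact: logb_cst.
have := @subst_inc (a - k) (b - k) a b (fun x => x + k) (fun=> 1) f.
move=> /(_ ltac:(lra) ab) /(_ ltac:(move=> x _; dv_auto; ring)).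
move=> /(_ ltac:(move=> x h; lra)).
have ca : x + k @[x --> (a - k)^'+] --> a by apply: cvg_at_right_filter; cvg_auto; ring.
have cb : x + k @[x --> (b - k)^'-] --> b by apply: cvg_at_left_filter; cvg_auto; ring.
by move=> /(_ ca cb hf l1) <-; apply: itg_ext => x _; rewrite mulr1.
Qed.

Lemma logb_scale a b k f : 0 < k -> logb (k * a) (k * b) f ->
  logb a b (fun x => f (k * x)).
Proof.
move=> k0 [cf [C [n [C0 hf]]]].
have kab x : a < x < b -> k * a < k * x < k * b by rewrite !(ltr_pM2l k0).
split.
  move=> x xab; apply: (@cvg_comp _ _ _ (fun y => k * y) f _ (nbhs (k * x))); last exact/cf/kab.
  by apply: cvgM; [exact: cvg_cst|exact: cvg_id].
pose K := 1 + 2 * `|ln k|; have nk := normr_ge0 (ln k).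
exists (C * K ^+ n), n; split; first by rewrite mulr_ge0// exprn_ge0// /K; lra.
move=> x xab; apply: le_trans (hf _ (kab x xab)) _.
rewrite -mulrA -exprMn; apply: ler_wpM2l => //.
have w0 : logw (k * a) (k * b) (k * x) <= K * logw a b x.
  rewrite /K /logw -!mulrBr !lnM ?posrE//; try lra.
  have p1 := ler_normD (ln k) (ln (x - a)); have p2 := ler_normD (ln k) (ln (b - x)).
  have : 0 <= `|ln k| * (`|ln (x - a)| + `|ln (b - x)|) by rewrite mulr_ge0// addr_ge0.
  by lra.
by apply: lerXn2r => //; rewrite nnegrE; [exact: logw_ge0|apply: le_trans w0; exact: logw_ge0].
Qed.

Lemma itg_scale a b k f : 0 < k -> logb (k * a) (k * b) f ->
  itg a b (fun x => f (k * x)) = k^-1 * itg (k * a) (k * b) f.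
Proof.
move=> k0 hf; have [ab|ba] := ltP a b; last first.
  by rewrite !itg_nil ?mulr0// ler_pM2l.
have l0 := logb_scale k0 hf.
have l1 : logb a b (fun x => f (k * x) * k).
  by apply: logbM => //; exact: logb_cst.
have := @subst_inc a b (k * a) (k * b) (fun x => k * x) (fun=> k) f ab.
rewrite (ltr_pM2l k0) => /(_ ab) /(_ ltac:(move=> x _; dv_auto; ring)).
move=> /(_ ltac:(move=> x h; rewrite !(ltr_pM2l k0)//)).
have ca : k * x @[x --> a^'+] --> k * a by apply: cvg_at_right_filter; cvg_auto.
have cb : k * x @[x --> b^'-] --> k * b by apply: cvg_at_left_filter; cvg_auto.
move=> /(_ ca cb hf l1) <-; rewrite -itgZ; last exact: integ_logb.
by apply: itg_ext => x _; field; rewrite gt_eqF.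
Qed.

Lemma mvt_bound u v (f f' : R -> R) M x y : u < x < v -> u < y < v ->
  (forall t, u < t < v -> dv f t (f' t)) -> (forall t, u < t < v -> `|f' t| <= M) ->
  `|f x - f y| <= M * `|x - y|.
Proof.
wlog xy : x y / y < x => [hw|] hx hy df bf.
  have [xy|yx|->] := ltgtP x y; [|exact: hw|by rewrite !subrr normr0 mulr0].
  by rewrite distrC [in leRHS]distrC; exact: hw.
have sub t : y <= t <= x -> u < t < v.
  by move: hx hy => /andP[? ?] /andP[? ?] /andP[? ?]; apply/andP; split; lra.
have [||c cxy ->] := @MVT R f f' y x xy.
- by move=> t; rewrite in_itv /= => /andP[/ltW ? /ltW ?]; apply/df/sub/andP.
- apply: derivable_within_continuous => t; rewrite in_itv /= => /sub /df [].
  by [].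
- rewrite normrM; apply: ler_wpM2r => //; apply/bf/sub.
  by move: cxy; rewrite in_itv /= => /andP[/ltW -> /ltW ->].
Qed.

Lemma dv_under a b u v c (F F' : R -> R -> R) (G : R -> R) : u < c < v ->
  (forall t, u < t < v -> integ a b (F t)) ->
  (forall t w, u < t < v -> a < w < b -> dv (fun s => F s w) t (F' t w)) ->
  (forall t w, u < t < v -> a < w < b -> `|F' t w| <= G w) -> integ a b G ->
  dv (fun t => itg a b (F t)) c (itg a b (F' c)).
Proof.
move=> cuv iF dF bF iG.
have mab : measurable (`]a, b[%classic : set (measurableTypeR R)) by exact: measurable_itv.
have Ic : `]u, v[%classic c by rewrite /= in_itv.
have i1 t : `]u, v[%classic t -> mu.-integrable `]a, b[ (EFin \o F t).
  by rewrite /= in_itv /=; exact: iF.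
have d1 t w : `]u, v[%classic t -> `]a, b[%classic w -> derivable (F ^~ w) t 1.
  by rewrite /= !in_itv /= => h1 h2; have [] := dF t w h1 h2.
have e1 t w : u < t < v -> a < w < b -> partial1of2 F t w = F' t w.
  by move=> h1 h2; rewrite partial1of2E; have [_ ->] := dF t w h1 h2.
have b1 t w : `]u, v[%classic t -> `]a, b[%classic w -> `|partial1of2 F t w| <= `|G w|.
  rewrite /= !in_itv /= => h1 h2; rewrite e1//.
  exact: le_trans (bF t w h1 h2) (ler_norm _).
have dd := @derivable_under_integral R _ _ mu F _ mab c u v Ic i1 d1
  (fun w => `|G w|) (fun w => normr_ge0 _) (integ_norm iG) b1.
have de := @differentiation_under_integral R _ _ mu F _ mab c u v Ic i1 d1
  (fun w => `|G w|) (fun w => normr_ge0 _) (integ_norm iG) b1.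
split; first exact: dd.
rewrite -derive1E [LHS]de; apply: itg_ext => w wab.
by rewrite e1.
Qed.

Lemma cvg_under a b u v c (F : R -> R -> R) (G : R -> R) : u < c < v ->
  (forall t, u < t < v -> integ a b (F t)) ->
  (forall t w, u < t < v -> a < w < b -> F s w @[s --> t] --> F t w) ->
  (forall t w, u < t < v -> a < w < b -> `|F t w| <= G w) -> integ a b G ->
  itg a b (F t) @[t --> c] --> itg a b (F c).
Proof.
move=> cuv iF cF bF iG.
have mab : measurable (`]a, b[%classic : set (measurableTypeR R)) by exact: measurable_itv.
have i1 t : `]u, v[%classic t -> mu.-integrable `]a, b[ (EFin \o F t).
  by rewrite /= in_itv /=; exact: iF.
have c1 : {ae mu, forall y, `]a, b[%classic y -> {in `]u, v[%classic, continuous (F ^~ y)}}.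
  apply/aeW => w; rewrite /= in_itv /= => wab t; rewrite inE /= in_itv /= => tuv.
  exact: cF.
have b1 t : `]u, v[%classic t -> {ae mu, forall w, `]a, b[%classic w -> `|F t w| <= G w}.
  by rewrite /= in_itv /= => h; apply/aeW => w; rewrite /= in_itv /=; exact: bF.
apply: (@continuity_under_integral R _ _ mu F _ mab u v i1 c1 G iG b1).
by rewrite inE /= in_itv.
Qed.

(** The difference quotient of [E] at [c] is bounded by [|h|], which tends to [0]. *)
Lemma dv_small (E h : R -> R) c : E c = 0 -> h x @[x --> c] --> (0 : R) ->
  (\forall x \near c, `|E x| <= `|x - c| * `|h x|) -> dv E c 0.
Proof.
move=> E0 h0 bE.
have L : t^-1 *: (E (t *: 1 + c) - E c) @[t --> 0^'] --> (0 : R).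
  apply/cvgrPdist_le => /= eps eps0.
  have : \forall x \near c, `|E x| <= `|x - c| * eps.
    move/cvgrPdist_le : h0 => /(_ eps eps0) h1; near=> x.
    apply: le_trans (_ : `|x - c| * `|h x| <= _); first by near: x.
    apply: ler_wpM2l => //; rewrite -normrN -sub0r; near: x; exact: h1.
  move=> /nbhs_ballP[d /= d0 hd].
  exists d => //= t; rewrite /= sub0r normrN => td t0.
  rewrite E0 subr0 sub0r normrN /GRing.scale /= mulr1 normrM normfV.
  rewrite ler_pdivrMl ?normr_gt0//.
  have := hd (t + c); rewrite /ball /= => /(_ _).
  by rewrite opprD addrC addrNK normrN addrK; apply.
split; first by apply/cvg_ex; exists 0.
exact: (cvg_lim _ L).
Unshelve. all: end_near. Qed.

(** The first term comes from moving the endpoint with the integrand frozen at [c], the second from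
    moving the parameter with the endpoint frozen at [b c]; what remains is a mixed second
    difference of derivative [0]. *)
Lemma leibniz a B u v c (F F' : R -> R -> R) (b G : R -> R) b' : u < c < v ->
  a < b c < B -> dv b c b' ->
  (forall t, u < t < v -> integ a B (F t)) ->
  (forall t w, u < t < v -> a < w < B -> dv (fun s => F s w) t (F' t w)) ->
  (forall t w, u < t < v -> a < w < B -> `|F' t w| <= G w) -> integ a B G ->
  F c y @[y --> b c] --> F c (b c) ->
  dv (fun t => itg a (b t) (F t)) c (F c (b c) * b' + itg a (b c) (F' c)).
Proof.
move=> cuv bB db iF dF bF iG cF.
have bcB : b c <= B by lra.
have iFc t : u < t < v -> integ a (b c) (F t).
  by move=> tu; apply: integ_sub (iF t tu).
have d1 : dv (fun t => itg a (b t) (F c)) c (F c (b c) * b').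
  apply: (@dv_comp _ (fun y => itg a y (F c)) b c _ _ _ db); apply: (@dv_prim _ a B) => //; exact: iF.
have d2 : dv (fun t => itg a (b c) (F t)) c (itg a (b c) (F' c)).
  apply: (@dv_under _ _ u v _ _ _ G) => //.
  - by move=> t w tu wa; apply: dF => //; lra.
  - by move=> t w tu wa; apply: bF => //; lra.
  - exact: integ_sub iG.
(* The mixed second difference: the integral of [F t - F c] between [b c] and [b t], up to
   orientation. *)
pose E t := itg a (b t) (F t) - itg a (b t) (F c) - (itg a (b c) (F t) - itg a (b c) (F c)).
have d3 : dv E c 0.
  apply: (@dv_small _ (fun t => itg a (b t) G - itg a (b c) G)).
  - by rewrite /E; ring.
  - rewrite -(subrr (itg a (b c) G)); apply: cvgB; last exact: cvg_cst.
    apply: (cvg_comp _ (fun y => itg a y G) (dv_cvg db)).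
    exact: (prim_cvg bB iG).
  - have nb : \forall t \near c, a < b t < B by exact: (dv_cvg db) (near_oo bB).
    near=> t.
    have tu : u < t < v by near: t; exact: near_oo.
    have tb : a < b t < B by near: t.
    (* By the mean value theorem in the parameter the integrand is at most [|t - c| * G]; the
       integral of [G] over the shrinking range supplies the second small factor. *)
    have key y z : a < y -> y <= z -> z < B ->
        `|itg y z (F t) - itg y z (F c)| <= `|t - c| * (itg a z G - itg a y G).
      move=> ay yz zB; have iy : integ a z G by apply: integ_sub iG => //; exact: ltW.
      have it s : u < s < v -> integ y z (F s) by move=> su; apply: integ_sub (iF s su); lra.
      have iG' : integ y z G by apply: integ_sub iG; lra.
      rewrite (@itg_split _ a z y G)//; last by rewrite yz (ltW ay).
      rewrite [X in _ * X]addrC addKr.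
      rewrite -itgB; [|exact: it|exact: it].
      have id : integ y z (fun x => F t x - F c x).
        by apply: integD; [exact: it|apply: integN; exact: it].
      apply: le_trans (itg_norm id) _; rewrite -itgZ//.
      apply: le_itg; [exact: integ_norm|exact: integZ|].
      move=> w wyz; rewrite mulrC.
      apply: (@mvt_bound u v (fun s => F s w) (fun s => F' s w)) => //.
        by move=> s su; apply: dF => //; lra.
      by move=> s su; apply: bF => //; lra.
    have sp y z f : a < y -> y <= z -> z < B -> integ a B f -> itg a z f = itg a y f + itg y z f.
      by move=> ay yz zB ift; apply: itg_split; [lra|apply: integ_sub ift; lra].
    case/andP: (tb) => a1 a2; case/andP: (bB) => a3 a4.
    rewrite /E; have [le|/ltW le] := leP (b t) (b c).
    + rewrite (sp (b t) (b c) (F t)) ?(sp (b t) (b c) (F c)); try (exact: iF); try lra.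
      have k1 := key (b t) (b c) a1 le a4.
      rewrite (_ : _ - _ = - (itg (b t) (b c) (F t) - itg (b t) (b c) (F c))); last by ring.
      rewrite normrN; apply: le_trans k1 _; apply: ler_wpM2l => //.
      by rewrite -normrN opprB; exact: ler_norm.
    + rewrite (sp (b c) (b t) (F t)) ?(sp (b c) (b t) (F c)); try (exact: iF); try lra.
      have k1 := key (b c) (b t) a3 le a2.
      rewrite (_ : _ - _ = (itg (b c) (b t) (F t) - itg (b c) (b t) (F c))); last by ring.
      apply: le_trans k1 _; apply: ler_wpM2l => //; exact: ler_norm.
have := dvD (dvD d1 d2) d3; rewrite addr0 => hd.
have : dv (fun t => itg a (b t) (F t) + itg a (b c) (F c)) c (F c (b c) * b' + itg a (b c) (F' c)).
  by congr (dv _ _ _) : hd; apply/funext => t; rewrite /E; ring.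
move=> /(dvD (dv_cst (- itg a (b c) (F c)) c)); rewrite add0r.
by congr (dv _ _ _); apply/funext => t; ring.
Unshelve. all: end_near. Qed.

(** Tonelli for the kernel extended by [0] outside the open triangle. Integrability of the slices
    makes the inner extended integrals finite, hence equal to the real-valued ones. *)
Lemma itg_triangle a b (k : R -> R -> R) :
  measurable_fun [set: R * R] (fun z => k z.1 z.2) ->
  (forall x y, a < x -> x < y -> y < b -> 0 <= k x y) ->
  (forall x, a < x < b -> integ x b (k x)) ->
  (forall y, a < y < b -> integ a y (fun x => k x y)) ->
  itg a b (fun x => itg x b (k x)) = itg a b (fun y => itg a y (fun x => k x y)).
Proof.
move=> mk k0 i1 i2.
pose T : set (R * R) := [set z | a < z.1 /\ z.1 < z.2 /\ z.2 < b].
have mlt (p q : R * R -> R) : measurable_fun setT p -> measurable_fun setT q ->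
    measurable ([set z | p z < q z] : set (R * R)).
  move=> mp mq; have := measurable_fun_ltr mp mq.
  by move=> /(_ measurableT [set true] ltac:(by [])); rewrite setTI.
have mT : measurable (T : set (R * R)).
  rewrite /T; apply: measurableI; first by apply: mlt.
  by apply: measurableI; apply: mlt.
pose K z : \bar R := ((fun z => (k z.1 z.2)%:E) \_ T)%E z.
have mK : measurable_fun setT K.
  apply/(measurable_restrictT _ mT); apply: measurable_funTS.
  exact/measurable_EFinP.
have K0 z : (0 <= K z)%E.
  rewrite /K; apply: erestrict_ge0 => y [h1 [h2 h3]]; rewrite lee_fin; exact: k0.
have := @fubini_tonelli _ _ _ _ R mu mu K mK K0.
have e1 x : (\int[mu]_y K (x, y) = ((fun x => (itg x b (k x))%:E) \_ `]a, b[) x)%E.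
  have [xab|xab] := boolP (a < x < b).
  - rewrite [RHS]patchT; last by rewrite inE /= in_itv.
    have -> : (fun y => K (x, y)) = ((fun y => (k x y)%:E) \_ `]x, b[)%E.
      apply/funext => y; rewrite /K; have [xy|xy] := boolP (x < y < b).
        rewrite !patchT// ?inE /= ?in_itv//= /T /=.
        by case/andP: xab => -> _; case/andP: xy.
      rewrite !patchN// ?notin_setE /= ?in_itv /=; first exact/negP.
      by rewrite /T /= => -[_ [h1 h2]]; move: xy; rewrite h1 h2.
    rewrite -integral_mkcond; have := i1 x xab => ik.
    by rewrite /itg /Rintegral fineK//; exact: integrable_fin_num.
  - rewrite [RHS]patchN; last by rewrite notin_setE /= in_itv /=; exact/negP.
    apply: integral0_eq => y _; rewrite /K patchN// notin_setE /T /= => -[h1 [h2 h3]].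
    by move: xab; rewrite h1 (lt_trans h2 h3).
have e2 y : (\int[mu]_x K (x, y) = ((fun y => (itg a y (fun x => k x y))%:E) \_ `]a, b[) y)%E.
  have [yab|yab] := boolP (a < y < b).
  - rewrite [RHS]patchT; last by rewrite inE /= in_itv.
    have -> : (fun x => K (x, y)) = ((fun x => (k x y)%:E) \_ `]a, y[)%E.
      apply/funext => x; rewrite /K; have [xy|xy] := boolP (a < x < y).
        rewrite !patchT// ?inE /= ?in_itv//= /T /=.
        by case/andP: yab => _ ->; case/andP: xy.
      rewrite !patchN// ?notin_setE /= ?in_itv /=; first exact/negP.
      by rewrite /T /= => -[h1 [h2 _]]; move: xy; rewrite h1 h2.
    rewrite -integral_mkcond; have := i2 y yab => ik.
    by rewrite /itg /Rintegral fineK//; exact: integrable_fin_num.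
  - rewrite [RHS]patchN; last by rewrite notin_setE /= in_itv /=; exact/negP.
    apply: integral0_eq => x _; rewrite /K patchN// notin_setE /T /= => -[h1 [h2 h3]].
    by move: yab; rewrite (lt_trans h1 h2) h3.
under eq_integral do rewrite e1.
under [in X in _ = X -> _]eq_integral do rewrite e2.
by rewrite -!integral_mkcond /itg /Rintegral => ->.
Qed.

End integral_tools.

(** * Derivatives after a shift or a reflection of the variable *)

Section derivative_shift.
Context {R : realType}.
Implicit Types (c x d : R) (k : R -> R).

Lemma dv_shift k c x d : dv k (x - c) d -> dv (fun s => k (s - c)) x d.
Proof.
move=> h; have hs : dv (fun s : R => s - c) x 1 by dv_auto; ring.
by apply: dv_eq (@dv_comp _ k _ x _ _ h hs) _; rewrite mulr1.
Qed.

Lemma dv_flip k c x d : dv k (c - x) d -> dv (fun s => k (c - s)) x (- d).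
Proof.
move=> h; have hs : dv (fun s : R => c - s) x (-1) by dv_auto; ring.
by apply: dv_eq (@dv_comp _ k _ x _ _ h hs) _; rewrite mulrN1.
Qed.

End derivative_shift.

(** * Logarithmic growth of [lsin] and [lcos], cancellation of the pole of the cotangent *)

Section logb_trig.
Context {R : realType}.
Implicit Types (a b c x k : R).

(** The function [sin t - t cos t] vanishes at [0] and has derivative [t sin t]. *)
Lemma sin_ge_cos x : 0 <= x <= pi / 2 -> x * cos x <= sin x.
Proof.
move=> /andP[x0 xp]; have := @pi_gt0 R => p0.
have [->|xn0] := eqVneq x 0; first by rewrite mul0r sin0.
have x1 : 0 < x by rewrite lt_neqAle eq_sym xn0.
have [||c cx] := @MVT R (fun t => sin t - t * cos t) (fun t => t * sin t) 0 x x1.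
- by move=> t _; rewrite -/(dv _ _ _); dv_auto; ring.
- apply: derivable_within_continuous => t _.
  suff [] : dv (fun t => sin t - t * cos t) t (t * sin t) by [].
  by dv_auto; ring.
- rewrite sin0 mul0r subrr subr0 => e.
  rewrite -subr_ge0 e subr0 mulr_ge0 ?(ltW x1)//.
  move: cx; rewrite in_itv /= => /andP[c0 cx].
  by rewrite mulr_ge0 ?(ltW c0)// ltW// sin_pos//; apply/andP; split; lra.
Qed.

(** A parabola with simple zeros at [0] and [pi] is exactly the lower bound that [logb_ln] requires
    of [2 sin x]. *)
Lemma sin_lb x : 0 < x < pi -> x * (pi - x) / (2 * pi) <= sin x.
Proof.
move=> /andP[x0 xp]; have p0 := @pi_gt0 R.
(* Doubling gives [sin y = 2 sin (y / 2) cos (y / 2) >= y cos^2 (y / 2)], and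
   [cos^2 (y / 2) >= 1 / 2] because [cos y >= 0]. *)
have half (y : R) : 0 < y -> y <= pi / 2 -> y / 2 <= sin y.
  move=> y0 yp; have h := @sin_ge_cos (y / 2) ltac:(lra).
  have c0 : 0 <= cos (y / 2) by apply: cos_ge0_pihalf; lra.
  have cy : 0 <= cos y by apply: cos_ge0_pihalf; lra.
  have e : y = 2 * (y / 2) by field.
  move: cy; rewrite [in X in X -> _]e cos2x => cy.
  have : (y / 2) * cos (y / 2) * cos (y / 2) <= sin (y / 2) * cos (y / 2) by apply: ler_wpM2r.
  rewrite [in X in _ -> _ <= X]e sin2x => h2.
  have h3 : y * (1 / 2) <= y * cos (y / 2) ^+ 2 by rewrite ler_pM2l//; lra.
  by rewrite expr2 in h3; lra.
have [xh|xh] := leP x (pi / 2).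
- apply: le_trans (half x x0 xh); rewrite ler_pdivrMr ?mulr_gt0//.
  rewrite [leRHS](_ : _ = x * pi); last by field.
  by rewrite ler_pM2l//; lra.
- rewrite -sinBpi; apply: le_trans (half (pi - x) _ _); [|lra|lra].
  rewrite ler_pdivrMr ?mulr_gt0// [leRHS](_ : _ = pi * (pi - x)); last by field.
  by rewrite ler_pM2r//; lra.
Qed.

Lemma lsin_logb a b : 0 <= a -> b <= pi -> logb a b lsin.
Proof.
move=> a0 bp; apply: (logb_sub a0 bp); have p0 := @pi_gt0 R.
apply: (@logb_ln _ 0 pi (fun x => 2 * sin x) 2 (1 / pi)).
- by rewrite divr_gt0.
- by move=> x _; cvg_auto.
- move=> x xp; have := sin_lb xp; have := sin_le1 x; rewrite subr0.
  have -> : x * (pi - x) / (2 * pi) = 1 / pi * x * (pi - x) / 2 by gen_pi; fld.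
  by lra.
Qed.

Lemma lcos_logb a b : - (pi / 2) <= a -> b <= pi / 2 -> logb a b lcos.
Proof.
move=> a0 bp; apply: (@logb_sub _ (0 - pi / 2) (pi - pi / 2)); [lra|lra|].
apply: logb_ext (logb_shift (pi / 2) (lsin_logb (lexx 0) (lexx pi))) => x _.
exact: lsinD_pihalf.
Qed.

Lemma logb_tan a b : - (pi / 2) < a -> b < pi / 2 -> logb a b tan.
Proof.
by move=> a0 bp; apply: logb_seg => x xab; cvg_auto; lra.
Qed.

(** A zero of first order at [0] cancels the pole of the cotangent; the other zero of the sine, at
    [pi], stays beyond [b], whence the constant with [pi - b]. *)
Lemma logb_mul_cot b (f : R -> R) M : 0 < b < pi -> contin 0 b f ->
  (forall x, 0 < x < b -> `|f x| <= M * x) -> logb 0 b (fun x => f x * (cos x / sin x)).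
Proof.
move=> /andP[b0 bp] cf fM; have p0 := @pi_gt0 R.
have M0 : 0 <= M.
  have h := fM (b / 2) ltac:(lra).
  by have := le_trans (normr_ge0 _) h; rewrite pmulr_lge0; lra.
apply: (@logb_bounded _ _ _ _ (M * (2 * pi) / (pi - b))).
  move=> x xb; have s0 : 0 < sin x by apply: sin_pos; lra.
  have cc : cos y / sin y @[y --> x] --> cos x / sin x by cvg_auto; rewrite gt_eqF.
  by apply: cvgM cc; exact: cf.
move=> x xb; have xp : 0 < x < pi by lra.
have s0 := sin_pos xp.
rewrite !normrM normfV (ger0_norm (ltW s0)).
apply: le_trans (_ : M * x * (1 / sin x) <= _).
  apply: ler_pM => //; [by rewrite mulr_ge0 ?invr_ge0// ltW|exact: fM|].
  by apply: ler_wpM2r; [rewrite invr_ge0 ltW|exact: cos_max].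
rewrite mul1r ler_pdivrMr//; apply: le_trans (_ : M * (2 * pi) / (pi - b) * (x * (pi - b) / (2 * pi)) <= _).
  have pb : 0 < pi - b by lra.
  move: (pi - b) pb => q q0; gen_pi.
  by rewrite le_eqVlt; apply/orP; left; apply/eqP; fld.
apply: ler_wpM2l; first by rewrite divr_ge0 ?mulr_ge0//; lra.
apply: le_trans (sin_lb xp); apply: ler_wpM2r; first by rewrite invr_ge0; lra.
by apply: ler_wpM2l; lra.
Qed.

End logb_trig.

Ltac logb_hook ::= lazymatch goal with
  | |- logb _ _ lsin => apply lsin_logb
  | |- logb _ _ (fun x => lsin x) => apply lsin_logb
  | |- logb _ _ lcos => apply lcos_logb
  | |- logb _ _ (fun x => lcos x) => apply lcos_logb
  | |- logb _ _ (fun x => tan x) => apply logb_tan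
  end.

(** * Convolution of a kernel with [lsin] and its derivative in the centre *)

Section convolution.
Context {R : realType}.
Implicit Types (a b c x : R) (k : R -> R).

(** The kernel is centred at the midpoint of [[0, 2 c]], so its argument runs over the symmetric
    range [[- c, c]] and parity of [k] can be exploited. *)
Definition conv k c : R := itg 0 (2 * c) (fun w => k (w - c) * lsin w).

Section kernel.
Variables (k k' : R -> R).
Hypothesis dk : forall x, - (pi / 2) < x < pi / 2 -> dv k x (k' x).
Hypothesis ck' : forall x, - (pi / 2) < x < pi / 2 -> k' y @[y --> x] --> k' x.

Lemma kernel_bounds m : 0 < m < pi / 2 -> exists M : R, [/\ 0 <= M,
  (forall x, - m <= x <= m -> `|k x| <= M) & (forall x, - m <= x <= m -> `|k' x| <= M)].
Proof.
move=> mp; have bd (h : R -> R) : (forall x, - (pi / 2) < x < pi / 2 -> h y @[y --> x] --> h x) ->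
    exists2 M, 0 <= M & forall x, - m <= x <= m -> `|h x| <= M.
  move=> ch; have cn : {within `[- m, m], continuous (fun x => `|h x|)}.
    apply: continuous_in_subspaceT => x; rewrite inE /= in_itv /= => xm.
    by apply: cvg_norm; apply: ch; lra.
  have [|c _ hc] := EVT_max _ cn; first lra.
  exists `|h c| => // x xm; apply: hc; rewrite in_itv//.
have [M1 M10 h1] := bd k (fun x hx => dv_cvg (dk hx)).
have [M2 M20 h2] := bd k' ck'.
exists (M1 + M2); split; first exact: addr_ge0.
- by move=> x xm; apply: le_trans (h1 x xm) _; rewrite lerDl.
- by move=> x xm; apply: le_trans (h2 x xm) _; rewrite lerDr.
Qed.

Lemma cvg_kernel_shift (h : R -> R) c w : (forall x, - (pi / 2) < x < pi / 2 -> h y @[y --> x] --> h x) ->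
  - (pi / 2) < w - c < pi / 2 -> h (y - c) @[y --> w] --> h (w - c).
Proof.
move=> ch hw; apply: (@cvg_comp _ _ _ (fun y => y - c) h _ (nbhs (w - c))); last exact: ch.
by apply: cvgB; [exact: cvg_id|exact: cvg_cst].
Qed.

Lemma logb_kernel (h : R -> R) c B : 0 < c < pi / 2 -> B < c + pi / 2 ->
  (forall x, - (pi / 2) < x < pi / 2 -> h y @[y --> x] --> h x) ->
  logb 0 B (fun w => h (w - c)).
Proof.
by move=> cp Bp ch; apply: logb_seg => w w0; apply: cvg_kernel_shift => //; lra.
Qed.

Lemma dv_conv c : 0 < c < pi / 2 ->
  dv (conv k) c (2 * k c * lsin (2 * c) - itg 0 (2 * c) (fun w => k' (w - c) * lsin w)).
Proof.
(* The margin is an eighth of the distance from [c] to the ends of []0, pi / 2[], so that all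
   arguments [w - t] stay within [c + 3 * d], where the kernel is bounded. *)
move=> cp; pose d := (Num.min c (pi / 2 - c)) / 8.
have d0 : 0 < d by rewrite divr_gt0// lt_min; lra.
have dc : d <= c / 8 by rewrite ler_pM2r ?invr_gt0// ge_min lexx.
have dp : d <= (pi / 2 - c) / 8 by rewrite ler_pM2r ?invr_gt0// ge_min lexx orbT.
have [M [M0 kM k'M]] := @kernel_bounds (c + 3 * d) ltac:(lra).
have ls : logb 0 (2 * c + 2 * d) lsin by apply: lsin_logb; lra.
have db : dv (fun t : R => 2 * t) c 2 by dv_auto; ring.
have := @leibniz R 0 (2 * c + 2 * d) (c - d) (c + d) c (fun t w => k (w - t) * lsin w)
  (fun t w => - k' (w - t) * lsin w) (fun t => 2 * t) (fun w => M * `|lsin w|) 2.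
move=> /(_ ltac:(lra) ltac:(lra) db) H.
apply: dv_eq; first apply: H.
- move=> t td; apply: integ_logb; apply: logbM => //.
  by apply: logb_kernel => [||x hx]; [lra|lra|exact: dv_cvg (dk hx)].
- move=> t w td wd; dv_auto.
    by apply/dv_flip/dk; lra.
  by ring.
- move=> t w td wd; rewrite normrM normrN; apply: ler_wpM2r => //; apply: k'M; lra.
- by apply: integZ; apply: integ_norm; exact: integ_logb.
- have cl : lsin y @[y --> 2 * c] --> lsin (2 * c) by cvg_auto; lra.
  apply: cvgM cl.
  by apply: cvg_kernel_shift => [x hx|]; [exact: dv_cvg (dk hx)|lra].
- have -> : 2 * c - c = c by ring.
  rewrite -itgN; last first.
    apply: integ_logb; apply: logbM; [by apply: logb_kernel => //; lra|by apply: lsin_logb; lra].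
  congr (_ + _).
    by ring.
  by apply: itg_ext => w _; rewrite mulNr.
Qed.

(** Subtracting [k (- c)] makes the first factor vanish linearly at [w = 0], by the mean value
    theorem. *)
Lemma logb_conv_cot c : 0 < c < pi / 2 ->
  logb 0 (2 * c) (fun w => (k (w - c) - k (- c)) * (cos w / sin w)).
Proof.
move=> cp; have [M [M0 kM k'M]] := @kernel_bounds c ltac:(lra).
apply: (@logb_mul_cot _ _ _ M); first by lra.
- move=> w wc; apply: cvgB; last exact: cvg_cst.
  by apply: cvg_kernel_shift => [x hx|]; [exact: dv_cvg (dk hx)|lra].
- move=> w wc; have [|||t ht e] := @MVT_segment R k k' (- c) (w - c).
  + by lra.
  + by move=> x; rewrite in_itv /= => hx; apply: dk; lra.
  + apply: continuous_in_subspaceT => x; rewrite inE /= in_itv /= => hx.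
    by apply: dv_cvg; apply: dk; lra.
  + rewrite e normrM (_ : w - c - - c = w); last by ring.
    rewrite [X in _ * X]ger0_norm; last by lra.
    apply: ler_wpM2r; first by lra.
    by apply: k'M; move: ht; rewrite in_itv /=; lra.
Qed.

(** Integration by parts with the primitive [k (w - c) - k (- c)], normalised at [w = 0] where
    [lsin] is singular. *)
Lemma conv_parts c : 0 < c < pi / 2 ->
  itg 0 (2 * c) (fun w => k' (w - c) * lsin w) = (k c - k (- c)) * lsin (2 * c)
    - itg 0 (2 * c) (fun w => (k (w - c) - k (- c)) * (cos w / sin w)).
Proof.
move=> cp; apply/eqP; rewrite -subr_eq opprK; apply/eqP.
have l1 : logb 0 (2 * c) (fun w => k' (w - c) * lsin w).
  by apply: logbM; [apply: logb_kernel => //; lra|apply: lsin_logb; lra].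
have l2 := logb_conv_cot cp.
rewrite -itgD; [|exact: integ_logb|exact: integ_logb].
rewrite (@FTC_logb _ _ _ _ (fun w => (k (w - c) - k (- c)) * lsin w) 0 ((k c - k (- c)) * lsin (2 * c))).
- by rewrite subr0.
- by lra.
- exact: logbD.
- move=> w wc; have s0 : 0 < sin w by apply: sin_pos; lra.
  dv_auto; [|lra|].
    by apply/dv_shift/dk; lra.
  by ring.
(* For the limit at [0] the difference is written as the integral of [k'], so that the product with
   [lsin] falls under [logb_mul_prim0]. *)
- have lk : logb 0 (2 * c) (fun w => k' (w - c)) by apply: logb_kernel => //; lra.
  have := @logb_mul_prim0 R 0 (2 * c) lsin _ ltac:(lra) (lsin_logb (lexx 0) _) lk.
  move=> /(_ ltac:(lra)); apply: cvg_trans; apply: near_eq_cvg; near=> w.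
  have w0 : 0 < w by [].
  have wc : w < 2 * c by near: w; apply: nbhs_right_lt; lra.
  rewrite mulrC; congr (_ * _).
  rewrite (@FTC_logb _ _ _ _ (fun w => k (w - c)) (k (- c)) (k (w - c)))//.
  + by apply: logb_sub lk; lra.
  + by move=> x xw; apply/dv_shift/dk; lra.
  + apply: cvg_at_right_filter; rewrite -[X in _ --> k X]sub0r.
    by apply: cvg_kernel_shift => [x hx|]; [exact: dv_cvg (dk hx)|lra].
  + apply: cvg_at_left_filter.
    by apply: cvg_kernel_shift => [x hx|]; [exact: dv_cvg (dk hx)|lra].
- apply: cvg_at_left_filter; rewrite (_ : k c = k (2 * c - c)); last by congr k; ring.
  have cl : lsin y @[y --> 2 * c] --> lsin (2 * c) by cvg_auto; lra.
  apply: cvgM cl; apply: cvgB; last exact: cvg_cst.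
  by apply: cvg_kernel_shift => [x hx|]; [exact: dv_cvg (dk hx)|lra].
Unshelve. all: end_near. Qed.

(** The convolution tends to [0] with [c]: the kernel is bounded near [0] and [|lsin|] is integrated
    over a shrinking range. *)
Lemma conv_prim c (h : R -> R) : 0 < c < pi / 2 -> logb 0 c h ->
  (forall t, 0 < t < pi / 2 -> dv (conv k) t (h t)) -> conv k c = itg 0 c h.
Proof.
move=> cp lh dh; rewrite (@FTC_logb _ _ _ _ (conv k) 0 (conv k c)) ?subr0//.
- by lra.
- by move=> t tc; apply: dh; lra.
- have [M [M0 kM _]] := @kernel_bounds (pi / 4) ltac:(lra).
  have ls : logb 0 pi (@lsin R) by apply: lsin_logb.
  have lp := prim0 (@pi_gt0 R) (integ_norm (integ_logb ls)).
  have l2 : M * itg 0 (2 * t) (fun w => `|lsin w|) @[t --> 0^'+] --> (0 : R).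
    rewrite -[X in _ --> X](mulr0 M); apply: cvgM; first exact: cvg_cst.
    apply: cvg_at_right_filter.
    have c2 : (2 * t : R) @[t --> (0 : R)] --> (0 : R) by cvg_auto; ring.
    exact: (@cvg_comp _ _ _ (fun t : R => 2 * t) (fun x => itg 0 x (fun w => `|lsin w|)) _ (nbhs 0)).
  apply/cvgrPdist_le => /= eps eps0; move/cvgrPdist_le : l2 => /(_ eps eps0) l2.
  near=> t; have t0 : 0 < t by [].
  have tp : t < pi / 4 by near: t; apply: nbhs_right_lt; lra.
  rewrite sub0r normrN; apply: le_trans (_ : M * itg 0 (2 * t) (fun w => `|lsin w|) <= _); last first.
    apply: le_trans (ler_norm _) _; rewrite -normrN -sub0r; near: t; exact: l2.
  have ilt : integ 0 (2 * t) (@lsin R) by apply: integ_logb; apply: lsin_logb; lra.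
  have ic : integ 0 (2 * t) (fun w => k (w - t) * lsin w).
    apply: integ_logb; apply: logbM; last by apply: lsin_logb; lra.
    by apply: logb_kernel => [||x hx]; [lra|lra|exact: dv_cvg (dk hx)].
  apply: le_trans (itg_norm ic) _; rewrite -itgZ; last exact: integ_norm.
  apply: le_itg; [exact: integ_norm|by apply: integZ; exact: integ_norm|].
  by move=> w wt; rewrite normrM; apply: ler_wpM2r => //; apply: kM; lra.
- by apply: cvg_at_left_filter; exact: dv_cvg (dh c cp).
Unshelve. all: end_near. Qed.

End kernel.

End convolution.

(** * Convolutions with [tan], [lcos], [lcos * tan] and [lcos ^+ 2] *)

Section kernels.
Context {R : realType}.
Implicit Types (a b c x t w : R).

Let p0 : 0 < (pi : R). Proof. exact: pi_gt0. Qed.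

Lemma itg_prim_mul c (p p' h : R -> R) : 0 < c -> logb 0 c h ->
  (forall x, dv p x (p' x)) -> logb 0 c p' ->
  itg 0 c (fun t => p' t * itg 0 t h) + itg 0 c (fun t => p t * h t) = p c * itg 0 c h.
Proof.
move=> c0 lh dp lp'; have lp : logb 0 c p by apply: logb_seg => x _; exact: dv_cvg (dp x).
have lP := logb_prim (integ_logb lh).
rewrite -itgD; [|by apply: integ_logb; exact: logbM..].
rewrite (@FTC_logb _ _ _ _ (fun t => p t * itg 0 t h) 0 (p c * itg 0 c h)) ?subr0//.
- by apply: logbD; apply: logbM.
- by move=> x xc; apply: dvM => //; exact: dv_prim_logb lh.
- rewrite -[X in _ --> X](mulr0 (p 0)); apply: cvgM; apply: cvg_at_right_filter.
    exact: dv_cvg (dp 0).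
  exact: prim0 c0 (integ_logb lh).
- apply: cvgM; first exact: cvg_at_left_filter (dv_cvg (dp c)).
  exact: prim_left c0 (integ_logb lh).
Qed.

Section dv_conv_cot.
Variables (k k' : R -> R).
Hypothesis dk : forall x, - (pi / 2) < x < pi / 2 -> dv k x (k' x).
Hypothesis ck' : forall x, - (pi / 2) < x < pi / 2 -> k' y @[y --> x] --> k' x.

(** After the integration by parts the boundary term is the even part of [k]: it doubles for [lcos]
    and vanishes for the odd kernels [tan] and [lcos_tan]. *)
Lemma dv_conv_cot c : 0 < c < pi / 2 -> dv (conv k) c ((k c + k (- c)) * lsin (2 * c) +
  itg 0 (2 * c) (fun w => (k (w - c) - k (- c)) * (cos w / sin w))).
Proof.
move=> cp; apply: dv_eq (dv_conv dk ck' cp) _.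
by rewrite (conv_parts dk ck' cp); ring.
Qed.

End dv_conv_cot.

Lemma dv_tan0 x : - (pi / 2) < x < pi / 2 -> dv tan x (1 + tan x ^+ 2).
Proof. by move=> xp; have := dv_tan (dv_id x) xp; rewrite mulr1. Qed.

Lemma dv_lcos0 x : - (pi / 2) < x < pi / 2 -> dv lcos x (- tan x).
Proof. by move=> xp; have := dv_lcos (dv_id x) xp; rewrite mulr1. Qed.

Lemma dv_lsin0 x : 0 < x < pi -> dv lsin x (cos x / sin x).
Proof. by move=> xp; have := dv_lsin (dv_id x) xp; rewrite mulr1. Qed.

Lemma tanN x : tan (- x) = - tan x.
Proof. by rewrite /tan sinN cosN mulNr. Qed.

(** The addition formula for the tangent of [w = (w - c) + c]; it removes the pole of the cotangent
    at [w = 0]. *)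
Lemma tan_cot w c : sin w != 0 -> cos (w - c) != 0 -> cos c != 0 ->
  (tan (w - c) + tan c) * (cos w / sin w) = 1 - tan (w - c) * tan c.
Proof.
move: (w - c) (subrK c w) => a <-; rewrite sinD cosD /tan => h1 h2 h3.
by field; rewrite h1 h2 h3.
Qed.

Lemma conv_cot_ne0 c w : 0 < c < pi / 2 -> 0 < w < 2 * c ->
  [/\ sin w != 0, cos (w - c) != 0 & cos c != 0].
Proof.
move=> cp wc; split; rewrite gt_eqF//.
- by apply: sin_pos; lra.
- by apply: cos_pos; lra.
- by apply: cos_pos; lra.
Qed.

Lemma logb_comp_shift c (h : R -> R) : 0 < c < pi / 2 ->
  (forall x, - (pi / 2) < x < pi / 2 -> h y @[y --> x] --> h x) ->
  logb 0 (2 * c) (fun w => h (w - c)).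
Proof. by move=> cp ch; apply: logb_kernel => //; lra. Qed.

(** The derivative in [c] is [2 c]: the kernel is odd, and [1 - tan (w - c) tan c] integrates to
    [2 c] because [lcos (w - c)] has equal values at both ends. *)
Lemma conv_tan c : 0 < c < pi / 2 -> conv tan c = c ^+ 2.
Proof.
move=> cp; have dt := dv_tan0.
have ct x : - (pi / 2) < x < pi / 2 -> 1 + tan y ^+ 2 @[y --> x] --> 1 + tan x ^+ 2.
  by move=> xp; cvg_auto; lra.
have key t : 0 < t < pi / 2 -> dv (conv tan) t (2 * t).
  move=> tp; apply: dv_eq (dv_conv_cot dt ct tp) _.
  rewrite tanN subrr mul0r add0r.
  rewrite (@itg_ext _ _ _ _ (fun w => 1 - tan (w - t) * tan t)); last first.
    by move=> w wt; have [h1 h2 h3] := conv_cot_ne0 tp wt; rewrite opprK tan_cot.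
  rewrite (@FTC_logb _ _ _ _ (fun w => w + lcos (w - t) * tan t) (lcos t * tan t) (2 * t + lcos t * tan t)).
  - by ring.
  - by lra.
  - apply: logbD; [exact: logb_cst|apply: logbN; apply: logbM; last exact: logb_cst].
    by apply: logb_comp_shift => // x xp; exact: dv_cvg (dt x xp).
  - move=> w wt; dv_auto; first by lra.
    by rewrite -/(tan (w - t)); ring.
  - by apply: cvg_at_right_filter; cvg_auto; [lra|rewrite sub0r lcosN; ring].
  - by apply: cvg_at_left_filter; cvg_auto; [lra|rewrite (_ : 2 * t - t = t)//; ring].
have l2 : logb 0 c (fun t : R => 2 * t) by logb_auto.
rewrite (conv_prim dt ct cp l2 key).
rewrite (@FTC_logb _ _ _ _ (fun t => t ^+ 2) 0 (c ^+ 2)) ?subr0//; first by lra.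
- by move=> x _; dv_auto; rewrite /= mulr1 expr1.
- by apply: cvg_at_right_filter; cvg_auto; rewrite expr0n.
- by apply: cvg_at_left_filter; cvg_auto.
Qed.

Lemma dv_conv_lcos c : 0 < c < pi / 2 ->
  dv (conv lcos) c (2 * lcos c * lsin (2 * c) + c ^+ 2).
Proof.
move=> cp.
have ct x : - (pi / 2) < x < pi / 2 -> - tan y @[y --> x] --> - tan x.
  by move=> xp; cvg_auto; lra.
apply: dv_eq (dv_conv dv_lcos0 ct cp) _; rewrite -conv_tan// /conv -itgN; last first.
  apply: integ_logb; apply: logbM; last by apply: lsin_logb; lra.
  by apply: (logb_comp_shift (h := fun x => - tan x)).
by congr (_ + _); apply: itg_ext => w _; rewrite mulNr opprK.
Qed.

Lemma lsin2_logb c : 0 < c < pi / 2 -> logb 0 c (fun t => lsin (2 * t)).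
Proof. by move=> cp; apply: logb_scale; [lra|apply: lsin_logb; lra]. Qed.

Lemma conv_lcos c : 0 < c < pi / 2 ->
  conv lcos c = itg 0 c (fun t => 2 * lcos t * lsin (2 * t) + t ^+ 2).
Proof.
move=> cp.
have ct x : - (pi / 2) < x < pi / 2 -> - tan y @[y --> x] --> - tan x.
  by move=> xp; cvg_auto; lra.
apply: (conv_prim dv_lcos0 ct cp); last by move=> t tp; exact: dv_conv_lcos.
by have ls := lsin2_logb cp; logb_auto; lra.
Qed.

(** Read backwards, [conv_parts] for the even kernel [lcos] has no boundary term and identifies this
    integral with [conv tan c]. *)
Lemma lcos_cot c : 0 < c < pi / 2 ->
  itg 0 (2 * c) (fun w => (lcos (w - c) - lcos c) * (cos w / sin w)) = c ^+ 2.
Proof.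
move=> cp.
have ct x : - (pi / 2) < x < pi / 2 -> - tan y @[y --> x] --> - tan x.
  by move=> xp; cvg_auto; lra.
have := conv_parts dv_lcos0 ct cp; rewrite lcosN subrr mul0r sub0r.
rewrite -conv_tan// /conv => h; apply: oppr_inj; rewrite -h -itgN; last first.
  apply: integ_logb; apply: logbM; last by apply: lsin_logb; lra.
  by apply: (logb_comp_shift (h := tan) cp) => x xp; cvg_auto; lra.
by apply: itg_ext => w _; rewrite mulNr.
Qed.

(** Minus one half of the derivative of [lcos ^+ 2], needed to differentiate the convolution with
    that square. *)
Definition lcos_tan x : R := lcos x * tan x.

Lemma dv_lcos_tan x : - (pi / 2) < x < pi / 2 ->
  dv lcos_tan x (- tan x * tan x + lcos x * (1 + tan x ^+ 2)).
Proof. by move=> xp; exact: dvM (dv_lcos0 xp) (dv_tan0 xp). Qed.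

Lemma cts_lcos_tan' x : - (pi / 2) < x < pi / 2 ->
  - tan y * tan y + lcos y * (1 + tan y ^+ 2) @[y --> x] -->
  - tan x * tan x + lcos x * (1 + tan x ^+ 2).
Proof. by move=> xp; cvg_auto; lra. Qed.

Lemma itg_lcos_sym c : 0 < c < pi / 2 ->
  itg 0 (2 * c) (fun w => lcos (w - c)) = 2 * itg 0 c lcos.
Proof.
move=> cp; have l1 : logb (- c) c (@lcos R) by apply: lcos_logb; lra.
have := itg_shift (- c) l1; rewrite (_ : - c - - c = 0) 1?(_ : c - - c = 2 * c); try ring.
move=> ->; rewrite (@itg_split _ _ _ 0) ; [|lra|exact: integ_logb].
have l2 : logb 0 c (@lcos R) by apply: lcos_logb; lra.
have := itg_refl 0 l2; rewrite sub0r subrr => h.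
rewrite (_ : itg (- c) 0 lcos = itg 0 c lcos); first by ring.
by rewrite -h; apply: itg_ext => x _; rewrite sub0r lcosN.
Qed.

Lemma dv_conv_lcos_tan c : 0 < c < pi / 2 ->
  dv (conv lcos_tan) c (2 * itg 0 c lcos - c ^+ 2 * tan c).
Proof.
move=> cp; apply: dv_eq (dv_conv_cot dv_lcos_tan cts_lcos_tan' cp) _.
rewrite /lcos_tan tanN lcosN mulrN subrr mul0r add0r.
have l1 : logb 0 (2 * c) (fun w => lcos (w - c)).
  by apply: logb_comp_shift => // x xp; cvg_auto; lra.
have l2 : logb 0 (2 * c) (fun w => tan (w - c)).
  by apply: logb_comp_shift => // x xp; cvg_auto; lra.
have l3 : logb 0 (2 * c) (fun w => (lcos (w - c) - lcos c) * (cos w / sin w)).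
  have ct x : - (pi / 2) < x < pi / 2 -> - tan y @[y --> x] --> - tan x.
    by move=> xp; cvg_auto; lra.
  by have := logb_conv_cot dv_lcos0 ct cp; rewrite lcosN.
rewrite (@itg_ext _ _ _ _ (fun w => lcos (w - c) - tan c * (lcos (w - c) * tan (w - c))
   - tan c * ((lcos (w - c) - lcos c) * (cos w / sin w)))); last first.
  move=> w wc; have [h1 h2 h3] := conv_cot_ne0 cp wc.
  have := tan_cot h1 h2 h3; move: (cos w / sin w) => q e.
  (* The part carrying [tan (w - c) + tan c] loses its pole by [tan_cot]; the rest is a multiple of
     the integral in [lcos_cot]. *)
  rewrite (_ : _ * q = lcos (w - c) * ((tan (w - c) + tan c) * q) - tan c * ((lcos (w - c) - lcos c) * q)); last by ring.
  by rewrite e; ring.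
have i1 := integ_logb l1; have i3 := integ_logb l3.
have i2 := integ_logb (logbM l1 l2).
rewrite itgB; [|by apply: integD => //; apply: integN; exact: integZ|exact: integZ].
rewrite itgB//; last exact: integZ.
rewrite !itgZ// lcos_cot// itg_lcos_sym//.
(* The remaining product [lcos * tan] is odd about the centre, so its primitive agrees at the two
   ends. *)
rewrite (@FTC_logb _ 0 (2 * c) _ (fun w => - (lcos (w - c) ^+ 2 / 2)) (- (lcos c ^+ 2 / 2)) (- (lcos c ^+ 2 / 2))).
- by ring.
- by lra.
- exact: logbM.
- move=> w wt; dv_auto; first by lra.
  by rewrite -/(tan (w - c)) /= expr1; field.
- by apply: cvg_at_right_filter; cvg_auto; [lra|rewrite sub0r lcosN].
- by apply: cvg_at_left_filter; cvg_auto; [lra|rewrite (_ : 2 * c - c = c)//; ring].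
Qed.

Lemma lcos_prim_logb c : 0 < c <= pi / 2 -> logb 0 c (fun t => itg 0 t lcos).
Proof. by move=> cp; apply: logb_prim; apply: integ_logb; apply: lcos_logb; lra. Qed.

Lemma conv_lcos_tan c : 0 < c < pi / 2 ->
  conv lcos_tan c = itg 0 c (fun t => 2 * itg 0 t lcos - t ^+ 2 * tan t).
Proof.
move=> cp; apply: (conv_prim dv_lcos_tan cts_lcos_tan' cp); last first.
  by move=> t tp; exact: dv_conv_lcos_tan.
by have lp := @lcos_prim_logb c ltac:(lra); logb_auto; lra.
Qed.

(** The integrand is the derivative of [2 (c - t) t^2 lcos t], which vanishes at both ends. *)
Lemma itg_lcos_tan_quadratic c : 0 < c < pi / 2 ->
  itg 0 c (fun t => (4 * c * t - 6 * t ^+ 2) * lcos t - 2 * (c - t) * t ^+ 2 * tan t) = 0.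
Proof.
move=> cp; have lt : logb 0 c (@tan R) by apply: logb_tan; lra.
have lL : logb 0 c (@lcos R) by apply: lcos_logb; lra.
rewrite (@FTC_logb _ _ _ _ (fun t => 2 * (c - t) * t ^+ 2 * lcos t) 0 0) ?subrr; first by [].
- by lra.
- by logb_auto.
- move=> x xc; dv_auto; first by lra.
  by rewrite -/(tan x) /= expr1; ring.
- by apply: cvg_at_right_filter; cvg_auto; [lra|rewrite expr0n /=; ring].
- by apply: cvg_at_left_filter; cvg_auto; [lra|ring].
Qed.

(** Differentiating in [c] brings in [conv lcos_tan], itself an iterated primitive of [lcos];
    integrating back and reducing to single integrals creates the quadratic weight. *)
Lemma conv_lcos_sqr c : 0 < c < pi / 2 -> conv (fun x => lcos x ^+ 2) c =
  itg 0 c (fun t => 2 * lcos t ^+ 2 * lsin (2 * t)) +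
  itg 0 c (fun t => (2 * c ^+ 2 - 8 * c * t + 8 * t ^+ 2) * lcos t).
Proof.
move=> cp.
have dk x : - (pi / 2) < x < pi / 2 -> dv (fun x => lcos x ^+ 2) x (- 2 * lcos_tan x).
  move=> xp; apply: dv_eq; first exact: dvX (dv_lcos0 xp).
  by rewrite /lcos_tan /= expr1; ring.
have ck x : - (pi / 2) < x < pi / 2 -> - 2 * lcos_tan y @[y --> x] --> - 2 * lcos_tan x.
  by move=> xp; apply: cvgM; [exact: cvg_cst|exact: dv_cvg (dv_lcos_tan xp)].
pose h t := 2 * itg 0 t (@lcos R) - t ^+ 2 * tan t.
have lD := @lcos_prim_logb c ltac:(lra).
have lt : logb 0 c (@tan R) by apply: logb_tan; lra.
have lL : logb 0 c (@lcos R) by apply: lcos_logb; lra.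
have ls := lsin2_logb cp.
have lh : logb 0 c h by rewrite /h; logb_auto.
have lP : logb 0 c (fun t => itg 0 t h) by apply: logb_prim; exact: integ_logb.
have cU t : 0 < t < pi / 2 -> t <= c -> conv lcos_tan t = itg 0 t h.
  by move=> tp _; exact: conv_lcos_tan.
have lU : logb 0 c (conv lcos_tan).
  by apply: logb_ext lP => t tc; rewrite cU//; lra.
rewrite (conv_prim dk ck cp (h := fun t => 2 * lcos t ^+ 2 * lsin (2 * t) + 2 * conv lcos_tan t)).
- have l1 : logb 0 c (fun t => 2 * lcos t ^+ 2 * lsin (2 * t)) by logb_auto.
  rewrite itgD; [|exact: integ_logb|by apply: integZ; exact: integ_logb].
  congr (_ + _).
  rewrite itgZ; last exact: integ_logb.
  rewrite (@itg_ext _ _ _ (conv lcos_tan) (fun t => itg 0 t h)); last first.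
    by move=> t tc; rewrite cU//; lra.
  (* Both [e1] and [e2] unfold one primitive by parts, with weights vanishing at [c]; [e3] exchanges
     the weighted [tan] for [lcos]. *)
  have e1 := @itg_prim_mul c (fun t => t - c) (fun=> 1) h ltac:(lra) lh ltac:(move=> x; dv_auto; ring) (logb_cst _ _ _).
  rewrite subrr mul0r in e1.
  have e2 := @itg_prim_mul c (fun t => - 2 * (c - t) ^+ 2) (fun t => 4 * (c - t)) lcos ltac:(lra) lL
    ltac:(move=> x; dv_auto; rewrite /= expr1; ring) ltac:(logb_auto).
  rewrite subrr expr0n /= mulr0 mul0r in e2.
  have e3 := itg_lcos_tan_quadratic cp.
  have i4 : integ 0 c (fun t => 4 * (c - t) * itg 0 t lcos) by apply: integ_logb; logb_auto.
  have i5 : integ 0 c (fun t => - 2 * (c - t) ^+ 2 * lcos t) by apply: integ_logb; logb_auto.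
  have i6 : integ 0 c (fun t => (4 * c * t - 6 * t ^+ 2) * lcos t) by apply: integ_logb; logb_auto.
  have i7 : integ 0 c (fun t => 2 * (c - t) * t ^+ 2 * tan t) by apply: integ_logb; logb_auto.
  rewrite itgB// in e3.
  rewrite (@itg_ext _ _ _ (fun t => 1 * itg 0 t h) (fun t => itg 0 t h)) in e1; last first.
    by move=> t _; rewrite mul1r.
  have e4 : 2 * itg 0 c (fun t => (t - c) * h t) =
      - itg 0 c (fun t => 4 * (c - t) * itg 0 t lcos) + itg 0 c (fun t => 2 * (c - t) * t ^+ 2 * tan t).
    rewrite -itgZ; last by apply: integ_logb; logb_auto.
    rewrite -itgN// -itgD//; last exact: integN.
    by apply: itg_ext => t _; rewrite /h; ring.
  have e5 : itg 0 c (fun t => (2 * c ^+ 2 - 8 * c * t + 8 * t ^+ 2) * lcos t) =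
      - itg 0 c (fun t => - 2 * (c - t) ^+ 2 * lcos t) - itg 0 c (fun t => (4 * c * t - 6 * t ^+ 2) * lcos t).
    rewrite -itgN// -itgB//; last exact: integN.
    by apply: itg_ext => t _; ring.
  rewrite e5; move: e1 e2 e3 e4; do 6! move: (itg _ _ _) => ?; clear; lra.
- by logb_auto.
- move=> t tp; apply: dv_eq (dv_conv dk ck tp) _.
  rewrite -itgZ; last first.
    apply: integ_logb; apply: logbM; last by apply: lsin_logb; lra.
    by apply: logb_comp_shift => // x xp; exact: dv_cvg (dv_lcos_tan xp).
  rewrite -itgN; last first.
    apply: integ_logb; apply: logbM; last by apply: lsin_logb; lra.
    by apply: (logb_comp_shift (h := fun x => - 2 * lcos_tan x)).
  by congr (_ + _); apply: itg_ext => w _; ring.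
Qed.

End kernels.

(** * The real kernels of [1 / (r + e^{is})] and the polylogarithm ladder *)

Section radial_kernels.
Context {R : realType}.
Implicit Types (r s m : R) (k : nat).

Let p0 : 0 < (pi : R). Proof. exact: pi_gt0. Qed.

(* [rden r s = |r + e^{is}|^2], [rlog r s = ln |r + e^{is}|], and
   [rr r s - i kap r s = 1 / (r + e^{is})]; [kaps] and [rrs] are the derivatives
   of [kap] and [rr] in [s]. *)
Definition rden r s : R := 1 + 2 * r * cos s + r ^+ 2.
Definition kap r s : R := sin s / rden r s.
Definition rr r s : R := (r + cos s) / rden r s.
Definition kaps r s : R := (cos s * (1 + r ^+ 2) + 2 * r) / rden r s ^+ 2.
Definition rrs r s : R := - (sin s * (1 - r ^+ 2)) / rden r s ^+ 2.
Definition rlog r s : R := ln (rden r s) / 2.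

Lemma rden_sin r s : rden r s = (r + cos s) ^+ 2 + sin s ^+ 2.
Proof. by rewrite sin2cos2 /rden; ring. Qed.

Lemma rden_ge_sin r s : sin s ^+ 2 <= rden r s.
Proof. by rewrite rden_sin lerDr sqr_ge0. Qed.

Lemma rden_ge r s : 0 <= r -> (1 - r) ^+ 2 <= rden r s.
Proof.
move=> r0; rewrite -subr_ge0 (_ : _ - _ = 2 * (r * (1 + cos s))); last by rewrite /rden; ring.
by rewrite !mulr_ge0//; have := cos_geN1 s; lra.
Qed.

Lemma rden_gt0 r s : 0 < r < 1 -> 0 < rden r s.
Proof.
move=> r01; apply: lt_le_trans (rden_ge s _); last lra.
by rewrite exprn_gt0//; lra.
Qed.

Lemma rden_ne0 r s : 0 < r < 1 -> rden r s != 0.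
Proof. by move=> /(rden_gt0 s) h; rewrite gt_eqF. Qed.

Lemma rden_le r s : 0 < r < 1 -> rden r s <= 4.
Proof.
move=> /andP[r0 r1]; have h : r * cos s <= r by rewrite ler_piMr ?cos_le1// ltW.
have : r ^+ 2 <= 1 by rewrite expr_le1// ltW.
by rewrite /rden -mulrA; lra.
Qed.

Lemma dv_rden_r r s : dv (fun r => rden r s) r (2 * (r + cos s)).
Proof. by rewrite /rden; dv_auto; rewrite /= expr1; ring. Qed.

Lemma dv_rden_s r s : dv (fun s => rden r s) s (- (2 * r * sin s)).
Proof. by rewrite /rden; dv_auto; ring. Qed.

Lemma dv_kap_s r s : rden r s != 0 -> dv (fun s => kap r s) s (kaps r s).
Proof.
move=> d0; have dd := dv_rden_s r s; rewrite /kap; dv_auto => //.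
have e : rden r s = 1 + 2 * r * cos s + r ^+ 2 by [].
transitivity ((cos s * rden r s + 2 * r * sin s ^+ 2) / rden r s ^+ 2).
  by field; rewrite d0.
by rewrite /kaps; congr (_ / _); rewrite sin2cos2 e; ring.
Qed.

Lemma dv_rr_s r s : rden r s != 0 -> dv (fun s => rr r s) s (rrs r s).
Proof.
move=> d0; have dd := dv_rden_s r s; rewrite /rr; dv_auto => //.
have e : rden r s = 1 + 2 * r * cos s + r ^+ 2 by [].
transitivity ((- sin s * rden r s + (r + cos s) * (2 * r * sin s)) / rden r s ^+ 2).
  by field; rewrite d0.
by rewrite /rrs; congr (_ / _); rewrite e; ring.
Qed.

(** One Cauchy-Riemann equation; [dv_rkap_r] is the other. The quotient [r / (r + e^{is})] depends
    only on [z = r e^{-is}], so its derivative in [s] is [- i] times its derivative under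
    [r d/dr]. *)
Lemma dv_rrr_r r s : rden r s != 0 -> dv (fun r => r * rr r s) r (kaps r s).
Proof.
move=> d0; have dd := dv_rden_r r s; rewrite /rr; dv_auto => //.
have e : rden r s = 1 + 2 * r * cos s + r ^+ 2 by [].
transitivity (((2 * r + cos s) * rden r s - r * (r + cos s) * (2 * (r + cos s))) / rden r s ^+ 2).
  by field; rewrite d0.
by rewrite /kaps; congr (_ / _); rewrite e; ring.
Qed.

Lemma dv_rkap_r r s : rden r s != 0 -> dv (fun r => r * kap r s) r (- rrs r s).
Proof.
move=> d0; have dd := dv_rden_r r s; rewrite /kap; dv_auto => //.
have e : rden r s = 1 + 2 * r * cos s + r ^+ 2 by [].
transitivity (sin s * (rden r s - r * (2 * (r + cos s))) / rden r s ^+ 2).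
  by field; rewrite d0.
by rewrite /rrs mulNr opprK; congr (_ / _); rewrite e; ring.
Qed.

Lemma dv_rlog_r r s : 0 < rden r s -> dv (fun r => rlog r s) r (rr r s).
Proof.
move=> d0; have dd := dv_rden_r r s; rewrite /rlog; dv_auto => //.
by rewrite /rr; field; rewrite gt_eqF.
Qed.

Lemma dv_rlog_s r s : 0 < rden r s -> dv (fun s => rlog r s) s (- (r * kap r s)).
Proof.
move=> d0; have dd := dv_rden_s r s; rewrite /rlog; dv_auto => //.
by rewrite /kap; field; rewrite gt_eqF.
Qed.

(** The squared modulus of [1 / (r + e^{is})]. *)
Lemma kap_rr r s : rden r s != 0 -> kap r s ^+ 2 + rr r s ^+ 2 = (rden r s)^-1.
Proof.
move=> d0; rewrite /kap /rr !expr_div_n -mulrDl addrC -rden_sin.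
by field; rewrite d0.
Qed.

Lemma kap_bound r s : 0 < r < 1 -> `|kap r s| <= (1 - r)^-1.
Proof.
move=> r01; have d0 := rden_gt0 s r01; have q0 : 0 < (1 - r)^-1 by rewrite invr_gt0; lra.
rewrite -ler_sqr ?nnegrE ?(ltW q0)// -normrX ger0_norm ?sqr_ge0//.
apply: le_trans (_ : (rden r s)^-1 <= _).
  by rewrite -kap_rr ?gt_eqF// lerDl sqr_ge0.
rewrite exprVn lef_pV2 ?posrE ?exprn_gt0//; last lra.
by apply: rden_ge; lra.
Qed.

Lemma rr_bound r s : 0 < r < 1 -> `|rr r s| <= (1 - r)^-1.
Proof.
move=> r01; have d0 := rden_gt0 s r01; have q0 : 0 < (1 - r)^-1 by rewrite invr_gt0; lra.
rewrite -ler_sqr ?nnegrE ?(ltW q0)// -normrX ger0_norm ?sqr_ge0//.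
apply: le_trans (_ : (rden r s)^-1 <= _).
  by rewrite -kap_rr ?gt_eqF// lerDr sqr_ge0.
rewrite exprVn lef_pV2 ?posrE ?exprn_gt0//; last lra.
by apply: rden_ge; lra.
Qed.

Lemma kaps_bound r s : 0 < r < 1 -> `|kaps r s| <= 3 / rden r s.
Proof.
move=> r01; have d0 := rden_gt0 s r01.
have -> : kaps r s = cos s / rden r s + 2 * r * (sin s ^+ 2 / rden r s) / rden r s.
  transitivity ((cos s * rden r s + 2 * r * sin s ^+ 2) / rden r s ^+ 2).
    by rewrite /kaps; congr (_ / _); rewrite sin2cos2 /rden; ring.
  by field; rewrite gt_eqF.
apply: le_trans (ler_normD _ _) _.
rewrite (_ : 3 = 1 + 2); last by ring.
rewrite [leRHS]mulrDl; apply: lerD; rewrite normrM normfV (ger0_norm (ltW d0)).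
  by rewrite ler_pM2r ?invr_gt0// cos_max.
rewrite ler_pM2r ?invr_gt0// ger0_norm; last first.
  have q0 : 0 <= sin s ^+ 2 / rden r s by rewrite mulr_ge0 ?sqr_ge0// invr_ge0 ltW.
  by rewrite mulr_ge0//; lra.
have : sin s ^+ 2 / rden r s <= 1 by rewrite ler_pdivrMr// mul1r rden_ge_sin.
move: (_ / rden r s) => q q1; apply: le_trans (_ : 2 * r * 1 <= _); last lra.
by rewrite ler_pM2l//; lra.
Qed.

(** The product of [|sin s|] and [1 - r] is at most half the sum of their squares, and each square
    is a lower bound for [rden r s]. *)
Lemma rrs_bound r s : 0 < r < 1 -> `|rrs r s| <= 3 / rden r s.
Proof.
move=> r01; have d0 := rden_gt0 s r01.
rewrite /rrs mulNr normrN normrM normfV (ger0_norm (sqr_ge0 _)).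
rewrite ler_pdivrMr ?exprn_gt0// expr2 mulrA divfK ?gt_eqF//.
rewrite (_ : sin s * (1 - r ^+ 2) = sin s * (1 - r) * (1 + r)); last by ring.
rewrite normrM (ger0_norm (_ : 0 <= 1 + r)); last lra.
have h1 : `|sin s * (1 - r)| <= rden r s.
  have a := rden_ge_sin r s; have b := @rden_ge r s ltac:(lra).
  have := sqr_ge0 (sin s - (1 - r)); have := sqr_ge0 (sin s + (1 - r)).
  rewrite (_ : (sin s + (1 - r)) ^+ 2 = sin s ^+ 2 + 2 * (sin s * (1 - r)) + (1 - r) ^+ 2); last by ring.
  rewrite (_ : (sin s - (1 - r)) ^+ 2 = sin s ^+ 2 - 2 * (sin s * (1 - r)) + (1 - r) ^+ 2); last by ring.
  move: (sin s * (1 - r)) (sin s ^+ 2) ((1 - r) ^+ 2) a b => x y z a b h1 h2.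
  by rewrite ler_norml; apply/andP; split; lra.
apply: le_trans (_ : rden r s * (1 + r) <= _).
  by apply: ler_wpM2r => //; lra.
by rewrite mulrC ler_pM2r//; lra.
Qed.

(** Away from [s = pi] the segment [0 < r < 1] stays at a positive distance from [- e^{is}], since
    [rden] is [(1 - r)^2 + 2 r (1 + cos s)]. *)
Lemma rden_local m : 0 < m < pi -> exists2 e, 0 < e & forall r s, 0 < r < 1 -> - m < s < m -> e <= rden r s.
Proof.
move=> mp; pose e := (1 + cos m) / 2.
have cm : -1 < cos m.
  by rewrite -cospi ltr_cos ?in_itv/=; lra.
exists e; first by rewrite /e; lra.
move=> r s r01 sm.
have cs : cos m <= cos s.
  have sm' : `|s| < m by rewrite ltr_norml; lra.
  by rewrite -(cos_norm s) ltW// ltr_cos ?in_itv/= ?normr_ge0//=; lra.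
have c1 := cos_le1 m; have r2 := sqr_ge0 r; have r3 := sqr_ge0 (1 - r).
rewrite (_ : rden r s = (1 - r) ^+ 2 + 2 * r * (1 + cos s)); last by rewrite /rden; ring.
apply: le_trans (_ : e * (1 - r) ^+ 2 + 2 * r * e <= _); last first.
  apply: lerD; first by rewrite ler_piMl// /e; lra.
  by rewrite ler_pM2l; rewrite /e; lra.
have -> : e * (1 - r) ^+ 2 + 2 * r * e = e + e * r ^+ 2 by ring.
by rewrite lerDl mulr_ge0// /e; lra.
Qed.

Lemma logb_ln01 : logb 0 1 (@ln R).
Proof.
apply: (@logb_ln R 0 1 (fun x => x) 1 1); first by [].
  by move=> x _; exact: cvg_id.
move=> x x01; apply/andP; split; last lra.
by rewrite mul1r subr0 -[leRHS]mulr1 ler_pM2l; lra.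
Qed.

(** From [ln (1 / r) <= 1 / r - 1]. The zero of [ln] at [1] is made explicit while the logarithmic
    growth at [0] is kept. *)
Lemma ln_bound r : 0 < r < 1 -> `|ln r| <= (1 - r) * (1 - ln r).
Proof.
move=> r01; have l0 : ln r < 0 by apply: ln_lt0.
rewrite ltr0_norm//.
have : ln (1 + (r^-1 - 1)) <= r^-1 - 1 by apply: le_ln1Dx; rewrite ltrBrDl subrr invr_gt0; lra.
rewrite (_ : 1 + _ = r^-1); last by ring.
rewrite lnV ?posrE; last lra.
move=> h; have : r * - ln r <= r * (r^-1 - 1) by rewrite ler_pM2l//; lra.
rewrite mulrBr divff; last by rewrite gt_eqF//; lra.
by lra.
Qed.

Definition lw r : R := 1 - ln r.

Lemma logb_lw : logb 0 1 lw.
Proof. by rewrite /lw; have h := logb_ln01; logb_auto. Qed.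

Lemma lw_ge1 r : 0 < r < 1 -> 1 <= lw r.
Proof. by move=> r01; have := ln_lt0 r01; rewrite /lw; lra. Qed.

Lemma ln_lw r : 0 < r < 1 -> `|ln r| <= lw r.
Proof. by move=> r01; have l := ln_lt0 r01; rewrite ltr0_norm// /lw; lra. Qed.

(** Each of the [k] logarithms can pay for one pole at [r = 1]. The bound does not involve [s],
    which is what differentiation across [s = pi] demands. *)
Lemma ln_pow_bound k j r : 0 < r < 1 -> (j <= k)%N ->
  `|ln r ^+ k| * (1 - r)^-1 ^+ j <= lw r ^+ k.
Proof.
move=> r01 jk; rewrite -(subnKC jk) !exprD normrM mulrAC.
have q0 : 0 < 1 - r by lra.
have i0 : 0 <= (1 - r)^-1 by rewrite invr_ge0 ltW.
apply: ler_pM; [by rewrite mulr_ge0// exprn_ge0|by []| |].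
  rewrite normrX -exprMn; apply: lerXn2r; rewrite ?nnegrE; [exact: mulr_ge0|exact: le_trans ler01 (lw_ge1 r01)|].
  by rewrite ler_pdivrMr// mulrC; exact: ln_bound.
rewrite normrX; apply: lerXn2r; rewrite ?nnegrE//; last exact: ln_lw.
exact: le_trans ler01 (lw_ge1 r01).
Qed.

(* [Yk k s - i Bk k s = (-1)^(k+1) k! Li_(k+1)(- e^{-is})]. *)
Definition Bk k s : R := itg 0 1 (fun r => ln r ^+ k * kap r s).
Definition Yk k s : R := itg 0 1 (fun r => ln r ^+ k * rr r s).

Lemma contin_lnX k (q : R -> R) : contin 0 1 q -> contin 0 1 (fun r => ln r ^+ k * q r).
Proof.
move=> cq x x01; have c1 : ln y ^+ k @[y --> x] --> ln x ^+ k by cvg_auto; lra.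
by apply: cvgM c1 _; exact: cq.
Qed.

Lemma contin_kap s : contin 0 1 (fun r => kap r s).
Proof.
move=> r r01; have dd := dv_rden_r r s; rewrite /kap; cvg_auto.
exact: rden_ne0.
Qed.

Lemma contin_rr s : contin 0 1 (fun r => rr r s).
Proof.
move=> r r01; have dd := dv_rden_r r s; rewrite /rr; cvg_auto.
exact: rden_ne0.
Qed.

Lemma contin_kaps s : contin 0 1 (fun r => kaps r s).
Proof.
move=> r r01; have dd := dv_rden_r r s; rewrite /kaps; cvg_auto.
by rewrite expf_neq0// rden_ne0.
Qed.

Lemma contin_rrs s : contin 0 1 (fun r => rrs r s).
Proof.
move=> r r01; have dd := dv_rden_r r s; rewrite /rrs; cvg_auto.
by rewrite expf_neq0// rden_ne0.
Qed.

Lemma ln_kernel_bound k j (M x r : R) : 0 < r < 1 -> (j <= k)%N -> 0 <= M ->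
  `|x| <= M * (1 - r)^-1 ^+ j -> `|ln r ^+ k * x| <= M * lw r ^+ k.
Proof.
move=> r01 jk M0 h; rewrite normrM.
apply: le_trans (_ : `|ln r ^+ k| * (M * (1 - r)^-1 ^+ j) <= _); first exact: ler_wpM2l.
by rewrite mulrCA; apply: ler_wpM2l => //; exact: ln_pow_bound.
Qed.

Lemma logb_lwX k M : logb 0 1 (fun r => M * lw r ^+ k).
Proof. by have h := logb_lw; apply: logbM; [exact: logb_cst|exact: logbX]. Qed.

Lemma rden_inv_bound r s : 0 < r < 1 -> (rden r s)^-1 <= (1 - r)^-1 ^+ 2.
Proof.
move=> r01; rewrite exprVn lef_pV2 ?posrE ?rden_gt0 ?exprn_gt0//; [|lra].
by apply: rden_ge; lra.
Qed.

Lemma kaps_bound2 r s : 0 < r < 1 -> `|kaps r s| <= 3 * (1 - r)^-1 ^+ 2.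
Proof.
move=> r01; apply: le_trans (kaps_bound s r01) _.
by rewrite ler_pM2l//; exact: rden_inv_bound.
Qed.

Lemma rrs_bound2 r s : 0 < r < 1 -> `|rrs r s| <= 3 * (1 - r)^-1 ^+ 2.
Proof.
move=> r01; apply: le_trans (rrs_bound s r01) _.
by rewrite ler_pM2l//; exact: rden_inv_bound.
Qed.

Lemma Bk_bound k s r : (0 < k)%N -> 0 < r < 1 -> `|ln r ^+ k * kap r s| <= 1 * lw r ^+ k.
Proof.
move=> k0 r01; apply: (@ln_kernel_bound _ 1) => //.
by rewrite mul1r expr1; exact: kap_bound.
Qed.

Lemma Yk_bound k s r : (0 < k)%N -> 0 < r < 1 -> `|ln r ^+ k * rr r s| <= 1 * lw r ^+ k.
Proof.
move=> k0 r01; apply: (@ln_kernel_bound _ 1) => //.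
by rewrite mul1r expr1; exact: rr_bound.
Qed.

Lemma logb_Bk k s : (0 < k)%N -> logb 0 1 (fun r => ln r ^+ k * kap r s).
Proof.
move=> k0; apply: logb_le (logb_lwX k 1); first exact/contin_lnX/contin_kap.
by move=> r r01; exact: Bk_bound.
Qed.

Lemma logb_Yk k s : (0 < k)%N -> logb 0 1 (fun r => ln r ^+ k * rr r s).
Proof.
move=> k0; apply: logb_le (logb_lwX k 1); first exact/contin_lnX/contin_rr.
by move=> r r01; exact: Yk_bound.
Qed.

(** At [s = pi] the derivative kernels have a double pole at [r = 1], whence two logarithms instead
    of one. *)
Lemma logb_kaps k s : (1 < k)%N -> logb 0 1 (fun r => ln r ^+ k * kaps r s).
Proof.
move=> k1; apply: logb_le (logb_lwX k 3); first exact/contin_lnX/contin_kaps.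
by move=> r r01; apply: (@ln_kernel_bound _ 2) => //; exact: kaps_bound2.
Qed.

Lemma logb_rrs k s : (1 < k)%N -> logb 0 1 (fun r => ln r ^+ k * rrs r s).
Proof.
move=> k1; apply: logb_le (logb_lwX k 3); first exact/contin_lnX/contin_rrs.
by move=> r r01; apply: (@ln_kernel_bound _ 2) => //; exact: rrs_bound2.
Qed.

Lemma cvg_Bk k s : (0 < k)%N -> Bk k t @[t --> s] --> Bk k s.
Proof.
move=> k0; apply: (@cvg_under _ _ _ (s - 1) (s + 1) _ _ (fun r => 1 * lw r ^+ k)).
- by lra.
- by move=> t _; exact/integ_logb/logb_Bk.
- move=> t r _ r01; apply: cvgM; first exact: cvg_cst.
  exact: dv_cvg (dv_kap_s (rden_ne0 t r01)).
- by move=> t r _ r01; exact: Bk_bound.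
- exact/integ_logb/logb_lwX.
Qed.

Lemma cvg_Yk k s : (0 < k)%N -> Yk k t @[t --> s] --> Yk k s.
Proof.
move=> k0; apply: (@cvg_under _ _ _ (s - 1) (s + 1) _ _ (fun r => 1 * lw r ^+ k)).
- by lra.
- by move=> t _; exact/integ_logb/logb_Yk.
- move=> t r _ r01; apply: cvgM; first exact: cvg_cst.
  exact: dv_cvg (dv_rr_s (rden_ne0 t r01)).
- by move=> t r _ r01; exact: Yk_bound.
- exact/integ_logb/logb_lwX.
Qed.

(** Differentiating [ln r ^+ k.+1] gives a factor [1 / r], which the factor [r] of the primitive
    [r * q r] cancels: the exponent drops by one and the kernel stays of the same kind. *)
Lemma ln_parts k (q Q' : R -> R) : (forall r, 0 < r < 1 -> dv (fun r => r * q r) r (Q' r)) ->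
  logb 0 1 (fun r => ln r ^+ k.+1 * Q' r) -> logb 0 1 (fun r => ln r ^+ k * q r) ->
  ln r ^+ k.+1 * (r * q r) @[r --> 1^'-] --> (0 : R) ->
  itg 0 1 (fun r => ln r ^+ k.+1 * Q' r) = - k.+1%:R * itg 0 1 (fun r => ln r ^+ k * q r).
Proof.
move=> dQ l1 l2 c1; have ll := logb_ln01.
have l3 : logb 0 1 (fun r => k.+1%:R * (ln r ^+ k * q r)) by apply: logbM => //; exact: logb_cst.
rewrite mulNr; apply/eqP; rewrite -addr_eq0; apply/eqP.
rewrite -itgZ; last exact: integ_logb.
rewrite -itgD; [|exact: integ_logb..].
rewrite (@FTC_logb _ _ _ _ (fun r => ln r ^+ k.+1 * (r * q r)) 0 0) ?subrr//.
- exact: logbD.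
- move=> r r01; have d1 := dQ r r01; have d2 : dv (fun r => ln r ^+ k.+1) r (k.+1%:R * ln r ^+ k * r^-1).
    by dv_auto; [lra|rewrite /= mul1r].
  apply: dv_eq (dvM d2 d1) _; rewrite addrC; congr (_ + _).
  by field; rewrite gt_eqF//; lra.
- have l4 : logb 0 1 (fun r => ln r * (ln r ^+ k * q r)) by apply: logbM.
  have := logb_mul_prim0 ltr01 l4 (logb_cst 0 1 1); apply: cvg_trans; apply: near_eq_cvg.
  near=> r; rewrite itg_cst; last by apply: ltW.
  by rewrite exprS; ring.
Unshelve. all: end_near. Qed.

(** One logarithm tends to [0] at [r = 1], another one absorbs the pole of [q]. *)
Lemma cvg1_kernel k (q : R -> R) : (1 < k)%N -> (forall r, 0 < r < 1 -> `|q r| <= (1 - r)^-1) ->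
  ln r ^+ k * (r * q r) @[r --> 1^'-] --> (0 : R).
Proof.
case: k => [//|k] k0 bq.
have c0 : `|ln r| * lw r ^+ k @[r --> 1^'-] --> (0 : R).
  apply: cvg_at_left_filter; rewrite -[X in _ --> X](mul0r (lw 1 ^+ k)).
  have c1 : ln r @[r --> (1 : R)] --> (0 : R) by cvg_auto; rewrite ?ln1.
  have c2 : lw r ^+ k @[r --> (1 : R)] --> lw 1 ^+ k by rewrite /lw; cvg_auto.
  have c3 := cvg_norm c1; rewrite normr0 in c3.
  exact: cvgM (c3 _) c2.
apply/cvgrPdist_le => /= e e0; move/cvgrPdist_le : c0 => /(_ e e0) c0; near=> r.
have r1 : r < 1 by [].
have r0 : 0 < r by near: r; exact: nbhs_left_gt.
rewrite sub0r normrN; apply: le_trans (_ : `|ln r| * lw r ^+ k <= _); last first.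
  apply: le_trans (ler_norm _) _; rewrite -normrN -sub0r; near: r; exact: c0.
rewrite exprS -mulrA normrM; apply: ler_wpM2l => //.
rewrite -(mul1r (lw r ^+ k)); apply: (@ln_kernel_bound _ 1) => //; first by rewrite r0.
rewrite mul1r expr1 normrM (gtr0_norm r0); apply: le_trans (bq r _); last by rewrite r0.
by rewrite ler_piMl// ltW.
Unshelve. all: end_near. Qed.

(** The differential equation of polylogarithms: the [s]-derivative of the kernel is an
    [r]-derivative by the Cauchy-Riemann relation, and integration by parts lowers the order. *)
Lemma dv_Bk k s : (0 < k)%N -> dv (Bk k.+1) s (- k.+1%:R * Yk k s).
Proof.
move=> k0; rewrite -(@ln_parts k (fun r => rr r s) (fun r => kaps r s)).
- apply: (@dv_under _ _ _ (s - 1) (s + 1) _ (fun s r => ln r ^+ k.+1 * kap r s) (fun s r => ln r ^+ k.+1 * kaps r s) (fun r => 3 * lw r ^+ k.+1)).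
  + by lra.
  + by move=> t _; exact/integ_logb/logb_Bk.
  + move=> t r _ r01; apply: dv_eq; first exact: dvM (dv_cst _ _) (dv_kap_s (rden_ne0 t r01)).
    by rewrite mul0r add0r.
  + by move=> t r _ r01; apply: (@ln_kernel_bound _ 2) => //; exact: kaps_bound2.
  + exact/integ_logb/logb_lwX.
- by move=> r r01; apply: dv_rrr_r; exact: rden_ne0.
- exact: logb_kaps.
- exact: logb_Yk.
- by apply: cvg1_kernel => // r r01; exact: rr_bound.
Qed.

Lemma dv_Yk k s : (0 < k)%N -> dv (Yk k.+1) s (k.+1%:R * Bk k s).
Proof.
move=> k0.
have e := @ln_parts k (fun r => kap r s) (fun r => - rrs r s).
have l1 : logb 0 1 (fun r => ln r ^+ k.+1 * - rrs r s).
  by apply: logb_ext (logbN (@logb_rrs k.+1 s _)) => // r _; rewrite mulrN.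
have := e (fun r r01 => dv_rkap_r (rden_ne0 s r01)) l1 (logb_Bk s k0)
  (@cvg1_kernel k.+1 _ k0 (fun r r01 => kap_bound s r01)).
move=> /(congr1 -%R); rewrite mulNr opprK => <-.
rewrite -itgN; last exact: integ_logb.
rewrite (@itg_ext _ _ _ _ (fun r => ln r ^+ k.+1 * rrs r s)); last by move=> r _; ring.
apply: (@dv_under _ _ _ (s - 1) (s + 1) _ (fun s r => ln r ^+ k.+1 * rr r s) (fun s r => ln r ^+ k.+1 * rrs r s) (fun r => 3 * lw r ^+ k.+1)).
- by lra.
- by move=> t _; exact/integ_logb/logb_Yk.
- move=> t r _ r01; apply: dv_eq; first exact: dvM (dv_cst _ _) (dv_rr_s (rden_ne0 t r01)).
  by rewrite mul0r add0r.
- by move=> t r _ r01; apply: (@ln_kernel_bound _ 2) => //; exact: rrs_bound2.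
- exact/integ_logb/logb_lwX.
Qed.

Lemma BkN k s : (0 < k)%N -> Bk k (- s) = - Bk k s.
Proof.
move=> k0; rewrite /Bk -itgN; last exact/integ_logb/logb_Bk.
by apply: itg_ext => r _; rewrite /kap /rden sinN cosN; ring.
Qed.

Lemma YkN k s : Yk k (- s) = Yk k s.
Proof. by apply: itg_ext => r _; rewrite /rr /rden cosN. Qed.

(** At [s = 0] and [s = pi] the kernel is real; these zeros fix the constants of integration. *)
Lemma Bk_sin0 k s : sin s = 0 -> Bk k s = 0.
Proof.
move=> s0; rewrite /Bk (@itg_ext _ _ _ _ (fun=> 0)); last by move=> r _; rewrite /kap s0 mul0r mulr0.
by rewrite itg_cst ?mul0r.
Qed.

End radial_kernels.

(** * The lowest orders of the ladder and quadratic moments of [lsin] and [lcos] *)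

Section radial_constants.
Context {R : realType}.
Implicit Types (r s m x y : R) (k : nat).

Let p0 : 0 < (pi : R). Proof. exact: pi_gt0. Qed.

Lemma bounded_lnX_local k (q : R -> R) (M : R) : contin 0 1 q -> (forall r, 0 < r < 1 -> `|q r| <= M) ->
  logb 0 1 (fun r => ln r ^+ k * q r).
Proof.
move=> cq bq; apply: logbM; last exact: logb_bounded cq bq.
by apply: logbX; exact: logb_ln01.
Qed.

(** For [k = 0] and [k = 1] there are too few logarithms to absorb the double pole, so the ladder
    starts from bounds that are uniform only for [s] away from [pi]. *)
Lemma kaps_local m : 0 < m < pi -> exists2 M : R, 0 <= M & forall r s, 0 < r < 1 -> - m < s < m ->
  [/\ `|kaps r s| <= M, `|rrs r s| <= M, `|kap r s| <= M & `|rr r s| <= M].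
Proof.
move=> mp; have [e e0 he] := rden_local mp; exists (3 / e); first by rewrite divr_ge0// ltW.
move=> r s r01 sm; have d0 := rden_gt0 s r01; have de := he r s r01 sm.
have h : (rden r s)^-1 <= e^-1 by rewrite lef_pV2.
have h3 : 3 / rden r s <= 3 / e by rewrite ler_pM2l.
have i0 : 0 <= (rden r s)^-1 by rewrite invr_ge0 ltW.
split.
- exact: le_trans (kaps_bound s r01) h3.
- exact: le_trans (rrs_bound s r01) h3.
- apply: le_trans h3; rewrite /kap normrM normfV (gtr0_norm d0).
  by apply: ler_wpM2r => //; apply: le_trans (sin_max s) _; lra.
- apply: le_trans h3; rewrite /rr normrM normfV (gtr0_norm d0).
  apply: ler_wpM2r => //; apply: le_trans (ler_normD _ _) _.
  by have := cos_max s; rewrite (@gtr0_norm _ r); lra.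
Qed.

Lemma local_window s : - pi < s < pi -> exists2 m : R, 0 < m < pi & - m < s < m.
Proof.
move=> sp; have sn : `|s| < pi by rewrite ltr_norml.
exists ((`|s| + pi) / 2); first by have := normr_ge0 s; lra.
by rewrite -ltr_norml; lra.
Qed.

Lemma logb_local k s : - pi < s < pi -> [/\ logb 0 1 (fun r => ln r ^+ k * kap r s),
  logb 0 1 (fun r => ln r ^+ k * rr r s), logb 0 1 (fun r => ln r ^+ k * kaps r s) &
  logb 0 1 (fun r => ln r ^+ k * rrs r s)].
Proof.
move=> sp; have [m mp sm] := local_window sp; have [M M0 hM] := kaps_local mp.
split.
- by apply: (@bounded_lnX_local k _ M (@contin_kap _ s)) => r r01; have [] := hM r s r01 sm.
- by apply: (@bounded_lnX_local k _ M (@contin_rr _ s)) => r r01; have [] := hM r s r01 sm.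
- by apply: (@bounded_lnX_local k _ M (@contin_kaps _ s)) => r r01; have [] := hM r s r01 sm.
- by apply: (@bounded_lnX_local k _ M (@contin_rrs _ s)) => r r01; have [] := hM r s r01 sm.
Qed.

Lemma dv_Bk_local k s : - pi < s < pi ->
  dv (Bk k) s (itg 0 1 (fun r => ln r ^+ k * kaps r s)).
Proof.
move=> sp; have [m mp sm] := local_window sp; have [M M0 hM] := kaps_local mp.
have ll := @logb_ln01 R.
have lk : logb 0 1 (fun r => M * `|ln r ^+ k|).
  by apply: logbM; [exact: logb_cst|apply: logb_norm; exact: logbX].
apply: (@dv_under _ _ _ (- m) m _ (fun s r => ln r ^+ k * kap r s) (fun s r => ln r ^+ k * kaps r s)
  (fun r => M * `|ln r ^+ k|)) => //.
- by move=> t tm; apply: integ_logb; have [] := @logb_local k t ltac:(lra).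
- move=> t r _ r01; apply: dv_eq; first exact: dvM (dv_cst _ _) (dv_kap_s (rden_ne0 t r01)).
  by rewrite mul0r add0r.
- move=> t r tm r01; rewrite normrM mulrC; apply: ler_wpM2r => //.
  by have [] := hM r t r01 tm.
- exact: integ_logb.
Qed.

Lemma dv_Yk_local k s : - pi < s < pi ->
  dv (Yk k) s (itg 0 1 (fun r => ln r ^+ k * rrs r s)).
Proof.
move=> sp; have [m mp sm] := local_window sp; have [M M0 hM] := kaps_local mp.
have ll := @logb_ln01 R.
have lk : logb 0 1 (fun r => M * `|ln r ^+ k|).
  by apply: logbM; [exact: logb_cst|apply: logb_norm; exact: logbX].
apply: (@dv_under _ _ _ (- m) m _ (fun s r => ln r ^+ k * rr r s) (fun s r => ln r ^+ k * rrs r s)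
  (fun r => M * `|ln r ^+ k|)) => //.
- by move=> t tm; apply: integ_logb; have [] := @logb_local k t ltac:(lra).
- move=> t r _ r01; apply: dv_eq; first exact: dvM (dv_cst _ _) (dv_rr_s (rden_ne0 t r01)).
  by rewrite mul0r add0r.
- move=> t r tm r01; rewrite normrM mulrC; apply: ler_wpM2r => //.
  by have [] := hM r t r01 tm.
- exact: integ_logb.
Qed.

Lemma cvg1_ln (q : R -> R) M : (forall r, 0 < r < 1 -> `|q r| <= M) ->
  ln r ^+ 1 * (r * q r) @[r --> 1^'-] --> (0 : R).
Proof.
move=> bq; have M0 : 0 <= M by apply: le_trans (bq (1 / 2) _); [exact: normr_ge0|lra].
have c0 : M * `|ln r| @[r --> 1^'-] --> (0 : R).
  apply: cvg_at_left_filter; rewrite -[X in _ --> X](mulr0 M).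
  have c1 : ln r @[r --> (1 : R)] --> (0 : R) by cvg_auto; rewrite ?ln1.
  have c3 := cvg_norm c1; rewrite normr0 in c3.
  by apply: cvgM (c3 _); exact: cvg_cst.
apply/cvgrPdist_le => /= e e0; move/cvgrPdist_le : c0 => /(_ e e0) c0; near=> r.
have r1 : r < 1 by [].
have r0 : 0 < r by near: r; exact: nbhs_left_gt.
rewrite sub0r normrN; apply: le_trans (_ : M * `|ln r| <= _); last first.
  apply: le_trans (ler_norm _) _; rewrite -normrN -sub0r; near: r; exact: c0.
rewrite expr1 normrM mulrC; apply: ler_wpM2r => //.
rewrite normrM (gtr0_norm r0); apply: le_trans (bq r _); last by rewrite r0.
by rewrite ler_piMl// ltW.
Unshelve. all: end_near. Qed.

Lemma rden1 s : rden 1 s = 2 * (1 + cos s).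
Proof. by rewrite /rden; ring. Qed.

(** The primitive is [r * rr r s], and the real part of [1 / (1 + e^{is})] is [1 / 2] for every
    [s]. *)
Lemma itg_kaps s : - pi < s < pi -> itg 0 1 (fun r => kaps r s) = 1 / 2.
Proof.
move=> sp; have c1 : 0 < 1 + cos s.
  have sn : `|s| < pi by rewrite ltr_norml.
  by rewrite -ltrBlDl sub0r -cospi -(cos_norm s) ltr_cos ?in_itv/= ?normr_ge0 ?lexx//=; lra.
have d1 : rden 1 s != 0 by rewrite rden1 gt_eqF//; lra.
have [_ _ l _] := @logb_local 0 s sp.
rewrite (@FTC_logb _ _ _ _ (fun r => r * rr r s) 0 (1 / 2)) ?subr0//.
- by apply: logb_ext l => r _; rewrite expr0 mul1r.
- by move=> r r01; apply: dv_rrr_r; exact: rden_ne0.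
- apply: cvg_at_right_filter; apply: dv_cvg_eq; first apply: dv_rrr_r.
    by rewrite /rden expr0n /= mulr0 mul0r !addr0 oner_neq0.
  by rewrite mul0r.
- apply: cvg_at_left_filter; apply: dv_cvg_eq; first exact: dv_rrr_r.
  by rewrite mul1r /rr rden1; field; rewrite gt_eqF.
Qed.

(** The primitive is [ln |r + e^{is}|], and [|1 + e^{is}| = 2 cos (s / 2)]. *)
Lemma itg_rr s : - pi < s < pi -> itg 0 1 (fun r => rr r s) = lcos (s / 2).
Proof.
move=> sp; have c1 : 0 < 1 + cos s.
  have sn : `|s| < pi by rewrite ltr_norml.
  by rewrite -ltrBlDl sub0r -cospi -(cos_norm s) ltr_cos ?in_itv/= ?normr_ge0 ?lexx//=; lra.
have ch : 0 < cos (s / 2) by apply: cos_pos; lra.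
have d1 : 0 < rden 1 s by rewrite rden1; lra.
have d0 : 0 < rden 0 s by rewrite /rden expr0n /= mulr0 mul0r !addr0.
have [_ l _ _] := @logb_local 0 s sp.
rewrite (@FTC_logb _ _ _ _ (fun r => rlog r s) 0 (lcos (s / 2))) ?subr0//.
- by apply: logb_ext l => r _; rewrite expr0 mul1r.
- by move=> r r01; apply: dv_rlog_r; exact: rden_gt0.
- apply: cvg_at_right_filter; apply: dv_cvg_eq; first exact: dv_rlog_r.
  by rewrite /rlog /rden expr0n /= mulr0 mul0r !addr0 ln1 mul0r.
- apply: cvg_at_left_filter; apply: dv_cvg_eq; first exact: dv_rlog_r.
  rewrite /rlog rden1 {1}(_ : s = 2 * (s / 2)); last by field.
  rewrite cos2x /lcos (_ : 2 * _ = (2 * cos (s / 2)) ^+ 2); last by ring.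
  by rewrite lnXn ?mulr_gt0// mulr2n; field.
Qed.

(** The integral measures how much the argument of [r + e^{is}] falls from [r = 0] to [r = 1],
    namely from [s] to [s / 2]. *)
Lemma B0E s : 0 <= s < pi -> itg 0 1 (fun r => ln r ^+ 0 * kap r s) = s / 2.
Proof.
move=> sp; rewrite -/(Bk 0 s).
have z : Bk 0 0 = 0 :> R by rewrite Bk_sin0// sin0.
have [->|s0] := eqVneq s 0; first by rewrite z mul0r.
have s1 : 0 < s by lra.
have d (t : R) : - pi < t < pi -> dv (Bk 0) t (1 / 2).
  move=> tp; apply: dv_eq (dv_Bk_local 0 tp) _; rewrite -(itg_kaps tp).
  by apply: itg_ext => r _; rewrite expr0 mul1r.
have := @FTC_logb _ 0 s (fun=> 1 / 2) (Bk 0) 0 (Bk 0 s) s1 (logb_cst _ _ _).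
rewrite itg_cst ?(ltW s1)// !subr0 => <-.
- by field.
- by move=> t ts; apply: d; lra.
- by apply: cvg_at_right_filter; rewrite -[X in _ --> X]z; apply: dv_cvg; apply: d; lra.
- by apply: cvg_at_left_filter; apply: dv_cvg; apply: d; lra.
Qed.

Lemma dv_B1 s : - pi < s < pi -> dv (Bk 1) s (- lcos (s / 2)).
Proof.
move=> sp; apply: dv_eq (dv_Bk_local 1 sp) _.
have [_ l2 l3 _] := @logb_local 0 s sp; have [_ _ l4 _] := @logb_local 1 s sp.
have [m mp sm] := local_window sp; have [M M0 hM] := kaps_local mp.
rewrite (@ln_parts _ 0 (fun r => rr r s)) => //.
- rewrite mulN1r -itg_rr//; congr (- _); apply: itg_ext => r _.
  by rewrite expr0 mul1r.
- by move=> r r01; apply: dv_rrr_r; exact: rden_ne0.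
- by apply: (@cvg1_ln _ M) => r r01; have [] := hM r s r01 sm.
Qed.

Lemma dv_Y1 s : 0 <= s < pi -> dv (Yk 1) s (s / 2).
Proof.
move=> sp; apply: dv_eq (dv_Yk_local 1 _) _; first lra.
have sp' : - pi < s < pi by lra.
have [l1 _ _ _] := @logb_local 0 s sp'; have [_ _ _ l4] := @logb_local 1 s sp'.
have [m mp sm] := local_window sp'; have [M M0 hM] := kaps_local mp.
have l5 : logb 0 1 (fun r => ln r ^+ 1 * - rrs r s).
  by apply: logb_ext (logbN l4) => r _; rewrite mulrN.
have e := @ln_parts _ 0 (fun r => kap r s) (fun r => - rrs r s)
  (fun r r01 => dv_rkap_r (rden_ne0 s r01)) l5 l1.
rewrite -(B0E sp); apply: oppr_inj; rewrite -itgN; last exact: integ_logb.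
rewrite -mulN1r -e.
  by apply: itg_ext => r _; rewrite mulrN.
by apply: (@cvg1_ln _ M) => r r01; have [] := hM r s r01 sm.
Qed.

(** The quadratic follows from the derivative [s / 2]. The constant, in effect the value of
    [zeta(2)], comes from the next rung: [Bk 2] vanishes at [0] and at [pi], so [Yk 1] has mean zero
    over [[0, pi]]. *)
Lemma Y1E s : 0 <= s <= pi -> Yk 1 s = s ^+ 2 / 4 - pi ^+ 2 / 12.
Proof.
have hs x : 0 <= x <= pi -> Yk 1 x = x ^+ 2 / 4 + Yk 1 0.
  move=> xp; have [->|x0] := eqVneq x 0; first by rewrite expr0n /= mul0r add0r.
  have x1 : 0 < x by lra.
  have l2 : logb 0 x (fun s : R => s / 2) by logb_auto.
  have h2 : logb 0 x (fun s : R => s / 2) by logb_auto.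
  have := @FTC_logb _ 0 x (fun s => s / 2) (Yk 1) (Yk 1 0) (Yk 1 x) x1 l2.
  move=> /(_ ltac:(by move=> t ts; apply: dv_Y1; lra)).
  move=> /(_ (cvg_at_right_filter (@cvg_Yk _ 1 0 isT)) (cvg_at_left_filter (@cvg_Yk _ 1 x isT))).
  have := @FTC_logb _ 0 x (fun s => s / 2) (fun s => s ^+ 2 / 4) 0 (x ^+ 2 / 4) x1 l2.
  move=> /(_ ltac:(by move=> t ts; dv_auto; rewrite /= expr1; field)) -> //.
  - by lra.
  - by apply: cvg_at_right_filter; cvg_auto; rewrite expr0n /= mul0r.
  - by apply: cvg_at_left_filter; cvg_auto.
move=> sp; rewrite hs//.
have l2 : logb 0 pi (fun s : R => - 2 * (s ^+ 2 / 4 + Yk 1 0)) by logb_auto.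
have B20 : Bk 2 0 = 0 :> R by rewrite Bk_sin0// sin0.
have B2p : Bk 2 pi = 0 :> R by rewrite Bk_sin0// sinpi.
have := @FTC_logb _ 0 pi _ (Bk 2) 0 0 p0 l2.
move=> /(_ ltac:(by move=> t ts; apply: dv_eq (@dv_Bk _ 1 t isT) _; rewrite hs//; lra)).
have c1 : Bk 2 x @[x --> 0^'+] --> (0 : R).
  by apply: cvg_at_right_filter; rewrite -[X in _ --> X]B20; exact: cvg_Bk.
have c2 : Bk 2 x @[x --> pi^'-] --> (0 : R).
  by apply: cvg_at_left_filter; rewrite -[X in _ --> X]B2p; exact: cvg_Bk.
move=> /(_ c1 c2).
rewrite (@FTC_logb _ 0 pi _ (fun s => - 2 * (s ^+ 3 / 12 + Yk 1 0 * s)) 0 (- 2 * (pi ^+ 3 / 12 + Yk 1 0 * pi))) //.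
- rewrite !subr0 (_ : - 2 * _ = - 2 * pi * (pi ^+ 2 / 12 + Yk 1 0)); last by field.
  move/eqP; rewrite !mulf_eq0 (gt_eqF p0) orbF => /orP[|] /eqP; lra.
- by move=> t ts; dv_auto; rewrite /=; field.
- by apply: cvg_at_right_filter; cvg_auto; rewrite expr0n /= mul0r mulr0 addr0 mulr0.
- by apply: cvg_at_left_filter; cvg_auto.
Qed.

Lemma B2E s : 0 <= s <= pi -> Bk 2 s = pi ^+ 2 * s / 6 - s ^+ 3 / 6.
Proof.
move=> sp; have B20 : Bk 2 0 = 0 :> R by rewrite Bk_sin0// sin0.
have [->|x0] := eqVneq s 0; first by rewrite B20 expr0n /=; field.
have s1 : 0 < s by lra.
have l2 : logb 0 s (fun t : R => - 2 * (t ^+ 2 / 4 - pi ^+ 2 / 12)) by logb_auto.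
have := @FTC_logb _ 0 s _ (Bk 2) 0 (Bk 2 s) s1 l2.
move=> /(_ ltac:(by move=> t ts; apply: dv_eq (@dv_Bk _ 1 t isT) _; rewrite Y1E//; lra)).
have c1 : Bk 2 x @[x --> 0^'+] --> (0 : R).
  by apply: cvg_at_right_filter; rewrite -[X in _ --> X]B20; exact: cvg_Bk.
move=> /(_ c1 (cvg_at_left_filter (@cvg_Bk _ 2 s isT))).
rewrite subr0 => <-.
rewrite (@FTC_logb _ 0 s _ (fun t => pi ^+ 2 * t / 6 - t ^+ 3 / 6) 0 (pi ^+ 2 * s / 6 - s ^+ 3 / 6)) ?subr0//.
- by move=> t ts; dv_auto; rewrite /=; field.
- by apply: cvg_at_right_filter; cvg_auto; rewrite expr0n /=; ring.
- by apply: cvg_at_left_filter; cvg_auto.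
Qed.

(* [p G1 - p' G2 + p'' G3] is the primitive of [p h] when [h, G1, G2] are the
   derivatives of [G1, G2, G3] and [p] is quadratic. *)
Lemma itg_quadratic b (h G1 G2 G3 : R -> R) (u v w : R) : 0 < b -> logb 0 b h ->
  (forall x, 0 < x < b -> dv G1 x (h x)) ->
  (forall x, 0 < x < b -> dv G2 x (G1 x)) -> (forall x, 0 < x < b -> dv G3 x (G2 x)) ->
  G1 0 = 0 -> G2 0 = 0 -> G3 0 = 0 ->
  (forall x, 0 <= x <= b -> G1 t @[t --> x] --> G1 x) ->
  (forall x, 0 <= x <= b -> G2 t @[t --> x] --> G2 x) ->
  (forall x, 0 <= x <= b -> G3 t @[t --> x] --> G3 x) ->
  itg 0 b (fun x => (u + v * x + w * x ^+ 2) * h x) =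
    (u + v * b + w * b ^+ 2) * G1 b - (v + 2 * w * b) * G2 b + 2 * w * G3 b.
Proof.
move=> b0 lh d1 d2 d3 z1 z2 z3 c1 c2 c3.
pose F x := (u + v * x + w * x ^+ 2) * G1 x - (v + 2 * w * x) * G2 x + 2 * w * G3 x.
have cF x : 0 <= x <= b -> F t @[t --> x] --> F x.
  move=> xb; have a1 : u + v * t + w * t ^+ 2 @[t --> x] --> u + v * x + w * x ^+ 2 by cvg_auto.
  have a2 : v + 2 * w * t @[t --> x] --> v + 2 * w * x by cvg_auto.
  apply: cvgD; first apply: cvgB.
  - exact: cvgM a1 (c1 x xb).
  - exact: cvgM a2 (c2 x xb).
  - by apply: cvgM; [exact: cvg_cst|exact: c3].
rewrite (@FTC_logb _ 0 b _ F 0 (F b)) ?subr0; [reflexivity|exact: b0| | | |].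
- by logb_auto.
- move=> x xb; have e1 := d1 x xb; have e2 := d2 x xb; have e3 := d3 x xb.
  by rewrite /F; dv_auto; rewrite /= expr1; ring.
- apply: cvg_at_right_filter; have e0 : F 0 = 0 by rewrite /F z1 z2 z3; ring.
  by rewrite -[X in _ --> X]e0; apply: cF; lra.
- by apply: cvg_at_left_filter; apply: cF; lra.
Qed.

(** The ladder supplies three successive primitives of [lcos] at the doubled argument; those of even
    and odd order are corrected by a constant and a linear term in [Yk 2 0] so as to vanish at
    [0]. *)
Lemma lcos_moment b (u v w : R) : 0 < b <= pi / 2 ->
  itg 0 b (fun x => (u + v * x + w * x ^+ 2) * lcos x) =
    - (u + v * b + w * b ^+ 2) * (Bk 1 (2 * b) / 2)
    + (v + 2 * w * b) * ((Yk 2 (2 * b) - Yk 2 0) / 8)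
    + 2 * w * (Bk 3 (2 * b) / 48 + Yk 2 0 * b / 8).
Proof.
move=> bp.
have dB k (x : R) : (0 < k)%N -> dv (fun t => Bk k.+1 (2 * t)) x (- k.+1%:R * Yk k (2 * x) * 2).
  move=> k0; have d2 : dv (fun t : R => 2 * t) x 2 by dv_auto; ring.
  exact: (@dv_comp _ (Bk k.+1) (fun t : R => 2 * t) x _ _ (dv_Bk _ k0) d2).
have dY k (x : R) : (0 < k)%N -> dv (fun t => Yk k.+1 (2 * t)) x (k.+1%:R * Bk k (2 * x) * 2).
  move=> k0; have d2 : dv (fun t : R => 2 * t) x 2 by dv_auto; ring.
  exact: (@dv_comp _ (Yk k.+1) (fun t : R => 2 * t) x _ _ (dv_Yk _ k0) d2).
have B0 k : Bk k 0 = 0 :> R by rewrite Bk_sin0// sin0.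
rewrite (@itg_quadratic b lcos (fun y => - (Bk 1 (2 * y) / 2)) (fun y => - ((Yk 2 (2 * y) - Yk 2 0) / 8))
  (fun y => Bk 3 (2 * y) / 48 + Yk 2 0 * y / 8)).
- by rewrite mulrN mulrN opprK mulNr.
- by lra.
- by apply: lcos_logb; lra.
- move=> t ty; have d1 := @dv_B1 (2 * t) ltac:(lra).
  have d2 : dv (fun t : R => 2 * t) t 2 by dv_auto; ring.
  have d3 := @dv_comp _ (Bk 1) (fun t : R => 2 * t) t _ _ d1 d2.
  dv_auto; rewrite (_ : 2 * t / 2 = t); last by field.
  by field.
- by move=> x _; have d := dY 1%N x isT; dv_auto; field.
- by move=> x _; have d := dB 2%N x isT; dv_auto; field.
- by rewrite mulr0 B0 mul0r oppr0.
- by rewrite mulr0 subrr mul0r oppr0.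
- by rewrite mulr0 B0; ring.
- move=> z _; apply: cvgN; apply: cvgM; last exact: cvg_cst.
  have c2 : (2 * t : R) @[t --> z] --> 2 * z by cvg_auto.
  exact: (@cvg_comp _ _ _ (fun t : R => 2 * t) (Bk 1) _ _ _ c2 (@cvg_Bk _ 1 (2 * z) isT)).
- by move=> x _; have d := dY 1%N x isT; cvg_auto.
- by move=> x _; have d := dB 2%N x isT; cvg_auto.
Qed.

(** The same ladder run downwards from [pi], because [lsin x = lcos (pi / 2 - x)]; now [Bk] vanishes
    at the base point [pi]. *)
Lemma lsin_moment b (u v w : R) : 0 < b <= pi ->
  itg 0 b (fun x => (u + v * x + w * x ^+ 2) * lsin x) =
    (u + v * b + w * b ^+ 2) * (Bk 1 (pi - 2 * b) / 2)
    + (v + 2 * w * b) * ((Yk 2 (pi - 2 * b) - Yk 2 pi) / 8)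
    - 2 * w * (Bk 3 (pi - 2 * b) / 48 - Yk 2 pi * b / 8).
Proof.
move=> bp.
have dl x : dv (fun t : R => pi - 2 * t) x (- 2) by dv_auto; ring.
have dB k (x : R) : (0 < k)%N -> dv (fun t => Bk k.+1 (pi - 2 * t)) x (- k.+1%:R * Yk k (pi - 2 * x) * - 2).
  by move=> k0; exact: (@dv_comp _ (Bk k.+1) (fun t : R => pi - 2 * t) x _ _ (dv_Bk _ k0) (dl x)).
have dY k (x : R) : (0 < k)%N -> dv (fun t => Yk k.+1 (pi - 2 * t)) x (k.+1%:R * Bk k (pi - 2 * x) * - 2).
  by move=> k0; exact: (@dv_comp _ (Yk k.+1) (fun t : R => pi - 2 * t) x _ _ (dv_Yk _ k0) (dl x)).
have B0 k : Bk k pi = 0 :> R by rewrite Bk_sin0// sinpi.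
rewrite (@itg_quadratic b lsin (fun y => Bk 1 (pi - 2 * y) / 2) (fun y => - ((Yk 2 (pi - 2 * y) - Yk 2 pi) / 8))
  (fun y => - (Bk 3 (pi - 2 * y) / 48 - Yk 2 pi * y / 8))).
- by rewrite mulrN mulrN opprK.
- by lra.
- by apply: lsin_logb; lra.
- move=> t ty; have d1 := @dv_B1 (pi - 2 * t) ltac:(lra).
  have d3 := @dv_comp _ (Bk 1) (fun t : R => pi - 2 * t) t _ _ d1 (dl t).
  dv_auto; rewrite (_ : (pi - 2 * t) / 2 = pi / 2 - t); last by field.
  by rewrite lcosB_pihalf; field.
- by move=> x _; have d := dY 1%N x isT; dv_auto; field.
- by move=> x _; have d := dB 2%N x isT; dv_auto; field.
- by rewrite mulr0 subr0 B0 mul0r.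
- by rewrite mulr0 subr0 subrr mul0r oppr0.
- by rewrite mulr0 subr0 B0; ring.
- move=> z _; apply: cvgM; last exact: cvg_cst.
  have c2 : (pi - 2 * t : R) @[t --> z] --> pi - 2 * z by cvg_auto.
  exact: (@cvg_comp _ _ _ (fun t : R => pi - 2 * t) (Bk 1) _ _ _ c2 (@cvg_Bk _ 1 (pi - 2 * z) isT)).
- by move=> x _; have d := dY 1%N x isT; cvg_auto.
- by move=> x _; have d := dB 2%N x isT; cvg_auto.
Qed.

End radial_constants.

(** * Clausen and zeta values, distribution relations of the polylogarithms *)

Section polylog_constants.
Context {R : realType}.
Implicit Types (r s x y : R) (k n : nat).

Let p0 : 0 < (pi : R). Proof. exact: pi_gt0. Qed.

Lemma logb_lnX k : logb 0 1 (fun r : R => ln r ^+ k).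
Proof. by apply: logbX; exact: logb_ln01. Qed.

Lemma logb_powln n k : logb 0 1 (fun r : R => r ^+ n * ln r ^+ k).
Proof. by have h := logb_lnX k; logb_auto. Qed.

Lemma itg_powln n k : itg 0 1 (fun r : R => r ^+ n * ln r ^+ k) =
  (-1) ^+ k * k`!%:R / n.+1%:R ^+ k.+1.
Proof.
have n0 : n.+1%:R != 0 :> R by rewrite pnatr_eq0.
elim: k => [|k ih].
  rewrite (@FTC_logb _ _ _ _ (fun r => r ^+ n.+1 / n.+1%:R) 0 (1 / n.+1%:R)) ?subr0//.
  - by rewrite expr0 expr1 fact0 !mul1r.
  - exact: logb_powln.
  - by move=> r _; dv_auto; rewrite /= expr0; field.
  - by apply: cvg_at_right_filter; cvg_auto; rewrite expr0n /= mul0r.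
  - by apply: cvg_at_left_filter; cvg_auto; rewrite expr1n.
have i1 := integ_logb (logb_powln n k); have i2 := integ_logb (logb_powln n k.+1).
have l1 := logb_powln n k; have l2 := logb_powln n k.+1.
have : itg 0 1 (fun r : R => n.+1%:R * (r ^+ n * ln r ^+ k.+1) + k.+1%:R * (r ^+ n * ln r ^+ k)) = 0.
  rewrite (@FTC_logb _ _ _ _ (fun r => r ^+ n.+1 * ln r ^+ k.+1) 0 0) ?subrr//.
  - by logb_auto.
  - move=> r r01; dv_auto; first lra.
    by rewrite /= !exprS; field; rewrite gt_eqF//; lra.
  - have := logb_mul_prim0 ltr01 l2 (logb_cst 0 1 1); apply: cvg_trans; apply: near_eq_cvg.
    near=> r; rewrite itg_cst; last by apply: ltW.
    by rewrite (exprS r n); ring.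
  - by apply: cvg_at_left_filter; cvg_auto; [lra|rewrite ln1 expr0n /= mulr0].
rewrite itgD; [|exact: integZ..]; rewrite !itgZ// ih => /eqP.
rewrite addr_eq0 => /eqP h; apply: (mulfI n0); rewrite h factS natrM !exprS.
by move: (n.+1%:R : R) n0 => N n0; field; rewrite ?n0 ?expf_neq0.
Unshelve. all: end_near. Qed.

Lemma invn_pow_cvg0 k : (n.+1%:R ^+ k.+1)^-1 @[n --> \oo] --> (0 : R).
Proof.
apply: (@squeeze_cvgr _ _ _ _ (fun=> 0) (fun n => n.+1%:R^-1)) => //.
- near=> n; rewrite invr_ge0 exprn_ge0//=.
  rewrite lef_pV2 ?posrE ?exprn_gt0//.
  by rewrite exprS ler_peMr// exprn_ege1// (ler_nat R 1).
- exact: cvg_cst.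
- exact: cvg_harmonic.
Unshelve. all: end_near. Qed.

Lemma itg_sum (N : nat) (f : nat -> R -> R) a b : (forall n, integ a b (f n)) ->
  integ a b (fun r => \sum_(0 <= n < N) f n r) /\
  itg a b (fun r => \sum_(0 <= n < N) f n r) = \sum_(0 <= n < N) itg a b (f n).
Proof.
move=> fi; elim: N => [|N [ih1 ih2]].
  rewrite big_geq//; split.
    by apply: integ_ext (integ_cst a b 0) => x _; rewrite big_geq.
  rewrite (@itg_ext _ _ _ _ (fun=> 0)); last by move=> x _; rewrite big_geq.
  have [ab|ba] := leP a b; first by rewrite itg_cst// mul0r.
  by rewrite itg_nil// ltW.
split.
  by apply: integ_ext (integD ih1 (fi N)) => x _; rewrite big_nat_recr.
rewrite big_nat_recr//= -ih2 -itgD//; apply: itg_ext => x _.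
by rewrite big_nat_recr.
Qed.

(** A finite geometric sum in imaginary parts. As [2 cos (pi / 3) = 1], the sines satisfy a
    recurrence with coefficients [1] and [- 1], whose generating denominator is [1 - r + r^2]. *)
Lemma sin_sum_pi3 (N : nat) r : (1 - r + r ^+ 2) * (\sum_(0 <= n < N) r ^+ n * sin (n.+1%:R * (pi / 3))) =
  sin (pi / 3) - r ^+ N * sin (N.+1%:R * (pi / 3)) + r ^+ N.+1 * sin (N%:R * (pi / 3)).
Proof.
elim: N => [|N ih]; first by rewrite big_geq// expr0 expr1 mul1r !mul0r mul1r sin0; ring.
rewrite big_nat_recr//= mulrDr ih.
have e : sin (N.+2%:R * (pi / 3)) = sin (N.+1%:R * (pi / 3)) - sin (N%:R * (pi / 3) : R).
  have h1 : N.+2%:R * (pi / 3) = N.+1%:R * (pi / 3) + pi / 3 :> R by rewrite -(natr1 N.+1); ring.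
  have h2 : N%:R * (pi / 3) = N.+1%:R * (pi / 3) - pi / 3 :> R by rewrite -(natr1 N); ring.
  by rewrite h1 h2 sinD sinB cos_pi3; field.
by rewrite e !exprS; ring.
Qed.

Lemma rden_2pi3 r : rden r (2 * pi / 3) = 1 - r + r ^+ 2.
Proof.
rewrite /rden (_ : 2 * pi / 3 = 2 * (pi / 3)); last by field.
by rewrite cos2x cos_pi3; field.
Qed.

Lemma sin_2pi3 : sin (2 * pi / 3) = sin (pi / 3) :> R.
Proof. by rewrite -sinBpi; congr sin; field. Qed.

(** Since [- e^{- 2 pi i / 3} = e^{i pi / 3}], expanding the kernel in powers of [r] and integrating
    termwise against [ln r ^+ k] gives the Clausen series at [pi / 3]. *)
Lemma Bk_Cl k : (0 < k)%N -> Bk k (2 * pi / 3) = (-1) ^+ k * k`!%:R * Cl k.+1 (pi / 3 : R).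
Proof.
move=> k0; pose th : R := pi / 3.
pose u (j : nat) : R := sin (j.+1%:R * th) / j.+1%:R ^+ k.+1.
have sq : (-1) ^+ k * (-1) ^+ k = 1 :> R by rewrite -exprMn mulrNN mul1r expr1n.
have f0 : k`!%:R != 0 :> R by rewrite pnatr_eq0 -lt0n fact_gt0.
pose K : R := (-1) ^+ k * k`!%:R.
have K0 : K != 0 by rewrite /K mulf_neq0// expf_neq0// oppr_eq0 oner_neq0.
have lB := @logb_Bk R k (2 * pi / 3) k0.
(* The remainder of the kernel is at most [2 r^N] over [1 - r + r^2 >= 3 / 4], hence the constant
   [8 / 3]. *)
have bound N : `|Bk k (2 * pi / 3) - K * series u N| <= 8 / 3 * k`!%:R * (N.+1%:R ^+ k.+1)^-1.
  have ip n : integ 0 1 (fun r => ln r ^+ k * (r ^+ n * sin (n.+1%:R * th))).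
    apply: integ_ext (integZ (sin (n.+1%:R * th)) (integ_logb (logb_powln n k))).
    by move=> x _; ring.
  have [iS eS] := itg_sum N ip.
  have e1 : K * series u N = itg 0 1 (fun r => \sum_(0 <= n < N) ln r ^+ k * (r ^+ n * sin (n.+1%:R * th))).
    rewrite eS /series /= big_distrr /=; apply: eq_bigr => n _.
    rewrite (@itg_ext _ _ _ _ (fun r => sin (n.+1%:R * th) * (r ^+ n * ln r ^+ k))); last by move=> x _; ring.
    rewrite itgZ; last exact/integ_logb/logb_powln.
    by rewrite itg_powln /K /u; ring.
  rewrite e1 /Bk -itgB//; last exact: integ_logb.
  have iD : integ 0 1 (fun r => ln r ^+ k * kap r (2 * pi / 3) - \sum_(0 <= n < N) ln r ^+ k * (r ^+ n * sin (n.+1%:R * th))).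
    by apply: integD; [exact: integ_logb|exact: integN].
  apply: le_trans (itg_norm iD) _.
  have -> : 8 / 3 * k`!%:R * (N.+1%:R ^+ k.+1)^-1 = itg 0 1 (fun r => 8 / 3 * (-1) ^+ k * (r ^+ N * ln r ^+ k)).
    rewrite itgZ; last exact/integ_logb/logb_powln.
    rewrite itg_powln; transitivity (((-1) ^+ k * (-1) ^+ k) * (8 / 3 * k`!%:R / N.+1%:R ^+ k.+1) : R).
      by rewrite sq mul1r.
    by ring.
  apply: le_itg; [exact: integ_norm|by apply: integZ; exact/integ_logb/logb_powln|].
  move=> r r01; rewrite -big_distrr /= -mulrBr normrM.
  have -> : 8 / 3 * (-1) ^+ k * (r ^+ N * ln r ^+ k) = `|ln r ^+ k| * (8 / 3 * r ^+ N).
    rewrite normrX ltr0_norm; last exact: ln_lt0.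
    by rewrite -[in RHS]mulN1r exprMn; ring.
  apply: ler_wpM2l => //.
  have d0 : 3 / 4 <= 1 - r + r ^+ 2.
    by rewrite -subr_ge0 (_ : _ - _ = (r - 1 / 2) ^+ 2); [exact: sqr_ge0|field].
  have d1 : 0 < 1 - r + r ^+ 2 by lra.
  have -> : kap r (2 * pi / 3) - \sum_(0 <= n < N) r ^+ n * sin (n.+1%:R * th) =
      (r ^+ N * sin (N.+1%:R * th) - r ^+ N.+1 * sin (N%:R * th)) / (1 - r + r ^+ 2).
    apply: (mulfI (lt0r_neq0 d1)); rewrite mulrBr sin_sum_pi3 /kap rden_2pi3 sin_2pi3.
    by rewrite /th; field; rewrite gt_eqF.
  rewrite normrM normfV (gtr0_norm d1) ler_pdivrMr//.
  have rN : 0 <= r ^+ N by rewrite exprn_ge0//; lra.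
  apply: le_trans (_ : 2 * r ^+ N <= _).
    apply: le_trans (ler_normB _ _) _; rewrite exprS !normrM (ger0_norm rN) (@ger0_norm _ r); last lra.
    have s1 := sin_max (N.+1%:R * th); have s2 := sin_max (N%:R * th).
    have a1 : r ^+ N * `|sin (N.+1%:R * th)| <= r ^+ N by rewrite ler_piMr.
    have a2 : r * r ^+ N * `|sin (N%:R * th)| <= r ^+ N.
      apply: le_trans (_ : r * r ^+ N <= _); first by rewrite ler_piMr// mulr_ge0//; lra.
      by rewrite ler_piMl//; lra.
    lra.
  have : r ^+ N * (3 / 4) <= r ^+ N * (1 - r + r ^+ 2) by apply: ler_wpM2l.
  lra.
have cv : series u @ \oo --> K^-1 * Bk k (2 * pi / 3).
  apply/cvgrPdist_le => /= e e0.
  have Kp : 0 < `|K| by rewrite normr_gt0.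
  have c0 : 8 / 3 * k`!%:R * (n.+1%:R ^+ k.+1)^-1 @[n --> \oo] --> (0 : R).
    rewrite -(mulr0 (8 / 3 * k`!%:R)); apply: cvgM; first exact: cvg_cst.
    exact: invn_pow_cvg0.
  have eK : 0 < e * `|K| by rewrite mulr_gt0.
  move/cvgrPdist_le : c0 => /(_ _ eK) c0; near=> N.
  rewrite -(ler_pM2r Kp) -normrM mulrBl mulrAC mulVf// mul1r (mulrC (series u N)).
  apply: le_trans (bound N) _; apply: le_trans (ler_norm _) _; rewrite -normrN -sub0r.
  by near: N; exact: c0.
have -> : Cl k.+1 (pi / 3) = K^-1 * Bk k (2 * pi / 3) by apply: (cvg_lim _ cv).
by rewrite mulrA divff// mul1r.
Unshelve. all: end_near. Qed.

Lemma rr_pi r : r < 1 -> rr r pi = - (1 - r)^-1.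
Proof.
move=> r1; rewrite /rr /rden cospi.
have h : 1 + 2 * r * -1 + r ^+ 2 = (1 - r) ^+ 2 by ring.
by rewrite h; field; rewrite gt_eqF//; lra.
Qed.

(** At [s = pi] the kernel is [- 1 / (1 - r)], a geometric series. *)
Lemma Y2pi_zeta : Yk 2 pi = - (2 * zeta (3 : R)).
Proof.
pose u (j : nat) : R := (j.+1%:R `^ 3)^-1.
have uE j : u j = (j.+1%:R ^+ 3)^-1 by rewrite /u (powR_mulrn 3).
have lY := @logb_Yk R 2 pi isT.
(* The geometric remainder [r^N / (1 - r)] is singular at [1]; one of the two logarithms absorbs the
   pole at the cost of [1 - ln r]. The two terms on the right are the moments of [- ln r] and
   [ln r ^+ 2] against [r^N]. *)
have bound N : `|- Yk 2 pi - 2 * series u N| <= (N.+1%:R ^+ 2)^-1 + 2 * (N.+1%:R ^+ 3)^-1.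
  have ip n : integ 0 1 (fun r : R => r ^+ n * ln r ^+ 2) by exact/integ_logb/logb_powln.
  have [iS eS] := itg_sum N ip.
  have e1 : 2 * series u N = itg 0 1 (fun r => \sum_(0 <= n < N) r ^+ n * ln r ^+ 2).
    rewrite eS /series /= big_distrr /=; apply: eq_bigr => n _.
    by rewrite itg_powln uE sqrrN expr1n mul1r.
  rewrite e1 /Yk -itgN; last exact: integ_logb.
  have iN := integN (integ_logb lY).
  rewrite -itgB//.
  have iD : integ 0 1 (fun r => - (ln r ^+ 2 * rr r pi) - \sum_(0 <= n < N) r ^+ n * ln r ^+ 2).
    by apply: integD => //; exact: integN.
  apply: le_trans (itg_norm iD) _.
  have i1 : integ 0 1 (fun r : R => - (r ^+ N * ln r ^+ 1)).
    by apply: integN; exact/integ_logb/logb_powln.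
  have -> : (N.+1%:R ^+ 2)^-1 + 2 * (N.+1%:R ^+ 3)^-1 =
      itg 0 1 (fun r : R => - (r ^+ N * ln r ^+ 1) + r ^+ N * ln r ^+ 2).
    rewrite itgD// itgN; last exact/integ_logb/logb_powln.
    by rewrite !itg_powln sqrrN expr1n expr1 mulN1r; congr (_ + _); rewrite ?mul1r// mulNr opprK mul1r.
  apply: le_itg; [exact: integ_norm|exact: integD|].
  move=> r r01; have q0 : 0 < 1 - r by lra.
  have geo : \sum_(0 <= n < N) r ^+ n = (1 - r ^+ N) / (1 - r).
    apply: (mulfI (lt0r_neq0 q0)); rewrite mulrCA divff ?gt_eqF// mulr1.
    by rewrite big_mkord -[in RHS](expr1n _ N) subrXX_comm ?expr1n//; [congr (_ * _); apply: eq_bigr => i _; rewrite expr1n mul1r|exact: mulrC].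
  rewrite -big_distrl /= geo rr_pi; last lra.
  rewrite (_ : - _ - _ = ln r * ln r * (r ^+ N / (1 - r))); last by rewrite expr2; field; rewrite gt_eqF.
  have rN : 0 <= r ^+ N by rewrite exprn_ge0//; lra.
  have l0 : ln r < 0 by exact: ln_lt0.
  have lb := ln_bound r01.
  rewrite !normrM normfV (gtr0_norm q0) (ger0_norm rN).
  apply: le_trans (_ : `|ln r| * ((1 - r) * (1 - ln r)) * (r ^+ N / (1 - r)) <= _).
    by apply: ler_wpM2r; [rewrite divr_ge0// ltW|apply: ler_wpM2l].
  rewrite ltr0_norm// le_eqVlt; apply/orP; left; apply/eqP.
  by rewrite expr1 expr2; field; rewrite gt_eqF.
have cv : series u @ \oo --> - Yk 2 pi / 2.
  apply/cvgrPdist_le => /= e e0.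
  have c0 : (n.+1%:R ^+ 2)^-1 + 2 * (n.+1%:R ^+ 3)^-1 @[n --> \oo] --> (0 : R).
    rewrite (_ : 0 = 0 + 2 * 0); last by rewrite mulr0 addr0.
    by apply: cvgD; [exact: invn_pow_cvg0|apply: cvgM; [exact: cvg_cst|exact: invn_pow_cvg0]].
  move/cvgrPdist_le : c0 => /(_ _ e0) c0; near=> N.
  have h : `|(N.+1%:R ^+ 2)^-1 + 2 * (N.+1%:R ^+ 3)^-1 : R| <= e by rewrite -normrN -sub0r; near: N; exact: c0.
  have := bound N; rewrite (_ : - Yk 2 pi - _ = 2 * (- Yk 2 pi / 2 - series u N)); last by field.
  rewrite normrM ger0_norm// => b.
  have q := le_trans b (le_trans (ler_norm _) h).
  apply: le_trans q; rewrite ler_peMl//; lra.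
have -> : zeta (3 : R) = - Yk 2 pi / 2 by rewrite /zeta; exact: (cvg_lim (@Rhausdorff R) cv).
by field.
Unshelve. all: end_near. Qed.

Lemma subst_pow p (f : R -> R) : logb 0 1 f -> logb 0 1 (fun r => f (r ^+ p.+1) * (p.+1%:R * r ^+ p)) ->
  itg 0 1 (fun r => f (r ^+ p.+1) * (p.+1%:R * r ^+ p)) = itg 0 1 f.
Proof.
move=> lf lg; apply: (@subst_inc _ 0 1 0 1 (fun r => r ^+ p.+1) (fun r => p.+1%:R * r ^+ p)) => //.
- by move=> x _; dv_auto; rewrite /= mulr1.
- by move=> x /andP[x0 x1]; rewrite exprn_gt0// exprn_ilt1// ltW.
- by apply: cvg_at_right_filter; cvg_auto; rewrite expr0n.
- by apply: cvg_at_left_filter; cvg_auto; rewrite expr1n.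
Qed.

Lemma ln_powS p k r : 0 < r -> ln (r ^+ p) ^+ k = p%:R ^+ k * ln r ^+ k.
Proof. by move=> r0; rewrite lnXn// -[ln r *+ p]mulr_natl exprMn. Qed.

(** Distribution relation from [r^2 - e^{-2 i s} = (r + e^{-is}) (r - e^{-is})]: the kernel at [r^2]
    is a sum of two kernels at [r], and each logarithm of [r^2] yields a factor [2]. *)
Lemma Yk_dup k s : (0 < k)%N -> Yk k (pi - 2 * s) = 2 ^+ k * (Yk k s + Yk k (pi - s)).
Proof.
move=> k0; have i1 := integ_logb (logb_Yk s k0); have i2 := integ_logb (logb_Yk (pi - s) k0).
have lY := logb_Yk (pi - 2 * s) k0.
have pt r : 0 < r < 1 -> ln (r ^+ 2) ^+ k * rr (r ^+ 2) (pi - 2 * s) * (2 * r ^+ 1) =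
    2 ^+ k * (ln r ^+ k * rr r s + ln r ^+ k * rr r (pi - s)).
  move=> r01; rewrite ln_powS; last lra.
  rewrite -[LHS]mulrA -[LHS]mulrA; congr (_ * _); rewrite -mulrDr; congr (_ * _).
  have d1 := rden_ne0 s r01; have d2 := rden_ne0 (pi - s) r01.
  have cs : cos (pi - s) = - cos s by rewrite cosB cospi sinpi; ring.
  have c2 : cos (pi - 2 * s) = 1 - 2 * cos s ^+ 2 by rewrite cosB cospi sinpi cos2x; ring.
  have e : rden (r ^+ 2) (pi - 2 * s) = rden r s * rden r (pi - s).
    by rewrite /rden cs c2; ring.
  transitivity (((r + cos s) * rden r (pi - s) + (r + cos (pi - s)) * rden r s) / (rden r s * rden r (pi - s))).
    by rewrite /rr e c2 cs expr1 [LHS]mulrAC; congr (_ / _); rewrite /rden cs; ring.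
  by rewrite /rr; field; rewrite d1 d2.
have l3 : logb 0 1 (fun r => 2 ^+ k * (ln r ^+ k * rr r s + ln r ^+ k * rr r (pi - s))).
  apply: logbM; first exact: logb_cst.
  by apply: logbD; exact: logb_Yk.
rewrite {1}/Yk -(@subst_pow 1)//; last by apply: logb_ext l3 => r r01; rewrite pt.
rewrite (itg_ext pt) itgZ; last exact: integD.
by rewrite itgD.
Qed.

Lemma Bk_dup k s : (0 < k)%N -> Bk k (pi - 2 * s) = 2 ^+ k * (Bk k (pi - s) - Bk k s).
Proof.
move=> k0; have i1 := integ_logb (logb_Bk s k0); have i2 := integ_logb (logb_Bk (pi - s) k0).
have lY := logb_Bk (pi - 2 * s) k0.
have pt r : 0 < r < 1 -> ln (r ^+ 2) ^+ k * kap (r ^+ 2) (pi - 2 * s) * (2 * r ^+ 1) =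
    2 ^+ k * (ln r ^+ k * kap r (pi - s) - ln r ^+ k * kap r s).
  move=> r01; rewrite ln_powS; last lra.
  rewrite -[LHS]mulrA -[LHS]mulrA; congr (_ * _); rewrite -mulrBr; congr (_ * _).
  have d1 := rden_ne0 s r01; have d2 := rden_ne0 (pi - s) r01.
  have cs : cos (pi - s) = - cos s by rewrite cosB cospi sinpi; ring.
  have c2 : cos (pi - 2 * s) = 1 - 2 * cos s ^+ 2 by rewrite cosB cospi sinpi cos2x; ring.
  have e : rden (r ^+ 2) (pi - 2 * s) = rden r s * rden r (pi - s).
    by rewrite /rden cs c2; ring.
  transitivity (sin s * (rden r s - rden r (pi - s)) / (rden r s * rden r (pi - s))).
    by rewrite /kap e expr1 sinBpi sin2x [LHS]mulrAC; congr (_ / _); rewrite /rden cs; ring.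
  by rewrite /kap sinBpi; field; rewrite d1 d2.
have l3 : logb 0 1 (fun r => 2 ^+ k * (ln r ^+ k * kap r (pi - s) - ln r ^+ k * kap r s)).
  apply: logbM; first exact: logb_cst.
  by apply: logbD; [|apply: logbN]; exact: logb_Bk.
rewrite {1}/Bk -(@subst_pow 1)//; last by apply: logb_ext l3 => r r01; rewrite pt.
rewrite (itg_ext pt) itgZ; last by apply: integD => //; exact: integN.
by rewrite itgB.
Qed.

Lemma Y2_0 : Yk 2 0 = 3 / 2 * zeta (3 : R).
Proof.
have := @Yk_dup 2 0 isT; rewrite mulr0 subr0 Y2pi_zeta => h.
by apply: (mulfI (_ : 2 ^+ 2 != 0 :> R)); [rewrite expf_neq0// pnatr_eq0|lra].
Qed.

(** Triplication: the roots of [r^3 + 1] are [- 1] and [- e^{± 2 pi i / 3}], and the conjugate pair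
    contributes twice the same real part. *)
Lemma Y2_2pi3 : Yk 2 (2 * pi / 3) = - (2 / 3 * zeta (3 : R)).
Proof.
have i1 := integ_logb (@logb_Yk R 2 0 isT).
have i2 := integ_logb (@logb_Yk R 2 (2 * pi / 3) isT).
have lY := @logb_Yk R 2 0 isT; have lY2 := @logb_Yk R 2 (2 * pi / 3) isT.
have pt r : 0 < r < 1 -> ln (r ^+ 3) ^+ 2 * rr (r ^+ 3) 0 * (3 * r ^+ 2) =
    3 ^+ 2 * (ln r ^+ 2 * rr r 0 + 2 * (ln r ^+ 2 * rr r (2 * pi / 3))).
  move=> r01; rewrite ln_powS; last lra.
  have key : rr (r ^+ 3) 0 * (3 * r ^+ 2) = rr r 0 + 2 * rr r (2 * pi / 3).
    rewrite /rr rden_2pi3 (_ : 2 * pi / 3 = 2 * (pi / 3)); last by field.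
    rewrite cos2x cos_pi3 /rden cos0.
    have a1 : 1 + r != 0 by rewrite gt_eqF//; lra.
    have a2 : 1 - r + r ^+ 2 != 0.
      by rewrite -rden_2pi3; exact: rden_ne0.
    have e1 : 1 + 2 * r * 1 + r ^+ 2 = (1 + r) ^+ 2 by ring.
    have e2 : 1 + 2 * r ^+ 3 * 1 + (r ^+ 3) ^+ 2 = ((1 + r) * (1 - r + r ^+ 2)) ^+ 2 by ring.
    by rewrite e1 e2; field; rewrite a1 a2.
  transitivity (3 ^+ 2 * ln r ^+ 2 * (rr (r ^+ 3) 0 * (3 * r ^+ 2))); first by ring.
  by rewrite key; ring.
have l3 : logb 0 1 (fun r : R => 3 ^+ 2 * (ln r ^+ 2 * rr r 0 + 2 * (ln r ^+ 2 * rr r (2 * pi / 3)))).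
  by apply: logbM; [exact: logb_cst|apply: logbD => //; apply: logbM => //; exact: logb_cst].
have := @subst_pow 2 _ lY _; rewrite (itg_ext pt) itgZ; last by apply: integD => //; exact: integZ.
rewrite itgD//; last exact: integZ.
rewrite itgZ// -/(Yk 2 0) -/(Yk 2 (2 * pi / 3)) Y2_0 => h.
have := h (logb_ext (fun r r01 => esym (pt r r01)) l3); lra.
Qed.

(** The angle [pi / 3] is a fixed point of [s -> pi - 2 s], so duplication becomes a linear equation
    for the value. *)
Lemma Y2_pi3 : Yk 2 (pi / 3) = 8 / 9 * zeta (3 : R).
Proof.
have := @Yk_dup 2 (pi / 3) isT.
rewrite (_ : pi - 2 * (pi / 3) = pi / 3); last by field.
rewrite (_ : pi - pi / 3 = 2 * pi / 3); last by field.
by rewrite Y2_2pi3; lra.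
Qed.

Lemma B1_2pi3 : Bk 1 (2 * pi / 3) = - Cl 2 (pi / 3 : R).
Proof. by rewrite Bk_Cl// expr1 mulN1r mulNr mul1r. Qed.

Lemma B3_2pi3 : Bk 3 (2 * pi / 3) = - (6 * Cl 4 (pi / 3 : R)).
Proof. by rewrite Bk_Cl// (_ : 3`! = 6%N)//; ring. Qed.

Lemma Bk_pi3 k : (0 < k)%N -> (1 + 2 ^+ k) * Bk k (pi / 3) = 2 ^+ k * Bk k (2 * pi / 3 : R).
Proof.
move=> k0; have := @Bk_dup k (pi / 3) k0.
rewrite (_ : pi - 2 * (pi / 3) = pi / 3); last by field.
rewrite (_ : pi - pi / 3 = 2 * pi / 3); last by field.
by move=> h; rewrite mulrDl mul1r {1}h; ring.
Qed.

Lemma B1_pi3 : Bk 1 (pi / 3) = - (2 / 3 * Cl 2 (pi / 3 : R)).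
Proof. by have := @Bk_pi3 1 isT; rewrite B1_2pi3 expr1; lra. Qed.

Lemma B3_pi3 : Bk 3 (pi / 3) = - (16 / 3 * Cl 4 (pi / 3 : R)).
Proof.
have := @Bk_pi3 3 isT; rewrite B3_2pi3 (_ : 2 ^+ 3 = 8); last by ring.
lra.
Qed.

End polylog_constants.

(** * The cubic integral of [lsin] on [[0, pi / 6]] from a ray cut by a circle *)

Section chord_integrals.
Context {R : realType}.
Implicit Types (r s c t x y : R) (k : nat).

Let p0 : 0 < @pi R. Proof. exact: pi_gt0. Qed.

Lemma itg_prim c (h : R -> R) : 0 < c -> logb 0 c h ->
  itg 0 c (fun t => itg 0 t h) = itg 0 c (fun t => (c - t) * h t).
Proof.
move=> c0 lh.
have := @itg_prim_mul R c (fun t => t - c) (fun=> 1) h c0 lh ltac:(move=> x; dv_auto; ring) (logb_cst _ _ _).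
rewrite subrr mul0r (@itg_ext _ _ _ (fun t => 1 * itg 0 t h) (fun t => itg 0 t h)); last by move=> t _; rewrite mul1r.
move/eqP; rewrite addr_eq0 => /eqP ->; rewrite -itgN; last by apply: integ_logb; logb_auto.
by apply: itg_ext => t _; ring.
Qed.

(** Second half of Cauchy's formula for repeated integration; together with [itg_prim] it turns a
    triple primitive into one integral with a quadratic weight. *)
Lemma itg_prim2 c (h : R -> R) : 0 < c -> logb 0 c h ->
  itg 0 c (fun t => (c - t) * itg 0 t h) = itg 0 c (fun t => (c - t) ^+ 2 / 2 * h t).
Proof.
move=> c0 lh.
have d (x : R) : dv (fun t => - ((c - t) ^+ 2 / 2)) x (c - x) by dv_auto; rewrite /= expr1; field.
have l : logb 0 c (fun t => c - t) by logb_auto.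
have := itg_prim_mul c0 lh d l.
rewrite subrr expr0n /= mul0r oppr0 mul0r => /eqP; rewrite addr_eq0 => /eqP ->.
rewrite -itgN; last by apply: integ_logb; logb_auto.
by apply: itg_ext => t _; ring.
Qed.

(** Here the angle, not the radius, keeps [r + e^{is}] away from [0]; the radius may exceed [1]. *)
Lemma rden_half r s : pi / 4 < s < 3 * pi / 4 -> 1 / 2 <= rden r s.
Proof.
move=> sp; apply: le_trans (rden_ge_sin r s).
have c2 : cos (2 * s) < 0.
  rewrite -[2 * s](subrK pi) cosDpi oppr_lt0; apply: cos_pos; lra.
have := cos2sin2 s; rewrite cos2x in c2; lra.
Qed.

Lemma chord_bounds r s : pi / 4 < s < 3 * pi / 4 -> 0 < r < 2 ->
  [/\ `|kap r s| <= 6, `|rr r s| <= 6, `|kaps r s| <= 36 & `|rrs r s| <= 36].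
Proof.
move=> sp r02; have d := rden_half r sp; have d0 : 0 < rden r s by lra.
have i2 : (rden r s)^-1 <= 2 by rewrite -[leRHS]invrK lef_pV2 ?posrE ?invr_gt0//; lra.
have i0 : 0 <= (rden r s)^-1 by rewrite invr_ge0 ltW.
have i4 : (rden r s ^+ 2)^-1 <= 4.
  rewrite -exprVn (_ : 4 = 2 ^+ 2); last by ring.
  by apply: lerXn2r; rewrite ?nnegrE.
have i40 : 0 <= (rden r s ^+ 2)^-1 by rewrite invr_ge0 exprn_ge0// ltW.
have sm := sin_max s; have cm := cos_max s; have r0 : 0 < r by lra.
have r2 : r ^+ 2 <= 4.
  by rewrite (_ : 4 = 2 ^+ 2); [apply: lerXn2r; rewrite ?nnegrE; lra|ring].
have r20 := sqr_ge0 r.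
have key (a b M N : R) : `|a| <= M -> 0 <= b -> b <= N -> `|a * b| <= M * N.
  by move=> aM b0 bN; rewrite normrM (ger0_norm b0); apply: ler_pM.
split.
- by rewrite (_ : 6 = 3 * 2); [apply: key => //; lra|ring].
- rewrite (_ : 6 = 3 * 2); last by ring.
  by apply: key => //; apply: le_trans (ler_normD _ _) _; rewrite (gtr0_norm r0); lra.
- rewrite (_ : 36 = 9 * 4); last by ring.
  apply: key => //; apply: le_trans (ler_normD _ _) _.
  rewrite normrM (@ger0_norm _ (1 + r ^+ 2)); last lra.
  rewrite (@ger0_norm _ (2 * r)); last lra.
  have : `|cos s| * (1 + r ^+ 2) <= 1 * (1 + r ^+ 2) by apply: ler_wpM2r; lra.
  lra.
- rewrite (_ : 36 = 9 * 4); last by ring.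
  apply: key => //; rewrite normrN normrM.
  have : `|1 - r ^+ 2| <= 3 by rewrite ler_norml; lra.
  move=> h; apply: le_trans (_ : 1 * 3 <= _); last lra.
  exact: ler_pM.
Qed.

(** With [s = pi / 2 + c], both ends of the range satisfy [|r + e^{is}| = 1], and at the upper end
    [ln r] is [lsin c]. Kernel and endpoint move together with [c]. *)
Definition chord_B k c : R := itg 0 (2 * sin c) (fun r => ln r ^+ k * kap r (pi / 2 + c)).
Definition chord_Y k c : R := itg 0 (2 * sin c) (fun r => ln r ^+ k * rr r (pi / 2 + c)).

Lemma logb_ln02 : logb 0 2 (@ln R).
Proof.
apply: (@logb_ln R 0 2 (fun x => x) 2 (1 / 2)); first by lra.
  by move=> x _; exact: cvg_id.
move=> x x02; apply/andP; split; last lra.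
rewrite subr0 mulrAC; apply: le_trans (_ : 1 * x <= _); last lra.
by rewrite ler_pM2r; lra.
Qed.

Lemma logb_chord k s : pi / 4 < s < 3 * pi / 4 ->
  [/\ logb 0 2 (fun r => ln r ^+ k * kap r s), logb 0 2 (fun r => ln r ^+ k * rr r s),
      logb 0 2 (fun r => ln r ^+ k * kaps r s) & logb 0 2 (fun r => ln r ^+ k * rrs r s)].
Proof.
move=> sp; have ll := logb_ln02.
have d0 r : rden r s != 0 by have := rden_half r sp => h; rewrite gt_eqF//; lra.
split; apply: logbM; try exact: logbX; apply: (@logb_bounded _ _ _ _ 36).
- move=> r r02; have dd := dv_rden_r r s; rewrite /kap; cvg_auto; exact: d0.
- by move=> r r02; have [h _ _ _] := chord_bounds sp r02; lra.
- move=> r r02; have dd := dv_rden_r r s; rewrite /rr; cvg_auto; exact: d0.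
- by move=> r r02; have [_ h _ _] := chord_bounds sp r02; lra.
- move=> r r02; have dd := dv_rden_r r s; rewrite /kaps; cvg_auto; exact/expf_neq0/d0.
- by move=> r r02; have [_ _ h _] := chord_bounds sp r02.
- move=> r r02; have dd := dv_rden_r r s; rewrite /rrs; cvg_auto; exact/expf_neq0/d0.
- by move=> r r02; have [_ _ _ h] := chord_bounds sp r02.
Qed.

Lemma sin_chord c : 0 < c < pi / 4 -> 0 < 2 * sin c < 2.
Proof.
move=> cp; have s0 : 0 < sin c by apply: sin_pos; lra.
have k0 : 0 < cos c by apply: cos_pos; lra.
have : sin c < 1.
  by rewrite -(@expr_lt1 _ 2) ?(ltW s0)// sin2cos2; have := exprn_gt0 2 k0; lra.
lra.
Qed.

(* The endpoint [r = 2 sin c] lies on the unit circle around [- e^{is}]. *)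
Lemma rden_chord c : rden (2 * sin c) (pi / 2 + c) = 1.
Proof. by rewrite /rden cosD sin_pihalf cos_pihalf; ring. Qed.

Lemma kap_chord c : kap (2 * sin c) (pi / 2 + c) = cos c.
Proof. by rewrite /kap rden_chord divr1 sinD sin_pihalf cos_pihalf; ring. Qed.

Lemma rr_chord c : rr (2 * sin c) (pi / 2 + c) = sin c.
Proof. by rewrite /rr rden_chord divr1 cosD sin_pihalf cos_pihalf; ring. Qed.

Lemma ln_parts_chord k c (q Q' : R -> R) : 0 < c < pi / 4 ->
  (forall r, 0 < r < 2 -> dv (fun r => r * q r) r (Q' r)) ->
  logb 0 2 (fun r => ln r ^+ k.+1 * Q' r) -> logb 0 2 (fun r => ln r ^+ k * q r) ->
  itg 0 (2 * sin c) (fun r => ln r ^+ k.+1 * Q' r) =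
    lsin c ^+ k.+1 * (2 * sin c * q (2 * sin c)) -
    k.+1%:R * itg 0 (2 * sin c) (fun r => ln r ^+ k * q r).
Proof.
move=> cp dQ l1 l2; have ll := logb_ln02; have /andP[b0 b2] := sin_chord cp.
have s1 f : logb 0 2 f -> logb 0 (2 * sin c) f by apply: logb_sub => //; exact: ltW.
have l3 : logb 0 2 (fun r => k.+1%:R * (ln r ^+ k * q r)) by apply: logbM => //; exact: logb_cst.
apply/eqP; rewrite -subr_eq opprK; apply/eqP; rewrite -itgZ; last exact/integ_logb/s1.
rewrite -itgD; [|exact/integ_logb/s1..].
have dF r : 0 < r < 2 -> dv (fun r => ln r ^+ k.+1 * (r * q r)) r (ln r ^+ k.+1 * Q' r + k.+1%:R * (ln r ^+ k * q r)).
  move=> r01; have d1 := dQ r r01; have d2 : dv (fun r => ln r ^+ k.+1) r (k.+1%:R * ln r ^+ k * r^-1).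
    by dv_auto; [lra|rewrite /= mul1r].
  apply: dv_eq (dvM d2 d1) _; rewrite addrC; congr (_ + _).
  by field; rewrite gt_eqF//; lra.
rewrite (@FTC_logb _ _ _ _ (fun r => ln r ^+ k.+1 * (r * q r)) 0 (lsin c ^+ k.+1 * (2 * sin c * q (2 * sin c)))) ?subr0//.
- by apply: s1; exact: logbD.
- by move=> r r01; apply: dF; lra.
- have l4 : logb 0 2 (fun r => ln r * (ln r ^+ k * q r)) by apply: logbM.
  have := logb_mul_prim0 (ltr0n _ 2) l4 (logb_cst 0 2 1); apply: cvg_trans; apply: near_eq_cvg.
  near=> r; rewrite itg_cst; last by apply: ltW.
  by rewrite exprS; ring.
- apply: cvg_at_left_filter; apply: (@dv_cvg _ (fun r => ln r ^+ k.+1 * (r * q r))).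
  by apply: dF; rewrite b0.
Unshelve. all: end_near. Qed.

Lemma chord_window c : 0 < c < pi / 4 -> pi / 4 < pi / 2 + c < 3 * pi / 4.
Proof. by move=> cp; lra. Qed.

Lemma rden_chord_ne0 r c : 0 < c < pi / 4 -> rden r (pi / 2 + c) != 0.
Proof. by move=> /chord_window /(rden_half r) h; rewrite gt_eqF//; lra. Qed.

Lemma dv_arc (F : R -> R) c d : dv F (pi / 2 + c) d -> dv (fun t => F (pi / 2 + t)) c d.
Proof.
move=> h; have hs : dv (fun t : R => pi / 2 + t) c 1 by dv_auto; ring.
by apply: dv_eq (@dv_comp _ F _ c _ _ h hs) _; rewrite mulr1.
Qed.

(** The moving endpoint contributes [2 cos^2 c] times [lsin c ^+ k.+1] and the integration by parts
    [2 sin^2 c] times the same power; they add up to a pure power of [lsin]. *)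
Lemma dv_chord_B k c : 0 < c < pi / 4 ->
  dv (chord_B k.+1) c (2 * lsin c ^+ k.+1 - k.+1%:R * chord_Y k c).
Proof.
move=> cp; have ll := logb_ln02; have b2 := sin_chord cp.
have db : dv (fun c => 2 * sin c) c (2 * cos c) by dv_auto; ring.
have [l1 _ l3 _] := logb_chord k.+1 (chord_window cp).
have [_ l2 _ _] := logb_chord k (chord_window cp).
have lk : logb 0 2 (fun r : R => 36 * `|ln r ^+ k.+1|).
  by apply: logbM; [exact: logb_cst|apply: logb_norm; exact: logbX].
have := @leibniz R 0 2 0 (pi / 4) c (fun t r => ln r ^+ k.+1 * kap r (pi / 2 + t))
  (fun t r => ln r ^+ k.+1 * kaps r (pi / 2 + t)) (fun c => 2 * sin c) (fun r => 36 * `|ln r ^+ k.+1|)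
  (2 * cos c) cp b2 db => H.
apply: dv_eq; first apply: H.
- by move=> t tp; apply: integ_logb; have [] := logb_chord k.+1 (chord_window tp).
- move=> t r tp r02; apply: dv_eq; first apply: dvM (dv_cst _ _) (dv_arc (F := fun s => kap r s) _).
    by apply: dv_kap_s; exact: rden_chord_ne0.
  by rewrite mul0r add0r.
- move=> t r tp r02; rewrite normrM mulrC; apply: ler_wpM2r => //.
  by have [] := chord_bounds (chord_window tp) r02.
- exact: integ_logb.
- by apply: l1.1.
- rewrite kap_chord (@ln_parts_chord k c (fun r => rr r (pi / 2 + c)) (fun r => kaps r (pi / 2 + c)) cp _ l3 l2); last first.
    by move=> r r02; apply: dv_rrr_r; exact: rden_chord_ne0.
  rewrite rr_chord /chord_Y -/(lsin c) addrA; congr (_ - _).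
  rewrite (_ : _ + _ = 2 * lsin c ^+ k.+1 * (cos c ^+ 2 + sin c ^+ 2)); last by ring.
  by rewrite cos2Dsin2 mulr1.
Qed.

(** Here the two boundary contributions are [2 sin c cos c] with opposite signs and cancel. *)
Lemma dv_chord_Y k c : 0 < c < pi / 4 -> dv (chord_Y k.+1) c (k.+1%:R * chord_B k c).
Proof.
move=> cp; have ll := logb_ln02; have b2 := sin_chord cp.
have db : dv (fun c => 2 * sin c) c (2 * cos c) by dv_auto; ring.
have [_ l1 _ l3] := logb_chord k.+1 (chord_window cp).
have [l2 _ _ _] := logb_chord k (chord_window cp).
have lk : logb 0 2 (fun r : R => 36 * `|ln r ^+ k.+1|).
  by apply: logbM; [exact: logb_cst|apply: logb_norm; exact: logbX].
have := @leibniz R 0 2 0 (pi / 4) c (fun t r => ln r ^+ k.+1 * rr r (pi / 2 + t))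
  (fun t r => ln r ^+ k.+1 * rrs r (pi / 2 + t)) (fun c => 2 * sin c) (fun r => 36 * `|ln r ^+ k.+1|)
  (2 * cos c) cp b2 db => H.
apply: dv_eq; first apply: H.
- by move=> t tp; apply: integ_logb; have [] := logb_chord k.+1 (chord_window tp).
- move=> t r tp r02; apply: dv_eq; first apply: dvM (dv_cst _ _) (dv_arc (F := fun s => rr r s) _).
    by apply: dv_rr_s; exact: rden_chord_ne0.
  by rewrite mul0r add0r.
- move=> t r tp r02; rewrite normrM mulrC; apply: ler_wpM2r => //.
  by have [] := chord_bounds (chord_window tp) r02.
- exact: integ_logb.
- by apply: l1.1.
- have l4 : logb 0 2 (fun r => ln r ^+ k.+1 * - rrs r (pi / 2 + c)).
    by apply: logb_ext (logbN l3) => r _; rewrite mulrN.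
  have := @ln_parts_chord k c (fun r => kap r (pi / 2 + c)) (fun r => - rrs r (pi / 2 + c)) cp
    (fun r _ => dv_rkap_r (rden_chord_ne0 r cp)) l4 l2.
  rewrite kap_chord -/(chord_B k c) => e.
  have il3 : integ 0 (2 * sin c) (fun r => ln r ^+ k.+1 * rrs r (pi / 2 + c)).
    by apply: integ_sub (integ_logb l3) => //; lra.
  have e2 : itg 0 (2 * sin c) (fun r => ln r ^+ k.+1 * - rrs r (pi / 2 + c)) =
      - itg 0 (2 * sin c) (fun r => ln r ^+ k.+1 * rrs r (pi / 2 + c)).
    by rewrite -itgN//; apply: itg_ext => r _; rewrite mulrN.
  rewrite e2 in e; rewrite rr_chord -/(lsin c).
  by rewrite -[itg _ _ _]opprK e; ring.
Qed.

Lemma cvg0_chord k (q : R -> R -> R) :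
  (forall s r, pi / 4 < s < 3 * pi / 4 -> 0 < r < 2 -> `|q r s| <= 6) ->
  (forall s, pi / 4 < s < 3 * pi / 4 -> logb 0 2 (fun r => ln r ^+ k * q r s)) ->
  itg 0 (2 * sin c) (fun r => ln r ^+ k * q r (pi / 2 + c)) @[c --> 0^'+] --> (0 : R).
Proof.
move=> bq lq; have ll := logb_ln02.
have lk : logb 0 2 (fun r : R => `|ln r ^+ k|) by apply: logb_norm; exact: logbX.
have c0 : 6 * itg 0 (2 * sin c) (fun r => `|ln r ^+ k|) @[c --> 0^'+] --> (0 : R).
  rewrite -[X in _ --> X](mulr0 6); apply: cvgM; first exact: cvg_cst.
  apply: cvg_at_right_filter; have c2 : 2 * sin c @[c --> (0 : R)] --> (0 : R) by cvg_auto; rewrite sin0 mulr0.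
  exact: (@cvg_comp _ _ _ (fun c => 2 * sin c) (fun x => itg 0 x (fun r => `|ln r ^+ k|)) _ _ _ c2 (prim0 _ (integ_logb lk))).
apply/cvgrPdist_le => /= e e0; move/cvgrPdist_le : c0 => /(_ e e0) c0; near=> c.
have cp : 0 < c < pi / 4.
  apply/andP; split; first by near: c; exact: nbhs_right_gt.
  by near: c; apply: nbhs_right_lt; apply: divr_gt0.
have b2 := sin_chord cp.
rewrite sub0r normrN; apply: le_trans (_ : 6 * itg 0 (2 * sin c) (fun r => `|ln r ^+ k|) <= _); last first.
  apply: le_trans (ler_norm _) _; rewrite -normrN -sub0r; near: c; exact: c0.
have i1 : integ 0 (2 * sin c) (fun r => ln r ^+ k * q r (pi / 2 + c)).
  by apply: integ_sub (integ_logb (lq _ (chord_window cp))); lra.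
have i2 : integ 0 (2 * sin c) (fun r : R => `|ln r ^+ k|) by apply: integ_sub (integ_logb lk); lra.
apply: le_trans (itg_norm i1) _; rewrite -itgZ//.
apply: le_itg; [exact: integ_norm|exact: integZ|].
move=> r rc; rewrite normrM mulrC; apply: ler_wpM2r => //.
by apply: bq; [exact: chord_window|lra].
Unshelve. all: end_near. Qed.

Lemma cvg0_chord_B k : chord_B k c @[c --> 0^'+] --> (0 : R).
Proof.
apply: (@cvg0_chord k (fun r s => kap r s)).
- by move=> s r sp r02; have [] := chord_bounds sp r02.
- by move=> s sp; have [] := logb_chord k sp.
Qed.

Lemma cvg0_chord_Y k : chord_Y k c @[c --> 0^'+] --> (0 : R).
Proof.
apply: (@cvg0_chord k (fun r s => rr r s)).
- by move=> s r sp r02; have [] := chord_bounds sp r02.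
- by move=> s sp; have [] := logb_chord k sp.
Qed.

(** The primitive [ln |r + e^{is}|] is [0] at both ends of the chord. *)
Lemma chord_Y0 c : 0 < c < pi / 4 -> chord_Y 0 c = 0.
Proof.
move=> cp; have [_ l _ _] := logb_chord 0 (chord_window cp); have b2 := sin_chord cp.
have d0 r : 0 < rden r (pi / 2 + c) by have := rden_half r (chord_window cp); lra.
rewrite /chord_Y (@FTC_logb _ _ _ _ (fun r => rlog r (pi / 2 + c)) 0 0) ?subrr//.
- by lra.
- by apply: logb_sub l; lra.
- by move=> r _; apply: dv_eq (dv_rlog_r (d0 r)) _; rewrite expr0 mul1r.
- apply: cvg_at_right_filter; apply: dv_cvg_eq; first exact: dv_rlog_r.
  by rewrite /rlog /rden expr0n /= mulr0 mul0r !addr0 ln1 mul0r.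
- apply: cvg_at_left_filter; apply: dv_cvg_eq; first exact: dv_rlog_r.
  by rewrite /rlog rden_chord ln1 mul0r.
Qed.

Lemma chord_B1 c : 0 < c < pi / 4 -> chord_B 1 c = 2 * itg 0 c lsin.
Proof.
move=> cp; have ls : logb 0 c (@lsin R) by apply: lsin_logb; lra.
have l2 : logb 0 c (fun t : R => 2 * lsin t) by logb_auto.
rewrite -itgZ; last exact: integ_logb.
rewrite (@FTC_logb _ _ _ _ (chord_B 1) 0 (chord_B 1 c)) ?subr0//; first by lra.
- move=> t tp; have tp' : 0 < t < pi / 4 by lra.
  by apply: dv_eq (dv_chord_B 0 tp') _; rewrite chord_Y0// mulr0 subr0 expr1.
- exact: cvg0_chord_B.
- by apply: cvg_at_left_filter; exact: dv_cvg (dv_chord_B 0 cp).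
Qed.

Lemma chord_Y2 c : 0 < c < pi / 4 -> chord_Y 2 c = 4 * itg 0 c (fun t => (c - t) * lsin t).
Proof.
move=> cp; have ls : logb 0 c (@lsin R) by apply: lsin_logb; lra.
have lp := logb_prim (integ_logb ls).
rewrite -itg_prim//; last by lra.
rewrite -itgZ; last exact: integ_logb.
rewrite (@FTC_logb _ _ _ _ (chord_Y 2) 0 (chord_Y 2 c)) ?subr0//; first by lra.
- by logb_auto.
- move=> t tp; have tp' : 0 < t < pi / 4 by lra.
  by apply: dv_eq (dv_chord_Y 1 tp') _; rewrite chord_B1//; ring.
- exact: cvg0_chord_Y.
- by apply: cvg_at_left_filter; exact: dv_cvg (dv_chord_Y 1 cp).
Qed.

(** Climbing the ladder from [chord_Y 0 = 0]: every odd rung adds a power of [lsin], and the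
    accumulated primitives of [lsin] collapse to a quadratic moment. *)
Lemma chord_B3 c : 0 < c < pi / 4 -> chord_B 3 c =
  2 * itg 0 c (fun t => lsin t ^+ 3) - 6 * itg 0 c (fun t => (c - t) ^+ 2 * lsin t).
Proof.
move=> cp; have ls : logb 0 c (@lsin R) by apply: lsin_logb; lra.
have lp := logb_prim (integ_logb ls); have lpp := logb_prim (integ_logb lp).
have l3 : logb 0 c (fun t : R => 2 * lsin t ^+ 3) by logb_auto.
have l12 : logb 0 c (fun t : R => 12 * itg 0 t (fun u => itg 0 u lsin)) by logb_auto.
have -> : 6 * itg 0 c (fun t => (c - t) ^+ 2 * lsin t) = 12 * itg 0 c (fun t => itg 0 t (fun u => itg 0 u lsin)).
  rewrite itg_prim//; last by lra.
  rewrite itg_prim2//; last by lra.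
  rewrite -!itgZ; [|by apply: integ_logb; logb_auto..].
  by apply: itg_ext => t _; field.
rewrite -!itgZ; [|exact: integ_logb|by apply: integ_logb; logb_auto].
rewrite -itgB; [|exact: integ_logb..].
rewrite (@FTC_logb _ _ _ _ (chord_B 3) 0 (chord_B 3 c)) ?subr0//; first by lra.
- by logb_auto.
- move=> t tp; have tp' : 0 < t < pi / 4 by lra.
  apply: dv_eq (dv_chord_B 2 tp') _; rewrite chord_Y2// -itg_prim; [|lra|by apply: lsin_logb; lra].
  by ring.
- exact: cvg0_chord_B.
- by apply: cvg_at_left_filter; exact: dv_cvg (dv_chord_B 2 cp).
Qed.

(** At [c = pi / 6] the chord ends at [r = 1] and the angle is [2 pi / 3], so [chord_B 3] is the
    complete integral [Bk 3]. *)
Lemma lsin3_pi6 : 2 * itg 0 (pi / 6) (fun t : R => lsin t ^+ 3) =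
  Bk 3 (2 * pi / 3) + 6 * itg 0 (pi / 6) (fun t => (pi / 6 - t) ^+ 2 * lsin t).
Proof.
have cp : 0 < (pi / 6 : R) < pi / 4 by have := @pi_gt0 R; lra.
have := chord_B3 cp; rewrite /chord_B sin_pi6 (_ : 2 * (1 / 2) = 1); last by field.
rewrite (_ : pi / 2 + pi / 6 = 2 * pi / 3); last by field.
by rewrite -/(Bk 3 (2 * pi / 3)) => ->; ring.
Qed.

End chord_integrals.

(** * From log-sine integrals on [[0, s / 2]] to radial integrals *)

Section polar_substitution.
Context {R : realType}.
Implicit Types (r s t x y : R) (k : nat).

(** A zero of [h] at [0], up to logarithms, is squared; one of the two factors [r] pays for the
    division. *)
Lemma logb_sqr_div (h g : R -> R) : contin 0 1 h ->
  (forall r, 0 < r < 1 -> `|h r| <= g r * r) -> logb 0 1 g -> logb 0 1 (fun r => h r ^+ 2 / r).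
Proof.
move=> ch hg lg; apply: (@logb_le _ _ _ _ (fun r => g r ^+ 2)); last exact: logbX.
  move=> r r01; have c1 : y ^-1 @[y --> r] --> r^-1 by cvg_auto; rewrite gt_eqF//; lra.
  by have c2 := ch r r01; exact: cvgM (cvgM c2 c2) c1.
move=> r r01; have r0 : 0 < r by lra.
rewrite normrM normfV (gtr0_norm r0) ler_pdivrMr// normrX.
have h0 := normr_ge0 (h r); have h1 := hg r r01.
have g0 : 0 <= g r * r := le_trans h0 h1.
apply: le_trans (_ : (g r * r) ^+ 2 <= _); first by rewrite lerXn2r ?nnegrE.
by rewrite exprMn ler_wpM2l ?sqr_ge0// expr2 ler_piMr//; lra.
Qed.

Lemma polar_sin s t : 0 < s < pi -> 0 < t < s / 2 ->
  [/\ 0 < sin t, 0 < sin (s - t), 0 < sin s & sin t < sin (s - t)].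
Proof.
move=> sp ts; split; [by apply: sin_pos; lra..|].
have e1 : sin (s - t) = sin (s / 2) * cos (s / 2 - t) + cos (s / 2) * sin (s / 2 - t).
  by rewrite -sinD; congr sin; field.
have e2 : sin t = sin (s / 2) * cos (s / 2 - t) - cos (s / 2) * sin (s / 2 - t).
  by rewrite -sinB; congr sin; ring.
have c0 : 0 < cos (s / 2) by apply: cos_pos; lra.
have s0 : 0 < sin (s / 2 - t) by apply: sin_pos; lra.
have h : 0 < cos (s / 2) * sin (s / 2 - t) by rewrite mulr_gt0.
by rewrite e1 e2; lra.
Qed.

Lemma cosBK s t : cos s = cos (s - t) * cos t - sin (s - t) * sin t.
Proof. by rewrite -cosD subrK. Qed.

Lemma sinBK s t : sin s = sin (s - t) * cos t + cos (s - t) * sin t.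
Proof. by rewrite -sinD subrK. Qed.

(** The law of sines in the triangle with sides [r], [1] and [|r + e^{is}|]. *)
Lemma rden_polar s t : sin (s - t) != 0 ->
  rden (sin t / sin (s - t)) s = sin s ^+ 2 / sin (s - t) ^+ 2.
Proof.
move=> n0; rewrite /rden (sinBK s t) (cosBK s t); move: (s - t) n0 => u n0.
have h1 := cos2sin2 t; have h2 := cos2sin2 u.
apply: (mulIf (expf_neq0 2 n0)); rewrite divfK ?expf_neq0//.
transitivity (sin u ^+ 2 + 2 * sin t * sin u * (cos u * cos t) - 2 * sin t ^+ 2 * sin u ^+ 2 + sin t ^+ 2).
  by field; rewrite n0.
transitivity (sin u ^+ 2 * cos t ^+ 2 + 2 * sin t * sin u * (cos u * cos t) + cos u ^+ 2 * sin t ^+ 2).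
  by rewrite h1 h2; ring.
by ring.
Qed.

Lemma ln_polar s t : 0 < s < pi -> 0 < t < s / 2 ->
  ln (sin t / sin (s - t)) = lsin t - lsin (s - t).
Proof.
move=> sp ts; have [a b c d] := polar_sin sp ts.
rewrite /lsin !lnM ?posrE ?invr_gt0// lnV ?posrE//; ring.
Qed.

Lemma rlog_polar s t : 0 < s < pi -> 0 < t < s / 2 ->
  rlog (sin t / sin (s - t)) s = lsin s - lsin (s - t).
Proof.
move=> sp ts; have [a b c d] := polar_sin sp ts.
rewrite /rlog rden_polar ?gt_eqF// /lsin !lnM ?posrE ?invr_gt0 ?exprn_gt0//.
by rewrite lnV ?posrE ?exprn_gt0// !lnXn//; field.
Qed.

(** The variable is [t = s - arg (r + e^{is})], and the derivative of the argument in [r] is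
    [- kap r s]: hence [dt = kap r s dr], and [t = s / 2] corresponds to [r = 1]. *)
Lemma itg_polar s (g h : R -> R) : 0 < s < pi -> logb 0 1 (fun r => h r * kap r s) ->
  logb 0 (s / 2) g -> (forall t, 0 < t < s / 2 -> g t = h (sin t / sin (s - t))) ->
  itg 0 (s / 2) g = itg 0 1 (fun r => h r * kap r s).
Proof.
move=> sp lh lg gh.
have e t : 0 < t < s / 2 -> g t = h (sin t / sin (s - t)) * kap (sin t / sin (s - t)) s * (sin s / sin (s - t) ^+ 2).
  move=> ts; have [a b c d] := polar_sin sp ts.
  rewrite gh// /kap rden_polar ?gt_eqF//; field.
  by rewrite !gt_eqF.
rewrite (itg_ext e); have s20 : sin (s / 2) != 0 by rewrite gt_eqF// sin_pos//; lra.
apply: (@subst_inc _ _ _ _ _ (fun t => sin t / sin (s - t)) (fun t => sin s / sin (s - t) ^+ 2) (fun r => h r * kap r s)) => //.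
- by lra.
- move=> t ts; have [a b c d] := polar_sin sp ts.
  dv_auto; first by rewrite gt_eqF.
  by rewrite (sinBK s t); move: (s - t) b => u b; field; rewrite gt_eqF.
- move=> t ts; have [a b c d] := polar_sin sp ts.
  by rewrite divr_gt0//= ltr_pdivrMr ?mul1r.
- apply: cvg_at_right_filter; cvg_auto; last by rewrite sin0 mul0r.
  by rewrite subr0 gt_eqF// sin_pos.
- have h2 : s - s / 2 = s / 2 by field.
  by apply: cvg_at_left_filter; cvg_auto; rewrite h2// divff.
- exact: logb_ext e lg.
Qed.

Lemma lsin_refl_cts s x : 0 < s < pi -> 0 <= x <= s / 2 -> lsin (s - y) @[y --> x] --> lsin (s - x).
Proof. by move=> sp xs; cvg_auto; lra. Qed.

Lemma logb_lsin_refl s : 0 < s < pi -> logb 0 (s / 2) (fun t => lsin (s - t)).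
Proof. by move=> sp; apply: logb_seg => x xs; apply: lsin_refl_cts. Qed.

Lemma logb_cot_refl s : 0 < s < pi -> logb 0 (s / 2) (fun t => cos (s - t) / sin (s - t)).
Proof. by move=> sp; apply: logb_seg => x xs; cvg_auto; rewrite gt_eqF// sin_pos//; lra. Qed.

(** The first-order zero of [ln |r + e^{is}|] at [r = 0], with the pole cost made explicit; both
    halves come from [ln (1 + x) <= x], applied to [rden] and to its inverse. *)
Lemma rlog_bound r s : 0 < r < 1 -> `|rlog r s| <= 6 / rden r s * r.
Proof.
move=> r01; have d0 := rden_gt0 s r01; have d4 := rden_le s r01.
have c1 := cos_le1 s; have c2 := cos_geN1 s.
have i1 : 1 <= 4 / rden r s by rewrite ler_pdivlMr// mul1r.
have rc : r * cos s <= r * 1 by rewrite ler_pM2l//; lra.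
have rc' : r * -1 <= r * cos s by rewrite ler_pM2l//; lra.
have r2 : 0 <= r ^+ 2 <= r by rewrite sqr_ge0 expr2 ler_piMr//; lra.
have ub : ln (rden r s) <= 3 * r.
  have : ln (1 + (rden r s - 1)) <= rden r s - 1 by apply: le_ln1Dx; lra.
  by rewrite addrC subrK; rewrite {2}/rden; lra.
have lb : - ln (rden r s) <= 2 * r / rden r s.
  rewrite -lnV ?posrE//.
  have : ln (1 + ((rden r s)^-1 - 1)) <= (rden r s)^-1 - 1 by apply: le_ln1Dx; rewrite ltrBrDl subrr invr_gt0.
  rewrite addrC subrK => h; apply: le_trans h _.
  rewrite -[X in _ - X](divff (lt0r_neq0 d0)) -{1}(mul1r (rden r s)^-1) -mulrBl ler_pM2r ?invr_gt0//.
  by rewrite /rden; lra.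
have h3 : 3 * r <= 12 / rden r s * r.
  by rewrite ler_pM2r//; lra.
have h4 : 2 * r / rden r s <= 12 / rden r s * r.
  rewrite (_ : 2 * r / rden r s = 2 / rden r s * r); last by ring.
  by rewrite ler_pM2r//; lra.
have e12 : 12 / rden r s * r = 2 * (6 / rden r s * r) by ring.
rewrite e12 in h3 h4; move: (6 / rden r s * r) (2 * r / rden r s) h3 h4 lb => u v h3 h4 lb.
by rewrite /rlog ler_norml; lra.
Qed.

Lemma contin_rlog s : contin 0 1 (fun r => rlog r s).
Proof. by move=> r r01; apply: dv_cvg (dv_rlog_r (rden_gt0 s r01)). Qed.

Lemma rlog_local m : 0 < m < pi -> exists2 M : R, 0 <= M & forall r s, 0 < r < 1 -> - m < s < m ->
  `|rlog r s| <= M * r.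
Proof.
move=> mp; have [e e0 he] := rden_local mp; exists (6 / e); first by rewrite divr_ge0// ltW.
move=> r s r01 sm; apply: le_trans (rlog_bound s r01) _.
rewrite ler_pM2r; last lra.
by rewrite ler_pM2l// lef_pV2 ?posrE ?(rden_gt0 s r01)//; exact: he.
Qed.

Lemma logb_rlog s : - pi < s < pi -> logb 0 1 (fun r => rlog r s).
Proof.
move=> sp; have [m mp sm] := local_window sp; have [M M0 hM] := rlog_local mp.
apply: (@logb_bounded _ _ _ _ M); first exact: contin_rlog.
move=> r r01; apply: le_trans (hM r s r01 sm) _.
by rewrite ler_piMr//; lra.
Qed.

Lemma logb_rlog_sqr_int s : - pi < s < pi -> logb 0 1 (fun r => rlog r s ^+ 2 / r).
Proof.
move=> sp; have [m mp sm] := local_window sp; have [M M0 hM] := rlog_local mp.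
apply: (@logb_sqr_div _ (fun=> M)); [exact: contin_rlog| |exact: logb_cst].
by move=> r r01; exact: hM.
Qed.

(** It arises as the only part of the derivative of [polar_cubic] outside the polylogarithm ladder;
    its own derivative is [- 2] times [rlog_kap_int], which is elementary in primitives of
    [lsin]. *)
Definition rlog_sqr_int s : R := itg 0 1 (fun r => rlog r s ^+ 2 / r).
Definition rlog_kap_int s : R := itg 0 1 (fun r => rlog r s * kap r s).

Lemma dv_rlog_sqr_int s : - pi < s < pi -> dv rlog_sqr_int s (- (2 * rlog_kap_int s)).
Proof.
move=> sp; have [m mp sm] := local_window sp; have [M M0 hM] := rlog_local mp.
have [N N0 hN] := kaps_local mp.
have lw x : - m < x < m -> - pi < x < pi by move: mp; lra.
have -> : - (2 * rlog_kap_int s) = itg 0 1 (fun r => - (2 * (rlog r s * kap r s))).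
  have l1 := logb_rlog sp; have [l2 _ _ _] := @logb_local _ 0 s sp.
  have l3 : logb 0 1 (fun r => kap r s) by apply: logb_ext l2 => r _; rewrite expr0 mul1r.
  rewrite itgN; last by apply: integ_logb; logb_auto.
  by rewrite itgZ//; apply: integ_logb; logb_auto.
apply: (@dv_under _ _ _ (- m) m _ (fun s r => rlog r s ^+ 2 / r) (fun s r => - (2 * (rlog r s * kap r s))) (fun=> 2 * (M * N))) => //.
- by move=> t tm; apply/integ_logb/logb_rlog_sqr_int/lw.
- move=> t r tm r01; have dd := dv_rlog_s (rden_gt0 t r01); dv_auto.
  by rewrite /= expr1; field; rewrite gt_eqF//; lra.
- move=> t r tm r01; have [_ _ b2 _] := hN r t r01 tm; have b1 := hM r t r01 tm.
  rewrite normrN normrM (ger0_norm (_ : 0 <= 2))// normrM ler_pM2l//.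
  apply: ler_pM => //; apply: le_trans b1 _; by rewrite ler_piMr//; lra.
- exact: integ_cst.
Qed.

Lemma rlog_kap_intE s : 0 < s < pi -> rlog_kap_int s = s / 2 * lsin s - itg 0 s lsin + itg 0 (s / 2) lsin.
Proof.
move=> sp; have sp' : - pi < s < pi by move: sp; lra.
have l1 := logb_rlog sp'; have [l2 _ _ _] := @logb_local _ 0 s sp'.
have l3 : logb 0 1 (fun r => kap r s) by apply: logb_ext l2 => r _; rewrite expr0 mul1r.
have l4 := logb_lsin_refl sp.
rewrite /rlog_kap_int -(@itg_polar s (fun t => lsin s - lsin (s - t)) (fun r => rlog r s))//.
- rewrite itgB; [|exact: integ_cst|exact: integ_logb].
  rewrite itg_cst; last lra.
  have ls : logb 0 s (@lsin R) by apply: lsin_logb; lra.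
  have ls2 : logb (s / 2) s (@lsin R) by apply: lsin_logb; lra.
  have e := @itg_refl _ (s / 2) s s _ ls2.
  rewrite (_ : s - s = 0) in e; last by ring.
  rewrite (_ : s - s / 2 = s / 2) in e; last by field.
  by rewrite e (@itg_split _ 0 s (s / 2) lsin) ?(integ_logb ls)//; [ring|lra].
- exact: logbM.
- by logb_auto.
- by move=> t ts; rewrite rlog_polar.
Qed.

(** The square vanishes at [t = s / 2], so that differentiation in [s] produces no endpoint term.
    Added to the cube of the difference, this combination isolates [lsin t * lsin (s - t) ^+ 2]. *)
Definition polar_cubic s : R := itg 0 (s / 2) (fun t => (lsin t - lsin (s - t)) ^+ 2 * lsin (s - t)).

(** Integration by parts: [rr] is the [r]-derivative of [rlog], and [ln r * rlog r s ^+ 2] vanishes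
    at both ends. *)
Lemma ln_rlog_rr s : - pi < s < pi ->
  2 * itg 0 1 (fun r => ln r * rlog r s * rr r s) = - rlog_sqr_int s.
Proof.
move=> sp; have l1 := logb_rlog sp; have [_ l2 _ _] := @logb_local _ 0 s sp.
have l3 : logb 0 1 (fun r => rr r s) by apply: logb_ext l2 => r _; rewrite expr0 mul1r.
have ll := @logb_ln01 R; have lS := logb_rlog_sqr_int sp.
apply/eqP; rewrite -addr_eq0 -itgZ; last by apply: integ_logb; logb_auto.
rewrite -itgD; [|by apply: integ_logb; logb_auto|exact: integ_logb].
apply/eqP; rewrite (@FTC_logb _ _ _ _ (fun r => ln r * rlog r s ^+ 2) 0 0) ?subrr//.
- by logb_auto.
- move=> r r01; have dd := dv_rlog_r (rden_gt0 s r01); dv_auto; first lra.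
  by rewrite /= expr1; field; rewrite gt_eqF//; lra.
- have l4 : logb 0 1 (fun r => ln r * (rlog r s ^+ 2 / r)) by logb_auto.
  have := logb_mul_prim0 ltr01 l4 (logb_cst 0 1 1); apply: cvg_trans; apply: near_eq_cvg.
  near=> r; have r0 : 0 < r by near: r; exact: nbhs_right_gt.
  rewrite itg_cst; last by apply: ltW.
  by field; rewrite gt_eqF.
- have d1 : 0 < rden 1 s.
    rewrite rden1; have sn : `|s| < pi by rewrite ltr_norml.
    have : -1 < cos s by rewrite -cospi -(cos_norm s) ltr_cos ?in_itv/= ?normr_ge0 ?lexx//=; lra.
    by lra.
  have dd := dv_rlog_r d1; apply: cvg_at_left_filter; cvg_auto; last by rewrite ln1 mul0r.
  exact: ltr01.
Unshelve. all: end_near. Qed.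

(** Under the substitution [cot (s - t)] becomes [(r + cos s) / sin s], the factor that converts
    [kap] into [rr]. *)
Lemma polar_kernel s : 0 < s < pi ->
  itg 0 (s / 2) (fun t => ((lsin t - lsin (s - t)) ^+ 2 - 2 * (lsin t - lsin (s - t)) * lsin (s - t)) *
    (cos (s - t) / sin (s - t))) = Yk 2 s - 2 * lsin s * Yk 1 s - rlog_sqr_int s.
Proof.
move=> sp; have sp' : - pi < s < pi by move: sp; lra.
have l1 := logb_rlog sp'; have ll := @logb_ln01 R.
have l5 := logb_lsin_refl sp; have l6 := logb_cot_refl sp.
have l7 : logb 0 (s / 2) (@lsin R) by apply: lsin_logb; lra.
have lY1 := @logb_Yk _ 1 s isT; have lY2 := @logb_Yk _ 2 s isT.
have [_ l2 _ _] := @logb_local _ 0 s sp'.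
have l3 : logb 0 1 (fun r => rr r s) by apply: logb_ext l2 => r _; rewrite expr0 mul1r.
have s0 : 0 < sin s by apply: sin_pos.
pose h r := (ln r ^+ 2 - 2 * ln r * (lsin s - rlog r s)) * ((r + cos s) / sin s).
have eh r : 0 < r < 1 -> h r * kap r s = ln r ^+ 2 * rr r s - 2 * lsin s * (ln r ^+ 1 * rr r s) +
    2 * (ln r * rlog r s * rr r s).
  by move=> r01; rewrite /h /kap /rr; field; rewrite rden_ne0// gt_eqF.
rewrite (@itg_polar s _ h)//.
- rewrite (itg_ext eh) itgD; last first.
  + by apply: integ_logb; logb_auto.
  + by apply: integ_logb; logb_auto.
  rewrite itgB; [|exact: integ_logb|by apply: integ_logb; logb_auto].
  rewrite itgZ; last exact: integ_logb.
  rewrite [itg _ _ (fun r => 2 * _)]itgZ; last by apply: integ_logb; logb_auto.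
  by rewrite ln_rlog_rr.
- by apply: (@logb_ext _ _ _ (fun r => ln r ^+ 2 * rr r s - 2 * lsin s * (ln r ^+ 1 * rr r s) +
    2 * (ln r * rlog r s * rr r s))); [move=> r r01; rewrite eh|logb_auto].
- by logb_auto.
- move=> t ts; have [a b c d] := polar_sin sp ts.
  rewrite /h ln_polar// rlog_polar//; congr (_ * _); first by ring.
  have h1 : 0 < sin (s - t) * cos t + cos (s - t) * sin t by rewrite -sinBK.
  rewrite (sinBK s t) (cosBK s t).
  have h2 := cos2sin2 t; move: (s - t) b h1 => u b h1.
  apply: (mulIf (lt0r_neq0 h1)); rewrite divfK ?gt_eqF//.
  transitivity (cos u * cos t + cos u ^+ 2 * sin t / sin u); first by field; rewrite gt_eqF.
  by rewrite cos2sin2; field; rewrite gt_eqF.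
Qed.

Lemma dv_polar_cubic s : 0 < s < pi -> dv polar_cubic s (Yk 2 s - 2 * lsin s * Yk 1 s - rlog_sqr_int s).
Proof.
move=> sp; rewrite -polar_kernel//.
pose F t w := (lsin w - lsin (t - w)) ^+ 2 * lsin (t - w).
pose F' t w := ((lsin w - lsin (t - w)) ^+ 2 - 2 * (lsin w - lsin (t - w)) * lsin (t - w)) *
    (cos (t - w) / sin (t - w)).
have F0 : F s (s / 2) = 0.
  by rewrite /F (_ : s - s / 2 = s / 2) ?subrr ?expr0n ?mul0r//=; field.
(* For [t] and [w] in the chosen windows, [t - w] keeps distance at least [s / 8] from [0] and
   [(pi - s) / 2] from [pi]. After the complement [pi / 2 - (t - w)], the bounds for [lcos] and its
   derivative control both [lsin] and the cotangent. *)
pose m := pi / 2 - Num.min (s / 8) ((pi - s) / 2).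
have mm : [/\ pi / 2 - s / 8 <= m, pi / 2 - (pi - s) / 2 <= m & 0 < m < pi / 2].
  by rewrite /m; case: (leP (s / 8) ((pi - s) / 2)) => h; split; move: h; lra.
have [m1 m2 mp] := mm.
have ck' x : - (pi / 2) < x < pi / 2 -> - tan y @[y --> x] --> - tan x.
  by move=> xp; cvg_auto; exact: xp.
have [M [M0 M1 M2]] := kernel_bounds (@dv_lcos0 R) ck' mp.
have rng t w : 3 * s / 4 < t < (s + pi) / 2 -> 0 < w < 5 * s / 8 -> - m <= pi / 2 - (t - w) <= m by lra.
have rng2 t w : 3 * s / 4 < t < (s + pi) / 2 -> 0 < w < 5 * s / 8 -> 0 < t - w < pi by lra.
have lb t w : 3 * s / 4 < t < (s + pi) / 2 -> 0 < w < 5 * s / 8 -> `|lsin (t - w)| <= M.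
  by move=> tp wp; rewrite -lcosB_pihalf; apply/M1/rng.
have cb t w : 3 * s / 4 < t < (s + pi) / 2 -> 0 < w < 5 * s / 8 -> `|cos (t - w) / sin (t - w)| <= M.
  move=> tp wp; have := M2 _ (rng t w tp wp); rewrite normrN /tan.
  by move: (t - w) => y; rewrite sinB cosB sin_pihalf cos_pihalf !mul1r !mul0r subr0 add0r.
have ls : logb 0 (5 * s / 8) (@lsin R) by apply: lsin_logb; lra.
have ln' : logb 0 (5 * s / 8) (fun w => `|lsin w|) by exact: logb_norm.
apply: dv_eq; first apply: (@leibniz _ 0 (5 * s / 8) (3 * s / 4) ((s + pi) / 2) s F F' (fun t => t / 2)
   (fun w => ((`|lsin w| + M) ^+ 2 + 2 * (`|lsin w| + M) * M) * M) (1 / 2)).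
- by lra.
- by lra.
- by dv_auto; field.
- move=> t tp; apply: integ_logb; rewrite /F.
  have l2 : logb 0 (5 * s / 8) (fun w => lsin (t - w)).
    by apply: logb_seg => x xs; cvg_auto; lra.
  by logb_auto.
- move=> t w tp wp; rewrite /F /F'; have h := rng2 t w tp wp; dv_auto => //.
  by rewrite /= expr1; ring.
- move=> t w tp wp; rewrite /F'; have h1 := lb t w tp wp; have h2 := cb t w tp wp.
  rewrite normrM; apply: ler_pM => //; apply: le_trans (ler_normB _ _) _.
  have h3 : `|lsin w - lsin (t - w)| <= `|lsin w| + M.
    by apply: le_trans (ler_normB _ _) _; rewrite lerD2l.
  apply: lerD; first by rewrite normrX lerXn2r// nnegrE addr_ge0.
  rewrite !normrM (ger0_norm (_ : 0 <= 2))// ler_pM ?mulr_ge0// ler_pM2l//.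
- by apply: integ_logb; logb_auto.
- by rewrite /F; cvg_auto; lra.
- by rewrite F0 mul0r add0r.
Qed.

(** In radial form the value is [lsin s * Bk 2 s - W s]: the first term vanishes because [Bk 2 s] is
    of order [s], the second by dominated convergence since [kap r 0 = 0]. *)
Lemma cvg0_polar_cubic : polar_cubic s @[s --> 0^'+] --> (0 : R).
Proof.
pose W s := itg 0 1 (fun r => ln r ^+ 2 * rlog r s * kap r s).
have lwr : logb 0 1 (fun r : R => 6 * lw r ^+ 2) by exact: logb_lwX.
have rl r s : 0 < r < 1 -> - (1 / 2) < s < 1 / 2 -> 1 <= rden r s.
  move=> r01 s1; have c0 : 0 < cos s by apply: cos_pos; have := @pi_ge2 R; lra.
  have : 0 < r * cos s by rewrite mulr_gt0//; lra.
  by have := sqr_ge0 r; rewrite /rden; lra.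
have bW s r : - (1 / 2) < s < 1 / 2 -> 0 < r < 1 -> `|ln r ^+ 2 * rlog r s * kap r s| <= 6 * lw r ^+ 2.
  move=> s1 r01; rewrite -mulrA; apply: (@ln_kernel_bound _ _ 1) => //.
  rewrite expr1 normrM; apply: ler_pM => //; last exact: kap_bound.
  apply: le_trans (rlog_bound s r01) _; have h := rl r s r01 s1.
  rewrite -mulrA -[leRHS]mulr1 ler_pM2l// mulrC ler_pdivrMr; last exact: rden_gt0.
  by rewrite mul1r; lra.
have cW s r : 0 < r < 1 -> ln r ^+ 2 * rlog r t * kap r t @[t --> s] --> ln r ^+ 2 * rlog r s * kap r s.
  by move=> r01; have d1 := dv_rlog_s (rden_gt0 s r01); have d2 := dv_kap_s (rden_ne0 s r01); cvg_auto.
have iW s : - (1 / 2) < s < 1 / 2 -> integ 0 1 (fun r => ln r ^+ 2 * rlog r s * kap r s).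
  move=> s1; apply: integ_logb; apply: logb_le lwr => [r r01|r r01]; last exact: bW.
  have c1 : ln y ^+ 2 @[y --> r] --> ln r ^+ 2 by cvg_auto; lra.
  exact: cvgM (cvgM c1 (contin_rlog r01)) (@contin_kap _ s r r01).
have W0 : W s @[s --> (0 : R)] --> (0 : R).
  have W00 : W 0 = 0.
    rewrite /W (@itg_ext _ _ _ _ (fun=> 0)) ?itg_cst ?mul0r//.
    by move=> r _; rewrite /kap sin0 mul0r mulr0.
  rewrite -[X in _ --> X]W00.
  by apply: (@cvg_under _ 0 1 (- (1 / 2)) (1 / 2) 0 (fun s r => ln r ^+ 2 * rlog r s * kap r s)
     (fun r => 6 * lw r ^+ 2)); [lra|exact: iW|move=> t r _ r01; exact: cW|exact: bW|exact: integ_logb].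
have ls1 : logb 0 1 (@lsin R) by apply: lsin_logb => //; have := @pi_ge2 R; lra.
have l1 : logb 0 1 (fun s : R => lsin s * (pi ^+ 2 / 6 - s ^+ 2 / 6)) by logb_auto.
have := cvgB (logb_mul_prim0 ltr01 l1 (logb_cst 0 1 1)) (cvg_at_right_filter W0).
rewrite subr0 => /(_ ltac:(typeclasses eauto)); apply: cvg_trans; apply: near_eq_cvg; near=> s.
have s0 : 0 < s by near: s; exact: nbhs_right_gt.
have s1 : s < 1 / 2 by near: s; apply: nbhs_right_lt; lra.
have sp : 0 < s < pi by have := @pi_ge2 R; lra.
have sh : - (1 / 2) < s < 1 / 2 by lra.
transitivity (lsin s * (pi ^+ 2 / 6 - s ^+ 2 / 6) * itg 0 s (fun=> 1) - W s); first by [].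
rewrite itg_cst; last by apply: ltW.
have -> : lsin s * (pi ^+ 2 / 6 - s ^+ 2 / 6) * (1 * (s - 0)) = lsin s * Bk 2 s.
  by rewrite B2E; [field|lra].
have lB := @logb_Bk _ 2 s isT.
have lr := logb_rlog (_ : - pi < s < pi).
have l5 := logb_lsin_refl sp.
have l7 : logb 0 (s / 2) (@lsin R) by apply: lsin_logb; lra.
rewrite /polar_cubic (@itg_polar s _ (fun r => ln r ^+ 2 * (lsin s - rlog r s)))//.
- rewrite (@itg_ext _ _ _ _ (fun r => lsin s * (ln r ^+ 2 * kap r s) - ln r ^+ 2 * rlog r s * kap r s)); last by move=> r _; ring.
  by rewrite itgB ?itgZ//; [exact: integ_logb|apply: integ_logb; logb_auto|exact: iW].
- apply: (@logb_ext _ _ _ (fun r => lsin s * (ln r ^+ 2 * kap r s) + rlog r s * (- (ln r ^+ 2 * kap r s)))); first by move=> r _; ring.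
  by have lr' := lr ltac:(lra); logb_auto.
- by logb_auto.
- by move=> t ts; rewrite ln_polar// rlog_polar//; congr (_ * _); ring.
Unshelve. all: end_near. Qed.

(** The derivative is integrated from [0]. The double primitives hidden in [rlog_sqr_int] become
    quadratic moments of [lsin] on [[0, b]] and, through the half-angle primitive, on
    [[0, b / 2]]. *)
Lemma polar_cubicE b : 0 < b < pi -> polar_cubic b =
  itg 0 b (fun t => ((pi ^+ 2 / 6 - b ^+ 2) + 3 * b * t + - (5 / 2) * t ^+ 2) * lsin t)
  - Bk 3 b / 3 - b * rlog_sqr_int 0 + 2 * itg 0 (b / 2) (fun t => ((b / 2) ^+ 2 * 2 + (- 2 * b) * t + 2 * t ^+ 2) * lsin t).
Proof.
move=> bp; have b0 : 0 < b by lra.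
have ls : logb 0 b (@lsin R) by apply: lsin_logb; lra.
have ls2 : logb 0 (b / 2) (@lsin R) by apply: lsin_logb; lra.
have lG := logb_prim (integ_logb ls); have lG2 := logb_prim (integ_logb ls2).
have lGh : logb 0 b (fun t => itg 0 (t / 2) lsin).
  apply: (@logb_ext _ _ _ (fun t => itg 0 (2^-1 * t) lsin)); first by move=> t _; rewrite mulrC.
  by apply: (@logb_scale _ 0 b 2^-1 (fun t => itg 0 t lsin)) => //; rewrite mulr0 mulrC.
have lY : logb 0 b (Yk 2) by apply: logb_seg => x _; exact: (@cvg_Yk _ 2 x isT).
have lS : logb 0 b rlog_sqr_int.
  by apply: logb_seg => x xb; apply: dv_cvg (dv_rlog_sqr_int _); lra.
have eE t : 0 < t < b -> t / 2 * lsin t - itg 0 t lsin + itg 0 (t / 2) lsin = rlog_kap_int t.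
  by move=> tb; rewrite rlog_kap_intE//; lra.
have lE : logb 0 b rlog_kap_int by apply: logb_ext eE _; logb_auto.
have eY1 t : 0 < t < b -> (t ^+ 2 / 4 - pi ^+ 2 / 12) = Yk 1 t by move=> tb; rewrite Y1E//; lra.
have lY1 : logb 0 b (Yk 1) by apply: logb_ext eY1 _; logb_auto.
have iY : itg 0 b (Yk 2) = - (Bk 3 b / 3).
  rewrite (@FTC_logb _ _ _ _ (fun t => - (Bk 3 t / 3)) (- (Bk 3 0 / 3)) (- (Bk 3 b / 3)))//.
  - by rewrite (Bk_sin0 _ (sin0 _)) mul0r oppr0 subr0.
  - by move=> x _; have d3 := @dv_Bk _ 2 x isT; dv_auto; field.
  - apply: cvg_at_right_filter; apply: cvgN; apply: cvgM; [exact: (@cvg_Bk _ 3 0 isT)|exact: cvg_cst].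
  - apply: cvg_at_left_filter; apply: cvgN; apply: cvgM; [exact: (@cvg_Bk _ 3 b isT)|exact: cvg_cst].
have eS t : 0 < t < b -> rlog_sqr_int t = rlog_sqr_int 0 - 2 * itg 0 t rlog_kap_int.
  move=> tb; have lEt : logb 0 t rlog_kap_int by apply: (logb_sub _ _ lE); lra.
  have := @FTC_logb _ 0 t (fun t => - (2 * rlog_kap_int t)) rlog_sqr_int (rlog_sqr_int 0) (rlog_sqr_int t).
  rewrite itgN ?itgZ; [|exact: integ_logb|by apply: integ_logb; logb_auto].
  move=> h; have t0 : 0 < t by case/andP: tb.
  have {}h := h t0 (logbN (logbM (logb_cst _ _ _) lEt)).
  suff : - (2 * itg 0 t rlog_kap_int) = rlog_sqr_int t - rlog_sqr_int 0.
    by move: (itg _ _ _) (rlog_sqr_int _) (rlog_sqr_int _); clear => x y z; lra.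
  apply: h; first by move=> x xt; apply: dv_rlog_sqr_int; lra.
    by apply: cvg_at_right_filter; apply: dv_cvg (dv_rlog_sqr_int _); lra.
  by apply: cvg_at_left_filter; apply: dv_cvg (dv_rlog_sqr_int _); lra.
have lEp := logb_prim (integ_logb lE).
have iS : itg 0 b rlog_sqr_int = b * rlog_sqr_int 0 - 2 * itg 0 b (fun t => (b - t) * rlog_kap_int t).
  rewrite (itg_ext eS) itgB; [|exact: integ_cst|by apply: integ_logb; logb_auto].
  rewrite itg_cst ?itgZ; [|exact: integ_logb|lra].
  by rewrite itg_prim//; ring.
have iGh : itg 0 b (fun t => (b - t) * itg 0 (t / 2) lsin) =
    itg 0 (b / 2) (fun t => ((b / 2) ^+ 2 * 2 + (- 2 * b) * t + 2 * t ^+ 2) * lsin t).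
  rewrite (@itg_ext _ _ _ _ (fun t => (fun u => 2 * ((b / 2 - u) * itg 0 u lsin)) (2^-1 * t))); last first.
    by move=> t tb /=; rewrite (mulrC _ t); field.
  rewrite (@itg_scale _ 0 b 2^-1 (fun u => 2 * ((b / 2 - u) * itg 0 u lsin)))//; last first.
    by rewrite mulr0 (mulrC _ b); logb_auto.
  have b2 : 0 < b / 2 by rewrite divr_gt0.
  rewrite mulr0 (mulrC _ b) itgZ; last by apply: integ_logb; logb_auto.
  rewrite (itg_prim2 b2 ls2).
  rewrite invrK mulrA -itgZ; last by apply: integ_logb; logb_auto.
  by apply: itg_ext => t _; field.
have iE : itg 0 b (fun t => (b - t) * rlog_kap_int t) = itg 0 b (fun t => ((b - t) * t / 2 - (b - t) ^+ 2 / 2) * lsin t) +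
    itg 0 (b / 2) (fun t => ((b / 2) ^+ 2 * 2 + (- 2 * b) * t + 2 * t ^+ 2) * lsin t).
  rewrite -iGh (@itg_ext _ _ _ _ (fun t => ((b - t) * (t / 2 * lsin t) - (b - t) * itg 0 t lsin) + (b - t) * itg 0 (t / 2) lsin)); last first.
    by move=> t tb; rewrite -eE//; ring.
  rewrite itgD; [|by apply: integ_logb; logb_auto..]; congr (_ + _).
  rewrite itgB; [|by apply: integ_logb; logb_auto..].
  rewrite itg_prim2// -itgB; [|by apply: integ_logb; logb_auto..].
  by apply: itg_ext => t _; ring.
rewrite [polar_cubic b](_ : _ = polar_cubic b - 0); last by rewrite subr0.
rewrite -(@FTC_logb _ 0 b (fun s => Yk 2 s - 2 * lsin s * Yk 1 s - rlog_sqr_int s) polar_cubic 0 (polar_cubic b))//; last first.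
- by apply: cvg_at_left_filter; apply: dv_cvg (dv_polar_cubic bp).
- exact: cvg0_polar_cubic.
- by move=> x xb; apply: dv_polar_cubic; move: xb bp; clear => xb bp; lra.
- by logb_auto.
rewrite !itgB; [|exact: integ_logb|by apply: integ_logb; logb_auto|by apply: integ_logb; logb_auto|exact: integ_logb].
rewrite iY iS iE mulrDr.
set X := itg 0 (b / 2) _.
rewrite (@itg_ext _ _ _ (fun t => 2 * lsin t * Yk 1 t) (fun t => (t ^+ 2 / 2 - pi ^+ 2 / 6) * lsin t)); last first.
  by move=> t tb; rewrite -eY1//; field.
rewrite -itgZ; last by apply: integ_logb; logb_auto.
set A1 := itg 0 b (fun t => 2 * _); set A2 := itg 0 b (fun t => (t ^+ 2 / 2 - _) * _).
have -> : itg 0 b (fun t => ((pi ^+ 2 / 6 - b ^+ 2) + 3 * b * t + - (5 / 2) * t ^+ 2) * lsin t) = A1 - A2.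
  rewrite -itgB; [|by apply: integ_logb; logb_auto..].
  by apply: itg_ext => t _; field.
by ring.
Qed.

End polar_substitution.

(** * Values at [zeta(3)] and the relation at [2 pi / 3] *)

Section zeta_constants.
Context {R : realType}.
Implicit Types (r s t x y : R) (k : nat).

Lemma contin_ln1B : contin 0 1 (fun r : R => ln (1 - r)).
Proof. by move=> r r01; cvg_auto; lra. Qed.

Lemma contin_ln1D : contin 0 1 (fun r : R => ln (1 + r)).
Proof. by move=> r r01; cvg_auto; lra. Qed.

Lemma logb_lw1B : logb 0 1 (fun r : R => lw (1 - r)).
Proof. by have := logb_refl 1 (@logb_lw R); rewrite subrr subr0. Qed.

Lemma ln1B_bound r : 0 < r < 1 -> `|ln (1 - r)| <= lw (1 - r) * r.
Proof.
move=> r01; have := @ln_bound _ (1 - r) ltac:(lra).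
by rewrite (_ : 1 - (1 - r) = r) 1?mulrC; last by ring.
Qed.

Lemma ln1D_bound r : 0 < r < 1 -> `|ln (1 + r)| <= 1 * r.
Proof.
move=> r01; rewrite mul1r ger0_norm; last by apply: ln_ge0; lra.
by apply: le_ln1Dx; lra.
Qed.

(** The reflection [r -> 1 - r] of [Yk 2 pi]. *)
Lemma itg_ln1B : itg 0 1 (fun r : R => ln (1 - r) ^+ 2 / r) = 2 * zeta (3 : R).
Proof.
have lY := @logb_Yk _ 2 (pi : R) isT; have := itg_refl 1 lY; rewrite subrr subr0.
rewrite -/(Yk 2 pi) Y2pi_zeta => /(congr1 -%R); rewrite opprK => <-.
have lr := logb_refl 1 lY; rewrite subrr subr0 in lr.
rewrite -itgN; last exact: integ_logb.
apply: itg_ext => r r01; rewrite rr_pi; last by lra.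
by rewrite (_ : 1 - (1 - r) = r); ring.
Qed.

Lemma logb_ln1B_sqr : logb 0 1 (fun r : R => ln (1 - r) ^+ 2 / r).
Proof. by apply: (logb_sqr_div contin_ln1B ln1B_bound); exact: logb_lw1B. Qed.

Lemma ln1BX2 r : 0 < r < 1 -> ln (1 - r ^+ 2) = ln (1 - r) + ln (1 + r).
Proof.
by move=> r01; rewrite -lnM ?posrE; [congr ln; ring|lra..].
Qed.

Lemma logb_lw1BD1 : logb 0 1 (fun r : R => lw (1 - r) + 1).
Proof. by have h := logb_lw1B; logb_auto. Qed.

Lemma contin_ln1BX2 : contin 0 1 (fun r : R => ln (1 - r ^+ 2)).
Proof.
move=> r r01; cvg_auto; have := sqr_ge0 r; have : r * r < 1 * 1 by apply: ltr_pM; lra.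
by rewrite expr2; lra.
Qed.

Lemma ln1BX2_bound r : 0 < r < 1 -> `|ln (1 - r ^+ 2)| <= (lw (1 - r) + 1) * r.
Proof.
move=> r01; rewrite ln1BX2//; apply: le_trans (ler_normD _ _) _.
by rewrite mulrDl lerD ?ln1B_bound ?ln1D_bound.
Qed.

Lemma logb_ln1BX2 : logb 0 1 (fun r : R => ln (1 - r ^+ 2) ^+ 2 / r).
Proof. exact: (logb_sqr_div contin_ln1BX2 ln1BX2_bound logb_lw1BD1). Qed.

Lemma logb_ln1BX2_div : logb 0 1 (fun r : R => ln (1 - r ^+ 2) / r).
Proof.
apply: logb_le logb_lw1BD1 => r r01; have r0 : 0 < r by lra.
  have c1 : y^-1 @[y --> r] --> r^-1 by cvg_auto; rewrite gt_eqF.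
  exact: cvgM (contin_ln1BX2 r01) c1.
by rewrite normrM normfV (gtr0_norm r0) ler_pdivrMr//; exact: ln1BX2_bound.
Qed.

(** Substituting [v = r^2] halves the integral of [ln (1 - v) ^+ 2 / v]. *)
Lemma itg_ln1BX2 : itg 0 1 (fun r : R => ln (1 - r ^+ 2) ^+ 2 / r) = zeta (3 : R).
Proof.
have e (r : R) : 0 < r < 1 -> 2 * (ln (1 - r ^+ 2) ^+ 2 / r) = (fun v => ln (1 - v) ^+ 2 / v) (r ^+ 2) * (2 * r ^+ 1).
  by move=> r01; field; rewrite gt_eqF//; lra.
have l2 : logb 0 1 (fun r : R => 2 * (ln (1 - r ^+ 2) ^+ 2 / r)) by have h := logb_ln1BX2; logb_auto.
suff : 2 * itg 0 1 (fun r : R => ln (1 - r ^+ 2) ^+ 2 / r) = 2 * zeta (3 : R) by lra.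
rewrite -itg_ln1B -itgZ; last exact/integ_logb/logb_ln1BX2.
rewrite (itg_ext e); apply: (@subst_pow _ 1 (fun v => ln (1 - v) ^+ 2 / v)); first exact: logb_ln1B_sqr.
exact: logb_ext e l2.
Qed.

Lemma itg_ln1BX2_div : itg 0 1 (fun r : R => ln (1 - r ^+ 2) / r) = - (pi ^+ 2 / 12).
Proof.
have lY := @logb_Yk _ 1 (pi : R) isT; have := itg_refl 1 lY; rewrite subrr subr0.
rewrite -/(Yk 1 pi) Y1E ?lexx ?pi_ge0// => hY.
have lr := logb_refl 1 lY; rewrite subrr subr0 in lr.
have e1 (r : R) : 0 < r < 1 -> ln (1 - r) ^+ 1 * rr (1 - r) pi = - (ln (1 - r) / r).
  move=> r01; rewrite rr_pi; last by lra.
  by rewrite (_ : 1 - (1 - r) = r); ring.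
have e (r : R) : 0 < r < 1 -> - (2 * (ln (1 - r ^+ 2) / r)) = (fun v => ln (1 - v) ^+ 1 * rr (1 - v) pi) (r ^+ 2) * (2 * r ^+ 1).
  move=> r01; have r2 : 0 < r ^+ 2 < 1 by rewrite exprn_gt0 ?expr_lt1//; lra.
  by rewrite e1//; field; rewrite gt_eqF//; lra.
have l2 : logb 0 1 (fun r : R => - (2 * (ln (1 - r ^+ 2) / r))) by have h := logb_ln1BX2_div; logb_auto.
have := @subst_pow _ 1 _ lr (logb_ext e l2); rewrite hY -(itg_ext e).
rewrite itgN ?itgZ; [move: (itg _ _ _) => x; lra|exact/integ_logb/logb_ln1BX2_div|].
by apply: integ_logb; have h := logb_ln1BX2_div; logb_auto.
Qed.

(* The integrals of [ln (1 - r) ^+ 2 / r] and [ln (1 + r) ^+ 2 / r] are related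
   through [ln (1 - r ^+ 2) ^+ 2 / r] and, by the involution
   [r -> (1 - r) / (1 + r)], through [ln ((1 - r) / (1 + r)) ^+ 2 / r]. *)
Lemma rlog_sqr_int0 : rlog_sqr_int 0 = zeta (3 : R) / 4.
Proof.
pose a r : R := ln (1 - r); pose b r : R := ln (1 + r).
have lwp := logb_lw1BD1.
have e1 r : 0 < r < 1 -> ln (1 - r ^+ 2) ^+ 2 / r = (a r + b r) ^+ 2 / r.
  by move=> r01; rewrite ln1BX2.
have lp := logb_ext e1 logb_ln1BX2.
have lm : logb 0 1 (fun r : R => (a r - b r) ^+ 2 / r).
  apply: (logb_sqr_div _ _ lwp); first by move=> r r01; apply: cvgB; [exact: contin_ln1B|exact: contin_ln1D].
  move=> r r01; apply: le_trans (ler_normB _ _) _.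
  by rewrite mulrDl lerD ?ln1B_bound ?ln1D_bound.
have la := logb_ln1B_sqr.
have lb : logb 0 1 (fun r : R => b r ^+ 2 / r).
  by apply: (logb_sqr_div contin_ln1D ln1D_bound); exact: logb_cst.
have ep : itg 0 1 (fun r : R => (a r + b r) ^+ 2 / r) = zeta (3 : R).
  by rewrite -(itg_ext e1) itg_ln1BX2.
have em : itg 0 1 (fun r : R => (a r - b r) ^+ 2 / r) = 7 / 2 * zeta (3 : R).
  have l1 := @logb_Yk _ 2 (0 : R) isT; have l2 := @logb_Yk _ 2 (pi : R) isT.
  have -> : 7 / 2 * zeta (3 : R) = Yk 2 0 - Yk 2 pi by rewrite Y2_0 Y2pi_zeta; field.
  rewrite /Yk -itgB; [|exact: integ_logb..].
  have lf : logb 0 1 (fun u : R => ln u ^+ 2 * rr u 0 - ln u ^+ 2 * rr u pi) by logb_auto.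
  have e r : 0 < r < 1 -> (a r - b r) ^+ 2 / r =
     (fun u => - (ln u ^+ 2 * rr u 0 - ln u ^+ 2 * rr u pi)) ((1 - r) / (1 + r)) * (- 2 / (1 + r) ^+ 2).
    move=> r01; have u1 : (1 - r) / (1 + r) < 1 by rewrite ltr_pdivrMr ?mul1r; lra.
    rewrite rr_pi// /rr /rden cos0 lnM ?posrE ?invr_gt0; [|lra..].
    rewrite lnV ?posrE -/(a r) -/(b r); last lra.
    field; rewrite !gt_eqF//; try lra.
  rewrite (itg_ext e).
  rewrite -[RHS]opprK -itgN; last exact: integ_logb.
  apply: (@subst_dec _ 0 1 0 1 (fun r => (1 - r) / (1 + r)) (fun r => - 2 / (1 + r) ^+ 2)
    (fun u => - (ln u ^+ 2 * rr u 0 - ln u ^+ 2 * rr u pi))) => //.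
  - by move=> r r01; dv_auto; [rewrite gt_eqF//; lra|field; rewrite gt_eqF//; lra].
  - by move=> r r01; rewrite divr_gt0/= ?ltr_pdivrMr ?mul1r; lra.
  - by apply: cvg_at_right_filter; cvg_auto; [rewrite gt_eqF//; lra|rewrite subr0 addr0 divr1].
  - by apply: cvg_at_left_filter; cvg_auto; [rewrite gt_eqF//; lra|rewrite subrr mul0r].
  - exact: logbN.
  - exact: logb_ext e lm.
have es : itg 0 1 (fun r : R => (a r + b r) ^+ 2 / r) + itg 0 1 (fun r : R => (a r - b r) ^+ 2 / r) =
    2 * itg 0 1 (fun r : R => a r ^+ 2 / r) + 2 * itg 0 1 (fun r : R => b r ^+ 2 / r).
  rewrite -!itgZ; [|exact: integ_logb..].
  rewrite -!itgD; [|by apply: integ_logb; logb_auto..].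
  by apply: itg_ext => r _; ring.
have -> : rlog_sqr_int 0 = itg 0 1 (fun r : R => b r ^+ 2 / r).
  apply: itg_ext => r r01; congr (_ ^+ 2 / _).
  rewrite /rlog /rden cos0 (_ : _ + _ = (1 + r) ^+ 2); last by ring.
  by rewrite lnXn ?mulr2n /b; [field|lra].
move: es ep em; rewrite itg_ln1B.
move: (itg _ _ _) (itg _ _ _) (itg _ _ _) => x y z; lra.
Qed.

Lemma polar_cubic_2pi3 : polar_cubic (2 * pi / 3) = 31 / 9 * Cl 4 (pi / 3 : R) - pi ^+ 2 / 54 * Cl 2 (pi / 3 : R)
  - 13 / 27 * pi * zeta (3 : R).
Proof.
have pp := @pi_gt0 R; rewrite polar_cubicE; last by lra.
rewrite !lsin_moment; [|lra..].
rewrite (_ : pi - 2 * (2 * pi / 3) = - (pi / 3 : R)); last by field.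
rewrite (_ : pi - 2 * (2 * pi / 3 / 2) = (pi / 3 : R)); last by field.
rewrite !BkN// !YkN rlog_sqr_int0 B3_2pi3 B1_pi3 B3_pi3 Y2_pi3 Y2pi_zeta; by field.
Qed.

Lemma itg_even_shift c (h : R -> R) : 0 < c -> logb (- c) c h -> (forall x, h (- x) = h x) ->
  itg 0 (2 * c) (fun w => h (w - c)) = 2 * itg 0 c h.
Proof.
move=> c0 lh eh; have := itg_shift (- c) lh.
rewrite opprK addNr (_ : c + c = 2 * c); last by ring.
move=> ->; rewrite (@itg_split _ _ _ 0) ?(integ_logb lh)//; last by lra.
have lh0 : logb 0 c h by apply: logb_sub lh; lra.
have := itg_refl 0 lh0; rewrite sub0r subrr => h1.
rewrite -h1 (@itg_ext _ _ _ (fun x => h (0 - x)) h); last by move=> x _; rewrite sub0r eh.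
by ring.
Qed.

(** With [x = lsin t] and [z = lsin (2 pi / 3 - t)], everything rests on [(x - z)^3 + 3 (x - z)^2 z
    = x^3 - 3 x z^2 + 2 z^3]: the cube is radial and equals [Bk 3], the second term is
    [polar_cubic], and [x z^2] is a convolution of [lcos ^+ 2]. *)
Lemma lsin_lcos2_pi6 : 6 * itg 0 (pi / 6) (fun t : R => lsin t * lcos t ^+ 2) =
  itg 0 (pi / 3) (fun t => lsin t ^+ 3) - 2 * itg 0 (pi / 6) (fun t => lcos t ^+ 3)
  - 3 * itg 0 (pi / 6) (fun t => (pi ^+ 2 / 18 + - (4 * pi / 3) * t + 8 * t ^+ 2) * lcos t)
  - Bk 3 (2 * pi / 3) - 3 * polar_cubic (2 * pi / 3).
Proof.
have pp := @pi_gt0 R; have sp : 0 < (2 * pi / 3 : R) < pi by lra.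
have s2 : 2 * pi / 3 / 2 = pi / 3 :> R by field.
have c2 : 2 * (pi / 6) = pi / 3 :> R by field.
have cp : 0 < (pi / 6 : R) < pi / 2 by lra.
have lz := logb_lsin_refl sp; rewrite s2 in lz.
have ls : logb 0 (pi / 3) (@lsin R) by apply: lsin_logb; lra.
have ls6 : logb 0 (pi / 6) (@lsin R) by apply: lsin_logb; lra.
have lc6 : logb 0 (pi / 6) (@lcos R) by apply: lcos_logb; lra.
have lc66 : logb (- (pi / 6)) (pi / 6) (@lcos R) by apply: lcos_logb; lra.
(* The reflected logarithm is centred at [pi / 6], the midpoint of [[0, pi / 3]], which is the shape
   required by [conv] with [c = pi / 6]. *)
have ez t : lsin (2 * pi / 3 - t) = lcos (t - pi / 6) :> R.
  by rewrite -lsinB_pihalf; congr lsin; field.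
have e3 : itg 0 (pi / 3) (fun t : R => (lsin t - lsin (2 * pi / 3 - t)) ^+ 3) = Bk 3 (2 * pi / 3).
  have := @itg_polar _ _ (fun t => (lsin t - lsin (2 * pi / 3 - t)) ^+ 3) (fun r => ln r ^+ 3) sp (@logb_Bk _ 3 _ isT).
  rewrite s2 => -> //; first by logb_auto.
  by move=> t ts; rewrite ln_polar// s2.
have ez3 : itg 0 (pi / 3) (fun t : R => lsin (2 * pi / 3 - t) ^+ 3) = 2 * itg 0 (pi / 6) (fun t => lcos t ^+ 3).
  rewrite -(@itg_even_shift (pi / 6) (fun t => lcos t ^+ 3)); [|lra|by logb_auto|by move=> x; rewrite lcosN].
  by rewrite c2; apply: itg_ext => t _; rewrite ez.
have exz : itg 0 (pi / 3) (fun t : R => lsin t * lsin (2 * pi / 3 - t) ^+ 2) =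
    2 * itg 0 (pi / 6) (fun t => lsin t * lcos t ^+ 2) + 2 * itg 0 (pi / 6) (fun t => lcos t ^+ 3) +
    itg 0 (pi / 6) (fun t => (pi ^+ 2 / 18 + - (4 * pi / 3) * t + 8 * t ^+ 2) * lcos t).
  have := conv_lcos_sqr cp; rewrite /conv c2.
  rewrite (@itg_ext _ _ _ _ (fun t : R => lsin t * lsin (2 * pi / 3 - t) ^+ 2)); last first.
    by move=> t _; rewrite ez mulrC.
  move=> ->; congr (_ + _); last by apply: itg_ext => t _; congr (_ * _); field.
  rewrite -!itgZ; [|by apply: integ_logb; logb_auto..].
  rewrite -itgD; [|by apply: integ_logb; logb_auto..].
  by apply: itg_ext => t tp; rewrite lsin_double; [ring|lra].
have eH : polar_cubic (2 * pi / 3) = itg 0 (pi / 3) (fun t : R => (lsin t - lsin (2 * pi / 3 - t)) ^+ 2 * lsin (2 * pi / 3 - t)).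
  by rewrite /polar_cubic s2.
have : itg 0 (pi / 3) (fun t : R => (lsin t - lsin (2 * pi / 3 - t)) ^+ 3) + 3 * polar_cubic (2 * pi / 3) =
    itg 0 (pi / 3) (fun t => lsin t ^+ 3) - 3 * itg 0 (pi / 3) (fun t : R => lsin t * lsin (2 * pi / 3 - t) ^+ 2)
    + 2 * itg 0 (pi / 3) (fun t : R => lsin (2 * pi / 3 - t) ^+ 3).
  rewrite eH -!itgZ; [|by apply: integ_logb; logb_auto..].
  rewrite -itgB; [|by apply: integ_logb; logb_auto..].
  rewrite -!itgD; [|by apply: integ_logb; logb_auto..].
  by apply: itg_ext => t _; ring.
rewrite e3 ez3 exz.
move: (itg 0 _ _) (itg 0 _ _) (itg 0 _ _) (itg 0 _ _) (Bk _ _) (polar_cubic _) => a b c d e f; lra.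
Qed.

End zeta_constants.

(** * Moments of [ln |1 + b e^{iu}|] over the circle *)

Section circle_moments.
Context {R : realType}.
Implicit Types (b r s u x : R) (j k : nat).

Let p0 := @pi_gt0 R.

(** Inside a smaller disc the distance to the zero is at least [1 - m]; negative radii are included,
    so [b = 0] becomes an interior point for differentiation. *)
Lemma disc_bounds m : 0 < m < 1 -> exists2 M : R, 0 <= M & forall r s, - m < r < m ->
  [/\ 0 < rden r s, `|rlog r s| <= M, `|rr r s| <= M & `|kaps r s| <= M].
Proof.
move=> mp; pose e := (1 - m) ^+ 2; have e0 : 0 < e by rewrite exprn_gt0//; lra.
have i0 : 0 < e^-1 by rewrite invr_gt0.
have j0 : 0 < e^-1 ^+ 2 by rewrite exprn_gt0.
exists (3 + `|ln e| + 2 / e + 4 * e^-1 ^+ 2); first by have := normr_ge0 (ln e); lra.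
move=> r s rm; have c1 := cos_le1 s; have c2 := cos_geN1 s.
have r2 : r ^+ 2 <= 1.
  have : 0 <= (1 - r) * (1 + r) by rewrite mulr_ge0//; lra.
  by rewrite (_ : (1 - r) * (1 + r) = 1 - r ^+ 2); [lra|ring].
have rc : `|r * cos s| <= m.
  by rewrite normrM -[leRHS]mulr1 ler_pM// ?ler_norml; lra.
have ed : e <= rden r s.
  have [r0|r0] := leP 0 r.
    apply: le_trans (rden_ge s r0); rewrite /e lerXn2r ?nnegrE; lra.
  have h : (1 + r) ^+ 2 <= rden r s.
    rewrite -subr_ge0 (_ : _ - _ = 2 * (- r * (1 - cos s))); last by rewrite /rden; ring.
    by rewrite !mulr_ge0//; lra.
  by apply: le_trans h; rewrite /e lerXn2r ?nnegrE; lra.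
have d0 : 0 < rden r s by lra.
have d4 : rden r s <= 4 by move: rc; rewrite /rden ler_norml -mulrA; lra.
have di : (rden r s)^-1 <= e^-1 by rewrite lef_pV2 ?posrE.
have ln0 : `|ln (rden r s)| <= 3 + `|ln e|.
  have h1 : ln e <= ln (rden r s) by rewrite ler_ln ?posrE.
  have h2 : ln (rden r s) <= 3.
    have : ln (1 + (rden r s - 1)) <= rden r s - 1 by apply: le_ln1Dx; lra.
    by rewrite addrC subrK; lra.
  have := ler_norm (- ln e); rewrite normrN ler_norml; move: h1 h2 (normr_ge0 (ln e)); lra.
have n0 := normr_ge0 (ln e).
have rB : `|r + cos s| <= 2 by rewrite ler_norml; lra.
split=> //.
- rewrite /rlog normrM (ger0_norm (_ : 0 <= 2^-1))//; have := normr_ge0 (ln (rden r s)); lra.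
- rewrite /rr normrM normfV (gtr0_norm d0).
  have h : `|r + cos s| * (rden r s)^-1 <= 2 * e^-1 by apply: ler_pM => //; rewrite invr_ge0 ltW.
  by lra.
- have cb : `|cos s * (1 + r ^+ 2) + 2 * r| <= 4.
    apply: le_trans (ler_normD _ _) _; rewrite (_ : 4 = 2 + 2); last by ring.
    have h1 : `|cos s * (1 + r ^+ 2)| <= 1 * 2.
      by rewrite normrM ler_pM// ?cos_max// ger0_norm; have := sqr_ge0 r; lra.
    have h2 : `|2 * r| <= 2 by rewrite ler_norml; lra.
    by lra.
  rewrite /kaps normrM normfV normrX (gtr0_norm d0) -exprVn.
  have h : `|cos s * (1 + r ^+ 2) + 2 * r| * (rden r s)^-1 ^+ 2 <= 4 * e^-1 ^+ 2.
    by apply: ler_pM => //; [rewrite exprn_ge0// invr_ge0 ltW|rewrite lerXn2r// nnegrE ?invr_ge0 ltW].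
  have : 0 < 2 / e by lra.
  by lra.
Qed.

Lemma disc_window b : -1 < b < 1 -> exists2 m : R, 0 < m < 1 & - m < b < m.
Proof.
move=> b1; exists ((1 + `|b|) / 2); have := normr_ge0 b; have : `|b| < 1 by rewrite ltr_norml; lra.
  by lra.
by have := ler_norm b; have := ler_norm (- b); rewrite normrN; lra.
Qed.

Lemma disc_rden b s : -1 < b < 1 -> 0 < rden b s.
Proof. by move=> /disc_window [m mp bm]; have [M _ h] := disc_bounds mp; have [] := h b s bm. Qed.

Lemma logb_circle b : -1 < b < 1 -> [/\ logb 0 pi (fun u => rlog b u), logb 0 pi (fun u => rr b u),
  logb 0 pi (fun u => kap b u) & logb 0 pi (fun u => kaps b u)].
Proof.
move=> b1; have d0 u := disc_rden u b1.
have n0 u : rden b u != 0 by rewrite gt_eqF.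
have dd := dv_rden_s b.
split; apply: logb_seg => u _.
- exact: dv_cvg (dv_rlog_s (d0 u)).
- exact: dv_cvg (dv_rr_s (n0 u)).
- exact: dv_cvg (dv_kap_s (n0 u)).
- by have du := dd u; rewrite /kaps; cvg_auto; rewrite expf_neq0.
Qed.

Definition mom j b : R := itg 0 pi (fun u => rlog b u ^+ j).
Definition rmom j b : R := itg 0 pi (fun u => rlog b u ^+ j * rr b u).
(** The factor [b] is kept inside because [b * rr b u] has the Cauchy-Riemann derivative [kaps],
    which leads to a closed recursion in [j]. *)
Definition gmom j b : R := itg 0 pi (fun u => rlog b u ^+ j * (b * rr b u)).

Lemma gmomE j b : -1 < b < 1 -> gmom j b = b * rmom j b.
Proof.
move=> b1; have [l1 l2 _ _] := logb_circle b1.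
rewrite /rmom -itgZ; last by apply: integ_logb; logb_auto.
by apply: itg_ext => u _; ring.
Qed.

Lemma dv_mom k b : -1 < b < 1 -> dv (mom k.+1) b (k.+1%:R * rmom k b).
Proof.
move=> b1; have [m mp bm] := disc_window b1; have [M M0 hM] := disc_bounds mp.
have sub x : - m < x < m -> -1 < x < 1 by move: mp; lra.
have [l1 l2 _ _] := logb_circle b1.
rewrite /rmom -itgZ; last by apply: integ_logb; logb_auto.
apply: (@dv_under _ _ _ (- m) m _ (fun b u => rlog b u ^+ k.+1) (fun b u => k.+1%:R * (rlog b u ^+ k * rr b u))
  (fun=> k.+1%:R * (M ^+ k * M))) => //.
- by move=> t /sub t1; have [l _ _ _] := logb_circle t1; apply: integ_logb; logb_auto.
- move=> t u tm _; have [d0 _ _ _] := hM t u tm; have dd := dv_rlog_r d0; dv_auto.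
  by rewrite /=; ring.
- move=> t u tm _; have [_ h1 h2 _] := hM t u tm.
  rewrite normrM (ger0_norm (ler0n _ _)) ler_wpM2l ?ler0n// normrM normrX ler_pM ?exprn_ge0//.
  by rewrite lerXn2r ?nnegrE.
- exact: integ_cst.
Qed.

(* Integrating [rlog^j kap_u] by parts in [u] leaves [kap^2 + rr^2 = 1/rden], and
   [1/rden = (1 - 2 b rr)/(1 - b^2)]. *)
Lemma dv_gmom j b : -1 < b < 1 -> dv (gmom j) b (j%:R * b / (1 - b ^+ 2) * (mom j.-1 b - 2 * gmom j.-1 b)).
Proof.
move=> b1; have [m mp bm] := disc_window b1; have [M M0 hM] := disc_bounds mp.
have sub x : - m < x < m -> -1 < x < 1 by move: mp; lra.
have [l1 l2 l3 l4] := logb_circle b1.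
have b2 : 1 - b ^+ 2 != 0.
  by rewrite (_ : _ - _ = (1 - b) * (1 + b)); [rewrite mulf_neq0// gt_eqF//; lra|ring].
have e0 : itg 0 pi (fun u => j%:R * rlog b u ^+ j.-1 * - (b * kap b u) * kap b u + rlog b u ^+ j * kaps b u) = 0.
  have c u : rlog b x ^+ j * kap b x @[x --> u] --> rlog b u ^+ j * kap b u.
    have d0 := disc_rden u b1; have d1 := dv_rlog_s d0; have d2 := dv_kap_s (lt0r_neq0 d0).
    by cvg_auto.
  rewrite (@FTC_logb _ _ _ _ (fun u => rlog b u ^+ j * kap b u) 0 0) ?subrr//.
  - by logb_auto.
  - move=> u _; have d0 := disc_rden u b1; have d1 := dv_rlog_s d0; have d2 := dv_kap_s (lt0r_neq0 d0).
    by dv_auto; rewrite /=; ring.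
  - by apply: cvg_at_right_filter; have := c 0; rewrite (_ : kap b 0 = 0) ?mulr0// /kap sin0 mul0r.
  - by apply: cvg_at_left_filter; have := c pi; rewrite (_ : kap b pi = 0) ?mulr0// /kap sinpi mul0r.
have -> : j%:R * b / (1 - b ^+ 2) * (mom j.-1 b - 2 * gmom j.-1 b) =
    itg 0 pi (fun u => j%:R * rlog b u ^+ j.-1 * rr b u * (b * rr b u) + rlog b u ^+ j * kaps b u).
  rewrite -[RHS]subr0 -[X in _ = _ - X]e0 -itgB; [|by apply: integ_logb; logb_auto..].
  rewrite /mom /gmom -itgZ; last by apply: integ_logb; logb_auto.
  rewrite -itgB; [|by apply: integ_logb; logb_auto..].
  rewrite -itgZ; last by apply: integ_logb; logb_auto.
  apply: itg_ext => u _; have d0 := lt0r_neq0 (disc_rden u b1).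
  transitivity (j%:R * b * rlog b u ^+ j.-1 * (kap b u ^+ 2 + rr b u ^+ 2)); last by ring.
  rewrite kap_rr//; have e : (rden b u)^-1 = (1 - 2 * (b * rr b u)) / (1 - b ^+ 2).
    rewrite /rr; apply: (mulIf b2); rewrite divfK//; apply: (mulIf d0).
    transitivity (1 - b ^+ 2); first by field.
    by rewrite mulrBl mul1r /rden; move: d0; rewrite /rden => d0; field.
  by rewrite e; field.
apply: (@dv_under _ _ _ (- m) m _ (fun b u => rlog b u ^+ j * (b * rr b u))
  (fun b u => j%:R * rlog b u ^+ j.-1 * rr b u * (b * rr b u) + rlog b u ^+ j * kaps b u)
  (fun=> j%:R * M ^+ j.-1 * M * (1 * M) + M ^+ j * M)) => //.
- by move=> t /sub t1; have [h1 h2 _ _] := logb_circle t1; apply: integ_logb; logb_auto.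
- move=> t u tm _; have [d0 _ _ _] := hM t u tm; have d1 := dv_rlog_r d0.
  have d2 := dv_rrr_r (lt0r_neq0 d0); apply: dv_eq; first exact: dvM (dvX j d1) d2.
  by rewrite /=; ring.
- move=> t u tm _; have [_ h1 h2 h3] := hM t u tm; have t1 : `|t| <= 1 by rewrite ler_norml; lra.
  have hp i : `|rlog t u| ^+ i <= M ^+ i by rewrite lerXn2r ?nnegrE.
  have a1 : `|j%:R * rlog t u ^+ j.-1 * rr t u| <= j%:R * M ^+ j.-1 * M.
    rewrite normrM normrM normrX (ger0_norm (ler0n _ j)); apply: ler_pM => //.
    by apply: ler_wpM2l => //; exact: hp.
  have a2 : `|t * rr t u| <= 1 * M by rewrite normrM; apply: ler_pM.
  have a3 : `|rlog t u ^+ j * kaps t u| <= M ^+ j * M by rewrite normrM normrX; apply: ler_pM; rewrite ?exprn_ge0.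
  apply: le_trans (ler_normD _ _) _; apply: lerD => //.
  by rewrite normrM; apply: ler_pM.
- exact: integ_cst.
Qed.

Lemma rlog0 u : rlog 0 u = 0.
Proof. by rewrite /rlog /rden mulr0 mul0r expr0n /= !addr0 ln1 mul0r. Qed.

Lemma gmom_0 j : gmom j 0 = 0.
Proof.
rewrite /gmom (@itg_ext _ _ _ _ (fun=> 0)) ?itg_cst ?mul0r ?pi_ge0// => u _.
by rewrite mul0r mulr0.
Qed.

Lemma gmom0 b : -1 < b < 1 -> gmom 0 b = 0.
Proof.
move=> b1; have := @eq_dv_cst _ (gmom 0) (fun=> 0) (fun=> 0) (-1) 1 b 0 b1.
rewrite gmom_0 !subr0; apply; first by lra.
  by move=> t t1; apply: dv_eq (dv_gmom 0 t1) _; rewrite !mul0r.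
by move=> t _; exact: dv_cst.
Qed.

(** Division by [b] settles all [b] but [0], where the kernel reduces to [cos]. *)
Lemma rmom0 b : -1 < b < 1 -> rmom 0 b = 0.
Proof.
move=> b1; have [->|bn] := eqVneq b 0; last first.
  by have := gmomE 0 b1; rewrite gmom0// => /esym/eqP; rewrite mulf_eq0 (negbTE bn) => /eqP.
rewrite /rmom (@itg_ext _ _ _ _ cos); last first.
  by move=> u _; rewrite expr0 mul1r /rr /rden mulr0 mul0r expr0n /= add0r !addr0 divr1.
rewrite (@FTC_logb _ _ _ _ sin 0 0) ?subrr//.
- by apply: logb_seg => u _; apply: continuous_cos.
- by move=> u _; apply: dv_eq (dv_sin (dv_id u)) _; rewrite mulr1.
- by apply: cvg_at_right_filter; rewrite -[X in _ --> X](@sin0 R); apply: continuous_sin.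
- by apply: cvg_at_left_filter; rewrite -[X in _ --> X](@sinpi R); apply: continuous_sin.
Qed.

Lemma mom_0 k : mom k.+1 0 = 0.
Proof.
rewrite /mom (@itg_ext _ _ _ _ (fun=> 0)) ?itg_cst ?mul0r ?pi_ge0// => u _.
by rewrite rlog0 exprS mul0r.
Qed.

(** Jensen's formula in the zero-free case: the mean of [ln |1 + b e^{iu}|] over the circle is
    zero. *)
Lemma mom1 b : -1 < b < 1 -> mom 1 b = 0.
Proof.
move=> b1; have := @eq_dv_cst _ (mom 1) (fun=> 0) (fun=> 0) (-1) 1 b 0 b1.
rewrite mom_0 !subr0; apply; first by lra.
  by move=> t t1; apply: dv_eq (dv_mom 0 t1) _; rewrite rmom0// mulr0.
by move=> t _; exact: dv_cst.
Qed.

Lemma onemX2_gt0 b : -1 < b < 1 -> 0 < 1 - b ^+ 2.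
Proof. by move=> b1; rewrite (_ : _ - _ = (1 - b) * (1 + b)); [rewrite mulr_gt0//; lra|ring]. Qed.

(** Both sides vanish at [0] and have the derivative [pi b / (1 - b^2)]; [gmom2] repeats this one
    order higher with [mom1] and [gmom1] as input. *)
Lemma gmom1 b : -1 < b < 1 -> gmom 1 b = - (pi / 2 * ln (1 - b ^+ 2)).
Proof.
move=> b1; have := @eq_dv_cst _ (gmom 1) (fun b => - (pi / 2 * ln (1 - b ^+ 2))) (fun b => pi * b / (1 - b ^+ 2)) (-1) 1 b 0 b1.
rewrite gmom_0 expr0n /= subr0 ln1 mulr0 oppr0 subrr => h; apply/eqP; rewrite -subr_eq0; apply/eqP/h; first by lra.
  move=> t t1; apply: dv_eq (dv_gmom 1 t1) _.
  rewrite gmom0// /mom (@itg_ext _ _ _ _ (fun=> 1)) ?itg_cst ?pi_ge0//.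
  by have := onemX2_gt0 t1; gen_pi => h1; fld.
by move=> t t1; have h1 := onemX2_gt0 t1; dv_auto => //; gen_pi; rewrite /= expr1; fld.
Qed.

Lemma gmom2 b : -1 < b < 1 -> gmom 2 b = - (pi / 2 * ln (1 - b ^+ 2) ^+ 2).
Proof.
move=> b1; have := @eq_dv_cst _ (gmom 2) (fun b => - (pi / 2 * ln (1 - b ^+ 2) ^+ 2))
  (fun b => 2 * pi * b * ln (1 - b ^+ 2) / (1 - b ^+ 2)) (-1) 1 b 0 b1.
rewrite gmom_0 expr0n /= subr0 ln1 expr0n /= mulr0 oppr0 subrr => h; apply/eqP; rewrite -subr_eq0; apply/eqP/h; first by lra.
  move=> t t1; apply: dv_eq (dv_gmom 2 t1) _; rewrite gmom1// mom1//.
  by have := onemX2_gt0 t1; gen_pi => h1; fld.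
by move=> t t1; have h1 := onemX2_gt0 t1; dv_auto => //; gen_pi; rewrite /= !expr1; fld.
Qed.

Lemma dv_mom2 b : 0 < b < 1 -> dv (mom 2) b (- pi * (ln (1 - b ^+ 2) / b)).
Proof.
move=> b1; have b1' : -1 < b < 1 by lra.
apply: dv_eq (dv_mom 1 b1') _; have := gmomE 1 b1'; rewrite gmom1// => h.
have b0 : 0 < b by lra.
by apply: (mulfI (lt0r_neq0 b0)); rewrite mulrCA -h; gen_pi; fld.
Qed.

Lemma dv_mom3 b : 0 < b < 1 -> dv (mom 3) b (- (3 * pi / 2) * (ln (1 - b ^+ 2) ^+ 2 / b)).
Proof.
move=> b1; have b1' : -1 < b < 1 by lra.
apply: dv_eq (dv_mom 2 b1') _; have := gmomE 2 b1'; rewrite gmom2// => h.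
have b0 : 0 < b by lra.
by apply: (mulfI (lt0r_neq0 b0)); rewrite mulrCA -h; gen_pi; fld.
Qed.

(** From [sin^2 u <= rden b u <= 9]. The bound is uniform through [|b| = 1], where the integrand
    becomes singular, and so gives continuity of the moments at that radius. *)
Lemma rlog_lsin b u : -2 < b < 2 -> 0 < u < pi -> `|rlog b u| <= 2 + `|lsin u|.
Proof.
move=> b2 up; have s0 := sin_pos up; have s2 : 0 < sin u ^+ 2 by rewrite exprn_gt0.
have ge := rden_ge_sin b u; have d0 : 0 < rden b u by lra.
have d9 : rden b u <= 9.
  have h1 : `|b * cos u| <= 2 * 1 by rewrite normrM ler_pM// ?cos_max// ler_norml; lra.
  have h2 : 0 <= (2 - b) * (2 + b) by rewrite mulr_ge0//; lra.
  rewrite (_ : (2 - b) * (2 + b) = 4 - b ^+ 2) in h2; last by ring.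
  by move: h1; rewrite /rden ler_norml -mulrA; lra.
have l9 : ln (rden b u) <= 4.
  have h : ln (rden b u) <= 2 * ln 3.
    rewrite (_ : 2 * ln 3 = ln (3 ^+ 2)); last by rewrite lnXn// mulr2n; ring.
    by rewrite ler_ln ?posrE ?exprn_gt0//; lra.
  have : ln (1 + 2) <= 2 :> R by apply: le_ln1Dx; lra.
  by rewrite (_ : 1 + 2 = 3); [lra|ring].
have lo : 2 * (lsin u - 1) <= ln (rden b u).
  apply: le_trans (_ : ln (sin u ^+ 2) <= _); last by rewrite ler_ln ?posrE.
  rewrite lnXn// mulr2n /lsin lnM ?posrE//.
  have : ln (1 + 1) <= 1 :> R by apply: le_ln1Dx; lra.
  by rewrite (_ : 1 + 1 = 2); [lra|ring].
have := ler_norm (- lsin u); have := normr_ge0 (lsin u); rewrite normrN.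
by rewrite /rlog ler_norml; lra.
Qed.

Lemma rden_sin_gt0 b u : 0 < u < pi -> 0 < rden b u.
Proof.
by move=> up; apply: lt_le_trans (rden_ge_sin b u); rewrite exprn_gt0// sin_pos.
Qed.

Lemma logb_lsin_dom j : logb 0 pi (fun u => (2 + `|lsin u|) ^+ j).
Proof.
have ls : logb 0 pi (@lsin R) by apply: lsin_logb.
by have l := logb_norm ls; logb_auto.
Qed.

Lemma logb_rlog_circle j b : -2 < b < 2 -> logb 0 pi (fun u => rlog b u ^+ j).
Proof.
move=> b2; apply: logb_le (logb_lsin_dom j) => u up.
  by have dd := dv_rlog_s (rden_sin_gt0 b up); cvg_auto.
by rewrite normrX lerXn2r ?nnegrE ?addr_ge0// rlog_lsin.
Qed.

Lemma cvg_mom j b : -2 < b < 2 -> mom j x @[x --> b] --> mom j b.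
Proof.
move=> b2; apply: (@cvg_under _ _ _ (-2) 2 _ (fun b u => rlog b u ^+ j) (fun u => (2 + `|lsin u|) ^+ j)) => //.
- by move=> t t2; apply/integ_logb/logb_rlog_circle.
- by move=> t u _ up; have dd := dv_rlog_r (rden_sin_gt0 t up); cvg_auto.
- by move=> t u t2 up; rewrite normrX lerXn2r ?nnegrE ?addr_ge0// rlog_lsin.
- exact/integ_logb/logb_lsin_dom.
Qed.

Lemma mom3_1 : mom 3 1 = - (3 / 2 * pi * zeta (3 : R)).
Proof.
rewrite -itg_ln1BX2; have l := @logb_ln1BX2 R.
have := @FTC_logb _ 0 1 (fun b => - (3 * pi / 2) * (ln (1 - b ^+ 2) ^+ 2 / b)) (mom 3) 0 (mom 3 1) ltr01.
rewrite itgZ ?subr0; last exact: integ_logb.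
move=> <-; [by ring|by logb_auto|exact: dv_mom3| |].
  by apply: cvg_at_right_filter; rewrite -[X in _ --> X](mom_0 2); apply: cvg_mom; lra.
by apply: cvg_at_left_filter; apply: cvg_mom; lra.
Qed.

Lemma mom2_1 : mom 2 1 = pi ^+ 3 / 12.
Proof.
have l := @logb_ln1BX2_div R.
have := @FTC_logb _ 0 1 (fun b => - pi * (ln (1 - b ^+ 2) / b)) (mom 2) 0 (mom 2 1) ltr01.
rewrite itgZ ?subr0 ?itg_ln1BX2_div; last exact: integ_logb.
move=> <-; [by ring|by logb_auto|exact: dv_mom2| |].
  by apply: cvg_at_right_filter; rewrite -[X in _ --> X](mom_0 1); apply: cvg_mom; lra.
by apply: cvg_at_left_filter; apply: cvg_mom; lra.
Qed.

(** Since [|1 + e^{iu}| = 2 cos (u / 2)], this is half of the third moment at radius [1]. *)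
Lemma lcos_cube_pihalf : itg 0 (pi / 2) (fun x : R => lcos x ^+ 3) = - (3 / 4 * pi * zeta (3 : R)).
Proof.
have lc : logb 0 (pi / 2) (@lcos R) by apply: lcos_logb; have := @pi_gt0 R; lra.
have l3 : logb (2^-1 * 0) (2^-1 * pi) (fun x : R => lcos x ^+ 3).
  by rewrite mulr0 (mulrC _ pi); logb_auto.
have := @itg_scale _ 0 pi 2^-1 (fun x => lcos x ^+ 3) ltac:(by []) l3.
rewrite mulr0 (mulrC _ pi) invrK (@itg_ext _ _ _ _ (fun u => rlog 1 u ^+ 3)); last first.
  move=> u up; congr (_ ^+ 3); have c0 : 0 < cos (2^-1 * u) by apply: cos_pos; lra.
  rewrite /rlog rden1 (_ : 2 * (1 + cos u) = (2 * cos (2^-1 * u)) ^+ 2).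
    by rewrite lnXn ?mulr2n /lcos; [field|rewrite mulr_gt0].
  rewrite {1}(_ : u = 2 * (2^-1 * u)) ?cos2x; [by ring|by field].
rewrite -/(mom 3 1) mom3_1; move: (itg _ _ _) => x; lra.
Qed.

(* Jensen: [ln |1 + a e^{iu}| = ln a + ln |1 + a^{-1} e^{-iu}|] and the first moment vanishes. *)
Lemma mom3_gt1 a : 1 < a < 2 -> mom 3 a = pi * ln a ^+ 3 + 3 * ln a * mom 2 a^-1 + mom 3 a^-1.
Proof.
move=> a12; have a0 : 0 < a by lra.
have i1 : 0 < a^-1 < 1 by rewrite invr_gt0 a0 invf_lt1//; lra.
have i1' : -1 < a^-1 < 1 by lra.
have i2 : -2 < a^-1 < 2 by lra.
have e u : 0 < u < pi -> rlog a u = ln a + rlog a^-1 u.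
  move=> up; have d0 := rden_sin_gt0 a^-1 up.
  rewrite /rlog (_ : rden a u = a ^+ 2 * rden a^-1 u); last by rewrite /rden; field; rewrite gt_eqF.
  by rewrite lnM ?posrE ?exprn_gt0// lnXn// mulr2n; field.
have l1 := logb_rlog_circle 1 i2; have l2 := logb_rlog_circle 2 i2; have l3 := logb_rlog_circle 3 i2.
transitivity (itg 0 pi (fun u => ln a ^+ 3 + (3 * ln a ^+ 2 * (rlog a^-1 u ^+ 1) +
    (3 * ln a * (rlog a^-1 u ^+ 2) + rlog a^-1 u ^+ 3)))).
  by apply: itg_ext => u up; rewrite e//; ring.
rewrite itgD; [|exact: integ_cst|by apply: integ_logb; logb_auto].
rewrite itgD; [|by apply: integ_logb; logb_auto|by apply: integ_logb; logb_auto].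
rewrite itgD; [|by apply: integ_logb; logb_auto|exact: integ_logb].
rewrite itg_cst ?pi_ge0// itgZ; last exact: integ_logb.
rewrite itgZ; last exact: integ_logb.
rewrite -/(mom 1 a^-1) -/(mom 2 a^-1) -/(mom 3 a^-1) mom1//.
by ring.
Qed.

End circle_moments.

(** * The Mahler measure as an integral of circle moments *)

Section jensen_reduction.
Context {R : realType}.
Implicit Types (a b c s t u x : R) (j k : nat).

Lemma cvg_compR (h phi : R -> R) x : phi y @[y --> x] --> phi x -> h y @[y --> phi x] --> h (phi x) ->
  h (phi y) @[y --> x] --> h (phi x).
Proof. exact: cvg_comp. Qed.

Lemma rden_piB b s : rden b (pi - s) = rden (- b) s.
Proof. by rewrite /rden cosB cospi sinpi; ring. Qed.

Lemma rden_gt0' a s : a ^+ 2 != 1 -> 0 < rden a s.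
Proof.
have nn x t : 0 <= x -> x ^+ 2 != 1 -> 0 < rden x t.
  move=> x0 x1; apply: lt_le_trans (rden_ge t x0).
  rewrite lt_neqAle sqr_ge0 andbT eq_sym expf_eq0 /= subr_eq0 eq_sym.
  by apply: contraNneq x1 => ->; rewrite expr1n.
have [a0|a0] := leP 0 a; first exact: nn.
move=> a1; rewrite -[a]opprK -rden_piB; apply: nn; first by lra.
by rewrite sqrrN.
Qed.

Lemma cts_rlogX a j s : a ^+ 2 != 1 -> rlog a x ^+ j @[x --> s] --> rlog a s ^+ j.
Proof. by move=> a1; have dd := dv_rlog_s (rden_gt0' s a1); cvg_auto. Qed.

Lemma itg_period c (h : R -> R) : (forall x, h (x + 2 * pi) = h x) ->
  (forall x, h y @[y --> x] --> h x) -> 0 <= c <= 2 * pi ->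
  itg (- c) (2 * pi - c) h = itg 0 (2 * pi) h.
Proof.
move=> hp hc cp; have lh x y : logb x y h by apply: logb_seg.
have ih x y : integ x y h by exact: integ_logb.
rewrite (@itg_split _ _ _ 0)//; last by lra.
rewrite (@itg_split _ 0 (2 * pi) (2 * pi - c))//; last by lra.
have := @itg_shift _ (2 * pi - c) (2 * pi) (2 * pi) h (lh _ _).
rewrite subrr (_ : 2 * pi - c - 2 * pi = - c); last by ring.
rewrite (@itg_ext _ _ _ (fun x => h (x + 2 * pi)) h); last by move=> x _; rewrite hp.
by move=> ->; rewrite addrC.
Qed.

(** Periodicity removes the phase [c], and evenness in the angle folds the full circle onto
    [[0, pi]]. *)
Lemma circle_mean a c j : a ^+ 2 != 1 -> 0 <= c <= 2 * pi ->
  itg 0 1 (fun t => rlog a (2 * pi * t - c) ^+ j) = mom j a / pi.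
Proof.
move=> a1 cp; have pp := @pi_gt0 R.
pose h x := rlog a x ^+ j; have hc x : h y @[y --> x] --> h x by exact: cts_rlogX.
have lh x y : logb x y h by apply: logb_seg.
have c2 x : cos (x + 2 * pi) = cos x by rewrite mulr_natl cosD2pi.
have hp x : h (x + 2 * pi) = h x by rewrite /h /rlog /rden c2.
have lhc x y : logb x y (fun x => h (x - c)).
  apply: logb_seg => z _; apply: (@cvg_compR h (fun x => x - c)); last exact: hc.
  by cvg_auto.
rewrite (@itg_scale _ 0 1 (2 * pi) (fun x => h (x - c))); [|lra|exact: lhc].
have := @itg_shift _ (- c) (2 * pi - c) (- c) h (lh _ _).
rewrite mulr0 mulr1 (_ : - c - - c = 0); last by ring.
rewrite (_ : 2 * pi - c - - c = 2 * pi); last by ring.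
move=> ->; rewrite itg_period//.
have e : itg pi (2 * pi) h = itg 0 pi h.
  have := @itg_refl _ pi (2 * pi) (2 * pi) h (lh _ _).
  rewrite subrr (_ : 2 * pi - pi = pi); last by ring.
  move=> <-; apply: itg_ext => x _; rewrite /h /rlog /rden.
  by rewrite (addrC (2 * pi)) c2 cosN.
rewrite (@itg_split _ 0 (2 * pi) pi h) ?e; [|lra|exact: integ_logb].
by rewrite -/(mom j a); gen_pi; fld.
Qed.

Lemma ln_sqrt x : 0 <= x -> ln (Num.sqrt x) = ln x / 2.
Proof.
rewrite le_eqVlt => /orP[/eqP <-|x0]; first by rewrite sqrtr0 ln0// mul0r.
by rewrite -{2}(sqr_sqrtr (ltW x0)) lnXn ?sqrtr_gt0// mulr2n; field.
Qed.

(** Multiplying by [e^{- i pi u}] leaves the modulus unchanged and brings the sum to the form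
    [a + e^{is}] with [s = 2 pi t - pi u]. *)
Lemma ln_normc t u : ln (Normc.normc (1 + expi (2 * pi * t) + expi (2 * pi * u))) =
  rlog (2 * cos (pi * u)) (2 * pi * t - pi * u).
Proof.
rewrite /expi /rlog -ln_sqrt; last first.
  by rewrite rden_sin addr_ge0// sqr_ge0.
congr (ln (Num.sqrt _)).
have -> : 2 * pi * u = 2 * (pi * u) by ring.
rewrite cos2x sin2x /rden cosB; move: (2 * pi * t) (pi * u) => x y.
have h1 := cos2sin2 x; have h2 := cos2sin2 y.
transitivity ((2 * cos y ^+ 2 + cos x) ^+ 2 + (sin x + 2 * sin y * cos y) ^+ 2); first by rewrite /=; ring.
transitivity (4 * cos y ^+ 2 * (cos y ^+ 2 + sin y ^+ 2) + 4 * cos y * (cos x * cos y + sin x * sin y) + (cos x ^+ 2 + sin x ^+ 2)); first by ring.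
by rewrite !cos2Dsin2; ring.
Qed.

Lemma itg_ext_point a b c (f g : R -> R) : a <= c <= b -> integ a b g ->
  (forall x, a < x < b -> x != c -> f x = g x) -> integ a b f /\ itg a b f = itg a b g.
Proof.
move=> cab ig fg.
have e1 x : a < x < c -> f x = g x by move=> xc; apply: fg; [lra|rewrite lt_eqF//; lra].
have e2 x : c < x < b -> f x = g x by move=> xc; apply: fg; [lra|rewrite gt_eqF//; lra].
have i1 : integ a c g by apply: integ_sub ig; lra.
have i2 : integ c b g by apply: integ_sub ig; lra.
have iF : integ a b f.
  apply: (integ_glue cab); first by apply: integ_ext i1 => x xc; rewrite e1.
  by apply: integ_ext i2 => x xc; rewrite e2.
by split=> //; rewrite (itg_split cab)// (itg_split cab ig) (itg_ext e1) (itg_ext e2).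
Qed.

Lemma momN j b : -2 < b < 2 -> mom j (- b) = mom j b.
Proof.
move=> b2; have := itg_refl pi (logb_rlog_circle j b2); rewrite subrr subr0 -/(mom j b) => <-.
by apply: itg_ext => u _; rewrite /rlog rden_piB.
Qed.

Lemma cos_lt1 x : 0 < x < pi -> -2 < 2 * cos x < 2.
Proof.
move=> xp; have h1 : cos x < cos 0 by rewrite ltr_cos ?in_itv/=; lra.
have h2 : cos pi < cos x by rewrite ltr_cos ?in_itv/=; lra.
by move: h1 h2; rewrite cos0 cospi; lra.
Qed.

Lemma logb_mom_comp a b j (f : R -> R) : contin a b f -> (forall x, a < x < b -> -2 < f x < 2) ->
  logb a b (fun x => mom j (f x)).
Proof.
move=> cf f2; apply: (@logb_bounded _ _ _ _ (itg 0 pi (fun u => (2 + `|lsin u|) ^+ j))).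
  by move=> x xp; apply: (@cvg_compR (mom j) f); [exact: cf|exact/cvg_mom/f2].
move=> x xp; have l := logb_rlog_circle j (f2 x xp).
apply: le_trans (itg_norm (integ_logb l)) _.
apply: le_itg; [exact/integ_norm/integ_logb|exact/integ_logb/logb_lsin_dom|].
by move=> u up; rewrite normrX lerXn2r ?nnegrE ?addr_ge0// rlog_lsin//; exact: f2.
Qed.

Lemma logb_mom_cos a b j : 0 <= a -> b <= pi -> logb a b (fun x => mom j (2 * cos x)).
Proof.
move=> a0 bp; apply: (logb_sub a0 bp); apply: logb_mom_comp; last exact: cos_lt1.
by move=> x _; cvg_auto.
Qed.

(** At [u = 1 / 3] and [u = 2 / 3] the radius is [1] in modulus and the inner integrand is singular
    on the circle; these two points are set aside. *)
Lemma two_cos_sqr1 u : 0 < u < 1 -> u != 1 / 3 -> u != 2 / 3 -> (2 * cos (pi * u)) ^+ 2 != 1.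
Proof.
move=> u1 un1 un2; have pp := @pi_gt0 R.
have pu : 0 < pi * u < pi.
  have h : pi * u < pi * 1 by rewrite ltr_pM2l//; lra.
  by rewrite mulr_gt0//; lra.
have inj x : 0 < x < pi -> cos x = 1 / 2 -> x = pi / 3.
  move=> xp cx; apply: (@cos_inj R); rewrite ?in_itv/= ?cos_pi3//; lra.
rewrite -[X in _ != X](expr1n _ 2) eqf_sqr negb_or; apply/andP; split.
  apply: contra un1 => /eqP h; apply/eqP.
  have h2 : pi * u = pi / 3 by apply: inj => //; lra.
  by apply: (mulfI (lt0r_neq0 pp)); rewrite h2; ring.
apply: contra un2 => /eqP h; apply/eqP.
have h2 : pi - pi * u = pi / 3.
  by apply: inj; [lra|rewrite cosB cospi sinpi; lra].
by apply: (mulfI (lt0r_neq0 pp)); lra.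
Qed.

Lemma mahler_mom : pi * higher_mahler 3 (fun x y : R[i]%C => 1 + x + y) =
  2 / pi * itg 0 (pi / 2) (fun x : R => mom 3 (2 * cos x)).
Proof.
have pp := @pi_gt0 R.
pose inner u : R := \int[@lebesgue_measure R]_(t in `[0%R, 1%R])
      (ln (Normc.normc (1 + expi (2 * pi * t) + expi (2 * pi * u)))) ^+ 3.
pose g u : R := mom 3 (2 * cos (pi * u)) / pi.
have eI u : 0 < u < 1 -> u != 1 / 3 -> u != 2 / 3 -> inner u = g u.
  move=> u1 un1 un2; have n1 := two_cos_sqr1 u1 un1 un2.
  have pu : 0 <= pi * u <= 2 * pi by rewrite mulr_ge0 ?(mulrC 2) ?ler_pM2l//; lra.
  rewrite /g -(circle_mean 3 n1 pu).
  have l : logb 0 1 (fun t => rlog (2 * cos (pi * u)) (2 * pi * t - pi * u) ^+ 3).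
    apply: logb_seg => x _; have dd := dv_rlog_s (rden_gt0' (2 * pi * x - pi * u) n1).
    have d1 : dv (fun t => 2 * pi * t - pi * u) x (2 * pi) by dv_auto; ring.
    by have d2 := @dv_comp _ (rlog (2 * cos (pi * u))) (fun t => 2 * pi * t - pi * u) x _ _ dd d1; cbv beta in d2; cvg_auto.
  rewrite -(@integ_ends _ 0 1 _ true false (integ_logb l)).
  by apply: eq_Rintegral => t _; rewrite ln_normc.
have lm := @logb_mom_cos 0 pi 3 (lexx _) (lexx _).
have lg : logb 0 1 g.
  have h : logb 0 1 (fun u => mom 3 (2 * cos (pi * u))).
    by apply: (@logb_scale _ 0 1 pi (fun x => mom 3 (2 * cos x))) => //; rewrite mulr0 mulr1.
  by rewrite /g; logb_auto.
(* The cut at [1 / 2] leaves one exceptional point in each half, where [itg_ext_point] applies. *)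
have [i1 e1] : integ 0 (1 / 2) inner /\ itg 0 (1 / 2) inner = itg 0 (1 / 2) g.
  apply: (@itg_ext_point _ _ (1 / 3)); [lra|by apply: integ_sub (integ_logb lg); lra|].
  by move=> x x1 xn; apply: eI => //; [lra|rewrite lt_eqF//; lra].
have [i2 e2] : integ (1 / 2) 1 inner /\ itg (1 / 2) 1 inner = itg (1 / 2) 1 g.
  apply: (@itg_ext_point _ _ (2 / 3)); [lra|by apply: integ_sub (integ_logb lg); lra|].
  by move=> x x1 xn; apply: eI => //; [lra|rewrite gt_eqF//; lra].
have h2 : 0 <= (1 / 2 : R) <= 1 by lra.
have iI := integ_glue h2 i1 i2.
have -> : higher_mahler 3 (fun x y : R[i]%C => 1 + x + y) = itg 0 1 inner.
  by rewrite -(@integ_ends _ 0 1 _ true false iI).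
rewrite (itg_split h2 iI) e1 e2 -(itg_split h2 (integ_logb lg)).
have -> : itg 0 1 g = pi^-1 * (pi^-1 * itg 0 pi (fun x => mom 3 (2 * cos x))).
  rewrite -(@itgZ _ 0 pi pi^-1); last exact: integ_logb.
  have lq : logb (pi * 0) (pi * 1) (fun x => pi^-1 * mom 3 (2 * cos x)) by rewrite mulr0 mulr1; logb_auto.
  have := itg_scale pp lq; rewrite mulr0 mulr1 => <-.
  by apply: itg_ext => u _; rewrite /g mulrC.
(* Replacing [x] by [pi - x] changes the sign of the radius, and the moments are even in the
   radius. *)
have -> : itg 0 pi (fun x => mom 3 (2 * cos x)) = 2 * itg 0 (pi / 2) (fun x => mom 3 (2 * cos x)).
  rewrite (@itg_split _ 0 pi (pi / 2)); [|lra|exact: integ_logb].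
  have lm2 := @logb_mom_cos (pi / 2) pi 3 ltac:(lra) (lexx _).
  have := itg_refl pi lm2; rewrite subrr (_ : pi - pi / 2 = pi / 2); last by field.
  move=> <-; rewrite [X in _ + X](@itg_ext _ _ _ _ (fun x => mom 3 (2 * cos x))); first by ring.
  move=> x xp; have xp' : 0 < x < pi by lra.
  by rewrite -(momN 3 (cos_lt1 xp')) cosB cospi sinpi; congr mom; ring.
by move: (itg _ _ _) => X; gen_pi; fld.
Qed.

End jensen_reduction.

(** * Moments as triangle integrals with a tangent weight *)

Section triangle_integrals.
Context {R : realType}.
Implicit Types (a b c k t x y : R).

Lemma logb_lsinBr a b k : 0 <= a - k -> b - k <= pi -> logb a b (fun x => lsin (x - k)).
Proof.
move=> ak bk; have := logb_shift (- k) (@lsin_logb R (a - k) (b - k) ak bk).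
by rewrite !opprK !subrK.
Qed.

Lemma logb_lsinDr a b k : 0 <= a + k -> b + k <= pi -> logb a b (fun x => lsin (k + x)).
Proof.
move=> ak bk; have := @logb_lsinBr a b (- k); rewrite !opprK => /(_ ak bk).
by apply: logb_ext => x _; rewrite addrC.
Qed.

Lemma logb_lsinBl a b k : 0 <= k - b -> k - a <= pi -> logb a b (fun x => lsin (k - x)).
Proof.
move=> bk ak; have := logb_refl k (@lsin_logb R (k - b) (k - a) bk ak).
by rewrite !subKr.
Qed.

(* [log_ratio x y = ln (1 - cos^2 y / cos^2 x)] for [0 < x < y < pi / 2]. *)
Definition log_ratio x y : R := lsin (y - x) + lsin (x + y) - 2 * lcos x.

(** The identity [cos^2 x - cos^2 y = sin (y - x) sin (y + x)] factors the argument, so the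
    logarithm splits into [lsin] and [lcos]. *)
Lemma log_ratioE x y : 0 < x -> x < y -> y < pi / 2 -> [/\ 0 < cos y / cos x < 1,
  0 < 1 - (cos y / cos x) ^+ 2 & ln (1 - (cos y / cos x) ^+ 2) = log_ratio x y].
Proof.
move=> x0 xy yp; have s1 : 0 < sin (y - x) by apply: sin_pos; lra.
have s2 : 0 < sin (x + y) by apply: sin_pos; lra.
have c1 : 0 < cos x by apply: cos_pos; lra.
have c2 : 0 < cos y by apply: cos_pos; lra.
have e : 1 - (cos y / cos x) ^+ 2 = (2 * sin (y - x)) * (2 * sin (x + y)) / (2 * cos x) ^+ 2.
  rewrite sinB sinD; have h1 := cos2sin2 x; have h2 := cos2sin2 y.
  transitivity ((sin y ^+ 2 * cos x ^+ 2 - cos y ^+ 2 * sin x ^+ 2) / cos x ^+ 2); last by field; rewrite gt_eqF.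
  rewrite (sin2cos2 y) (sin2cos2 x); field; by rewrite gt_eqF.
have p1 : 0 < 2 * sin (y - x) by lra.
have p2 : 0 < 2 * sin (x + y) by lra.
have p3 : 0 < 2 * cos x by lra.
have e0 : 0 < 1 - (cos y / cos x) ^+ 2 by rewrite e !mulr_gt0// invr_gt0 exprn_gt0.
split=> //.
  by rewrite divr_gt0//= ltr_pdivrMr// mul1r ltr_cos ?in_itv/=; lra.
rewrite e /log_ratio /lsin /lcos !lnM ?posrE ?mulr_gt0 ?invr_gt0 ?exprn_gt0//.
by rewrite lnV ?posrE ?exprn_gt0// lnXn// mulr2n lnM ?posrE//; ring.
Qed.

Lemma log_ratio_le0 x y : 0 < x -> x < y -> y < pi / 2 -> log_ratio x y <= 0.
Proof.
move=> x0 xy yp; have [_ h <-] := log_ratioE x0 xy yp.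
by apply: ln_le0; rewrite gerBl sqr_ge0.
Qed.

Lemma logb_ratio_r x b : 0 < x -> b <= pi / 2 -> logb x b (log_ratio x).
Proof.
move=> x0 bp; have [xb|bx] := ltP x b; last by split=> [y|]; [lra|exists 0, 0%N; split=> // y; lra].
have l1 : logb x b (fun y => lsin (y - x)) by apply: logb_lsinBr; lra.
have l2 : logb x b (fun y => lsin (x + y)) by apply: logb_lsinDr; lra.
by rewrite /log_ratio; logb_auto.
Qed.

Lemma logb_ratio_l a y : 0 <= a -> y < pi / 2 -> logb a y (fun x => log_ratio x y).
Proof.
move=> a0 yp; have [xb|bx] := ltP a y; last by split=> [t|]; [lra|exists 0, 0%N; split=> // t; lra].
have l1 : logb a y (fun x => lsin (y - x)) by apply: logb_lsinBl; lra.
have l2 : logb a y (fun x => lsin (x + y)).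
  by apply: (@logb_ext _ _ _ (fun x => lsin (y + x))); [move=> x _; rewrite addrC|apply: logb_lsinDr; lra].
have l3 : logb a y (@lcos R) by apply: lcos_logb; lra.
by rewrite /log_ratio; logb_auto.
Qed.

(* Equal to [tan] where [cos] is positive, and visibly measurable. *)
Let tanm x : R := sin x * expR (- ln (cos x)).

Let tanmE x : 0 < x < pi / 2 -> tanm x = tan x.
Proof.
move=> xp; have c0 : 0 < cos x by apply: cos_pos; lra.
by rewrite /tanm expRN lnK.
Qed.

Let mln_comp (f : R -> R) : continuous f -> measurable_fun [set: R] (fun x => ln (f x)).
Proof. by move=> cf; apply: (measurableT_comp (@measurable_ln R)); exact: continuous_measurable_fun. Qed.

Let mtanm : measurable_fun [set: R] tanm.
Proof.
rewrite /tanm; apply: measurable_funM.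
  by apply: continuous_measurable_fun; exact: continuous_sin.
apply: (measurableT_comp (@measurable_expR R)).
apply: measurableT_comp => //; apply: mln_comp; exact: continuous_cos.
Qed.

Let mlsin : measurable_fun [set: R] (@lsin R).
Proof.
apply: (mln_comp (f := fun x => 2 * sin x)) => x.
by have h : 2 * sin y @[y --> x] --> 2 * sin x by cvg_auto; exact: h.
Qed.

Let mlcos : measurable_fun [set: R] (@lcos R).
Proof.
apply: (mln_comp (f := fun x => 2 * cos x)) => x.
by have h : 2 * cos y @[y --> x] --> 2 * cos x by cvg_auto; exact: h.
Qed.

Let m1 (f : R -> R) : measurable_fun [set: R] f -> measurable_fun [set: R * R] (fun z => f z.1).
Proof. by move=> mf; apply: (measurableT_comp mf); exact: measurable_fst. Qed.

Let m2 (f : R -> R) : measurable_fun [set: R] f -> measurable_fun [set: R * R] (fun z => f z.2).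
Proof. by move=> mf; apply: (measurableT_comp mf); exact: measurable_snd. Qed.

Lemma measurable_log_ratio : measurable_fun [set: R * R] (fun z => log_ratio z.1 z.2).
Proof.
apply: measurable_funB; first apply: measurable_funD.
- apply: (measurableT_comp mlsin); apply: measurable_funB; [exact: measurable_snd|exact: measurable_fst].
- apply: (measurableT_comp mlsin); apply: measurable_funD; [exact: measurable_fst|exact: measurable_snd].
- by apply: measurable_funM; [exact: measurable_cst|exact: (m1 mlcos)].
Qed.

Lemma measurable_neg_lcos_ratio : measurable_fun [set: R * R] (fun z => - (lcos z.1 * log_ratio z.1 z.2)).
Proof. by apply: measurableT_comp => //; apply: measurable_funM; [exact: (m1 mlcos)|exact: measurable_log_ratio]. Qed.

(** Tonelli with the weight attached to the outer variable [y]; in the companion below it is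
    attached to [x]. The measurable substitute [tanm] enters only between the first and the last
    step. *)
Lemma triangle_tan_upper a b (F : R -> R -> R) : 0 <= a -> b <= pi / 2 ->
  measurable_fun [set: R * R] (fun z => F z.1 z.2) ->
  (forall x y, a < x -> x < y -> y < b -> 0 <= F x y) ->
  (forall x, a < x < b -> integ x b (fun y => tan y * F x y)) ->
  (forall y, a < y < b -> integ a y (fun x => F x y)) ->
  itg a b (fun x => itg x b (fun y => tan y * F x y)) = itg a b (fun y => tan y * itg a y (fun x => F x y)).
Proof.
move=> a0 bp mF F0 i1 i2.
have te x y : a < x -> x < y < b -> tanm y = tan y by move=> ax xy; apply: tanmE; lra.
have := @itg_triangle _ a b (fun x y => tanm y * F x y) (measurable_funM (m2 mtanm) mF).
rewrite (@itg_ext _ a b (fun x => itg x b (fun y => tanm y * F x y)) (fun x => itg x b (fun y => tan y * F x y))); last first.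
  by move=> x xab; apply: itg_ext => y xy; rewrite (te x)//; lra.
rewrite (@itg_ext _ a b (fun y => itg a y (fun x => tanm y * F x y)) (fun y => tan y * itg a y (fun x => F x y))); last first.
  by move=> y yab; rewrite itgZ; [rewrite tanmE//; lra|exact: i2].
apply.
- move=> x y ax xy yb; rewrite (te x)//; last by rewrite xy.
  rewrite mulr_ge0 ?F0// /tan divr_ge0//; first by apply/ltW/sin_pos; lra.
  by apply/ltW/cos_pos; lra.
- by move=> x xab; apply: integ_ext (i1 x xab) => y xy; rewrite (te x)//; lra.
- by move=> y yab; apply: integZ; exact: i2.
Qed.

Lemma triangle_tan_lower a b (F : R -> R -> R) : 0 <= a -> b <= pi / 2 ->
  measurable_fun [set: R * R] (fun z => F z.1 z.2) ->
  (forall x y, a < x -> x < y -> y < b -> 0 <= F x y) ->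
  (forall x, a < x < b -> integ x b (F x)) ->
  (forall y, a < y < b -> integ a y (fun x => tan x * F x y)) ->
  itg a b (fun y => itg a y (fun x => tan x * F x y)) = itg a b (fun x => tan x * itg x b (F x)).
Proof.
move=> a0 bp mF F0 i1 i2.
have te x : a < x < b -> tanm x = tan x by move=> xab; apply: tanmE; lra.
have := @itg_triangle _ a b (fun x y => tanm x * F x y) (measurable_funM (m1 mtanm) mF).
rewrite (@itg_ext _ a b (fun x => itg x b (fun y => tanm x * F x y)) (fun x => tan x * itg x b (F x))); last first.
  by move=> x xab; rewrite itgZ ?te//; exact: i1.
rewrite (@itg_ext _ a b (fun y => itg a y (fun x => tanm x * F x y)) (fun y => itg a y (fun x => tan x * F x y))); last first.
  by move=> y yab; apply: itg_ext => x xy; rewrite te//; lra.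
move=> -> //.
- move=> x y ax xy yb; rewrite te; last by lra.
  rewrite mulr_ge0 ?F0// /tan divr_ge0//; first by apply/ltW/sin_pos; lra.
  by apply/ltW/cos_pos; lra.
- by move=> x xab; apply: integZ; exact: i1.
- by move=> y yab; apply: integ_ext (i2 y yab) => x xy; rewrite te//; lra.
Qed.

(** The radius runs from [1] to [cos b / cos x] along [cos y / cos x], for which
    [d(radius) / radius = - tan y dy]. In [mom_ratio_lower] the denominator moves instead and the
    sign is reversed. *)
Lemma mom_ratio_upper (j : nat) (A : R -> R) (K : R) x b : (forall b, 0 < b < 1 -> dv (mom j) b (K * (A (ln (1 - b ^+ 2)) / b))) ->
  0 < x -> x < b -> b < pi / 2 -> logb x b (fun y => A (log_ratio x y)) ->
  mom j (cos b / cos x) = mom j 1 - K * itg x b (fun y => tan y * A (log_ratio x y)).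
Proof.
move=> dA x0 xb bp lA; have c1 : 0 < cos x by apply: cos_pos; lra.
have lt : logb x b (@tan R) by apply: logb_tan; lra.
have := @FTC_logb _ x b (fun y => - K * (tan y * A (log_ratio x y))) (fun y => mom j (cos y / cos x)) (mom j 1) (mom j (cos b / cos x)) xb.
rewrite itgZ; last by apply: integ_logb; logb_auto.
have e y : x < y < b -> 0 < cos y by move=> yb; apply: cos_pos; lra.
move=> h; suff : - K * itg x b (fun y => tan y * A (log_ratio x y)) = mom j (cos b / cos x) - mom j 1.
  by move: (mom _ _) (mom _ _) (itg _ _ _) => u v w; lra.
have dc y : dv (fun y => cos y / cos x) y (- sin y / cos x) by dv_auto; ring.
apply: h; first by logb_auto.
- move=> y yb; have [r1 r2 r3] := @log_ratioE x y x0 ltac:(lra) ltac:(lra).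
  apply: dv_eq; first exact: (@dv_comp _ (mom j) (fun y => cos y / cos x) y _ _ (dA _ r1) (dc y)).
  rewrite r3 /tan; have := e y yb => cy; field.
  by rewrite !gt_eqF.
- apply: cvg_at_right_filter; rewrite -(divff (lt0r_neq0 c1)).
  apply: (@cvg_compR _ (mom j) (fun y => cos y / cos x)); first exact: dv_cvg (dc x).
  by rewrite divff ?gt_eqF//; apply: cvg_mom; lra.
- apply: cvg_at_left_filter.
  apply: (@cvg_compR _ (mom j) (fun y => cos y / cos x)); first exact: dv_cvg (dc b).
  by have [r1 _ _] := log_ratioE x0 xb bp; apply: cvg_mom; lra.
Qed.

Lemma mom_ratio_lower (j : nat) (A : R -> R) (K : R) a y : (forall b, 0 < b < 1 -> dv (mom j) b (K * (A (ln (1 - b ^+ 2)) / b))) ->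
  0 < a -> a < y -> y < pi / 2 -> logb a y (fun x => A (log_ratio x y)) ->
  mom j (cos y / cos a) = mom j 1 - K * itg a y (fun x => tan x * A (log_ratio x y)).
Proof.
move=> dA a0 ay yp lA; have cy : 0 < cos y by apply: cos_pos; lra.
have ca : 0 < cos a by apply: cos_pos; lra.
have lt : logb a y (@tan R) by apply: logb_tan; lra.
have := @FTC_logb _ a y (fun x => K * (tan x * A (log_ratio x y))) (fun x => mom j (cos y / cos x)) (mom j (cos y / cos a)) (mom j 1) ay.
rewrite itgZ; last by apply: integ_logb; logb_auto.
have e x : a <= x <= y -> 0 < cos x by move=> xb; apply: cos_pos; lra.
move=> h; suff : K * itg a y (fun x => tan x * A (log_ratio x y)) = mom j 1 - mom j (cos y / cos a).
  by move: (mom _ _) (mom _ _) (itg _ _ _) => u v w; lra.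
have dc x : a <= x <= y -> dv (fun x => cos y / cos x) x (cos y * sin x / cos x ^+ 2).
  by move=> /e cx; dv_auto; [rewrite gt_eqF|field; rewrite gt_eqF].
apply: h; first by logb_auto.
- move=> x xb; have xb' : a <= x <= y by lra.
  have [r1 r2 r3] := @log_ratioE x y ltac:(lra) ltac:(lra) yp.
  apply: dv_eq; first exact: (@dv_comp _ (mom j) (fun x => cos y / cos x) x _ _ (dA _ r1) (dc x xb')).
  rewrite r3 /tan; have := e x xb' => cx; field.
  by rewrite !gt_eqF.
- have aa : a <= a <= y by lra.
  apply: cvg_at_right_filter.
  apply: (@cvg_compR _ (mom j) (fun x => cos y / cos x)); first exact: dv_cvg (dc a aa).
  by have [r1 _ _] := log_ratioE a0 ay yp; apply: cvg_mom; lra.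
- have yy : a <= y <= y by lra.
  apply: cvg_at_left_filter; rewrite -(divff (lt0r_neq0 cy)).
  apply: (@cvg_compR _ (mom j) (fun x => cos y / cos x)); first exact: dv_cvg (dc y yy).
  by rewrite divff ?gt_eqF//; apply: cvg_mom; lra.
Qed.

End triangle_integrals.

(** * The third moment at [2 cos x], below and above [pi / 3] *)

Section jensen_integrals.
Context {R : realType}.
Implicit Types (a b c t x y : R).

Lemma fold_half c (f : R -> R) : 0 < c -> logb 0 (2 * c) f ->
  itg 0 (2 * c) f = itg 0 c (fun x => f (c - x) + f (x + c)).
Proof.
move=> c0 lf; have l1 : logb 0 c f by apply: logb_sub lf; lra.
have l2 : logb c (2 * c) f by apply: logb_sub lf; lra.
have r1 := logb_refl c l1; rewrite subrr subr0 in r1.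
have r2 := logb_shift c l2; rewrite subrr (_ : 2 * c - c = c) in r2; last by ring.
have e1 := itg_refl c l1; rewrite subrr subr0 in e1.
have e2 := itg_shift c l2; rewrite subrr (_ : 2 * c - c = c) in e2; last by ring.
by rewrite itgD ?e1 ?e2; [rewrite -itg_split//; [lra|exact: integ_logb]|exact: integ_logb..].
Qed.

(* Means of a function with logarithmic growth again have logarithmic growth,
   because [1 + p + q <= (1 + p) (1 + q)] for [p, q >= 0]. *)
Lemma logb_mean b (h : R -> R) : 0 < b -> logb 0 b h -> logb 0 b (fun x => itg 0 x h / x).
Proof.
move=> b0 lh; have [ch [C [n [C0 hC]]]] := lh.
pose G u : R := (1 + `|ln b|) ^+ n * (1 + `|ln u| + `|ln (1 - u)|) ^+ n.
have ll : logb 0 1 (@ln R) := @logb_ln01 R.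
have ll1 : logb 0 1 (fun u : R => ln (1 - u)) by have := logb_refl 1 ll; rewrite subrr subr0.
have lG : logb 0 1 G.
  by have n1 := logb_norm ll; have n2 := logb_norm ll1; rewrite /G; logb_auto.
have lx : logb 0 b (fun x => (1 + `|ln x|) ^+ n).
  have h1 : logb 0 b (@ln R).
    apply: (@logb_ln R 0 b (fun x => x) b b^-1); first by rewrite invr_gt0.
      by move=> x _; exact: dv_cvg (dv_id x).
    move=> x xb; apply/andP; split; last lra.
    have b1 : b^-1 * (b - x) <= 1 by rewrite ler_pdivrMl// mulr1; lra.
    rewrite subr0 (_ : b^-1 * x * (b - x) = x * (b^-1 * (b - x))); last by ring.
    by rewrite ler_piMr//; lra.
  by have n1 := logb_norm h1; logb_auto.
apply: (@logb_le _ _ _ _ (fun x => C * itg 0 1 G * (1 + `|ln x|) ^+ n)); last by logb_auto.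
  move=> x xb; have d1 := dv_prim_logb xb lh.
  have c1 : y^-1 @[y --> x] --> x^-1 by cvg_auto; rewrite gt_eqF//; lra.
  exact: cvgM (dv_cvg d1) c1.
move=> x xb; have x0 : 0 < x by lra.
have lhx : logb 0 x h by apply: logb_sub lh; lra.
have lhs : logb 0 1 (fun u => h (x * u)) by apply: logb_scale => //; rewrite mulr0 mulr1.
have -> : itg 0 x h / x = itg 0 1 (fun u => h (x * u)).
  by rewrite itg_scale ?mulr0 ?mulr1//; exact: mulrC.
have lGx : logb 0 1 (fun u => C * (1 + `|ln x|) ^+ n * G u) by logb_auto.
apply: le_trans (itg_norm (integ_logb lhs)) _.
have -> : C * itg 0 1 G * (1 + `|ln x|) ^+ n = itg 0 1 (fun u => C * (1 + `|ln x|) ^+ n * G u).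
  by rewrite itgZ; [ring|exact: integ_logb].
apply: le_itg; [exact/integ_norm/integ_logb|exact: integ_logb|move=> u u1].
have xu : 0 < x * u < b.
  have h1 : x * u < x * 1 by rewrite ltr_pM2l//; lra.
  by rewrite mulr_gt0//; lra.
apply: le_trans (hC _ xu) _; rewrite -mulrA ler_wpM2l// /G mulrA -!exprMn.
apply: lerXn2r; rewrite ?nnegrE ?logw_ge0 ?mulr_ge0 ?addr_ge0//.
have l1 : `|ln (x * u - 0)| <= `|ln x| + `|ln u|.
  by rewrite subr0 lnM ?posrE//; [exact: ler_normD|lra].
have l2 : `|ln (b - x * u)| <= `|ln b| + `|ln (1 - u)|.
  have v1 : b * (1 - u) <= b - x * u.
    have : x * u <= b * u by rewrite ler_pM2r; lra.
    by lra.
  have v0 : 0 < b * (1 - u) by rewrite mulr_gt0//; lra.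
  have w1 : ln (b * (1 - u)) <= ln (b - x * u) by rewrite ler_ln ?posrE//; lra.
  have w2 : ln (b - x * u) <= ln b by rewrite ler_ln ?posrE//; lra.
  rewrite lnM ?posrE in w1; [|lra..].
  have z1 := ler_norm (ln b); have z2 := ler_norm (- ln b); have z3 := ler_norm (- ln (1 - u)).
  have z4 := normr_ge0 (ln (1 - u)); rewrite !normrN in z2 z3.
  by rewrite ler_norml; lra.
rewrite /logw; move: l1 l2 (normr_ge0 (ln x)) (normr_ge0 (ln u)) (normr_ge0 (ln b)) (normr_ge0 (ln (1 - u))).
move: `|ln (x * u - 0)| `|ln (b - x * u)| `|ln x| `|ln u| `|ln b| `|ln (1 - u)| => p q r s t v l1 l2 r0 s0 t0 v0.
have := mulr_ge0 r0 s0; have := mulr_ge0 r0 v0; have := mulr_ge0 t0 s0; have := mulr_ge0 t0 v0; have tr := mulr_ge0 t0 r0.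
have := mulr_ge0 tr s0; have := mulr_ge0 tr v0.
rewrite (_ : (1 + r) * (1 + t) * (1 + s + v) =
  1 + r + t + s + v + r * s + r * v + t * s + t * v + t * r + t * r * s + t * r * v); last by ring.
by lra.
Qed.

(** The product is [x cot x], which is bounded, times the mean of [h]. *)
Lemma logb_cot_prim b (h : R -> R) : 0 < b < pi -> logb 0 b h ->
  logb 0 b (fun x => cos x / sin x * itg 0 x h).
Proof.
move=> bp lh; have l1 := logb_mean (_ : 0 < b) lh.
have l2 : logb 0 b (fun x => x * (cos x / sin x)).
  apply: (@logb_mul_cot _ b (fun x => x) 1); first by [].
    by move=> x _; exact: cvg_id.
  by move=> x xb; rewrite mul1r ger0_norm//; lra.
have {}l1 := l1 ltac:(lra); apply: logb_ext (logbM l2 l1) => x xb.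
have s0 : 0 < sin x by apply: sin_pos; lra.
by field; rewrite !gt_eqF//; lra.
Qed.

(** The densities [h1], [h2] and [g2] are the derivatives in [c] of the integrals over [[0, c]] of
    [lcos x * S], [S ^+ 2] and [S], where [S = lsin (c - x) + lsin (x + c)]. *)
Let h1 t : R := 2 * lcos t * lsin (2 * t) + t ^+ 2.
Let h2 t : R := 4 * lsin (2 * t) ^+ 2 + 4 * t ^+ 2 - pi ^+ 2 / 3.
Let g2 t : R := 2 * lsin (2 * t).

Let lh c : 0 < c < pi / 2 -> [/\ logb 0 c h1, logb 0 c h2, logb 0 c g2 & logb 0 c (@lcos R)].
Proof.
move=> cp; have l1 := lsin2_logb cp; have l2 : logb 0 c (@lcos R) by apply: lcos_logb; lra.
by split=> //; rewrite /h1 /h2 /g2; logb_auto.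
Qed.

Lemma logb_lsin_sum c : 0 < c < pi / 2 -> logb 0 c (fun x => lsin (c - x)) /\ logb 0 c (fun x => lsin (x + c)).
Proof.
move=> cp; split; first by apply: logb_lsinBl; lra.
by apply: (@logb_ext _ _ _ (fun x => lsin (c + x))); [move=> x _; rewrite addrC|apply: logb_lsinDr; lra].
Qed.

Lemma itg_lsin_sum c : 0 < c < pi / 2 ->
  itg 0 c (fun x => lsin (c - x) + lsin (x + c)) = itg 0 c g2.
Proof.
move=> cp; have ls : logb 0 (2 * c) (@lsin R) by apply: lsin_logb; lra.
rewrite -(@fold_half c lsin)//; last by lra.
have l0 : logb (2 * 0) (2 * c) (@lsin R) by rewrite mulr0.
rewrite /g2 itgZ; last exact/integ_logb/lsin2_logb.
by rewrite (itg_scale _ l0)// mulr0 mulVKf.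
Qed.

Lemma itg_lcos_lsin_sum c : 0 < c < pi / 2 ->
  itg 0 c (fun x => lcos x * (lsin (c - x) + lsin (x + c))) = itg 0 c h1.
Proof.
move=> cp; rewrite -conv_lcos// /conv fold_half; [|lra|].
  by apply: itg_ext => x _; rewrite addrK (_ : c - x - c = - x) ?lcosN; ring.
have ls : logb 0 (2 * c) (@lsin R) by apply: lsin_logb; lra.
have lc : logb 0 (2 * c) (fun w => lcos (w - c)).
  have := logb_shift (- c) (@lcos_logb R (- c) c ltac:(lra) ltac:(lra)).
  by rewrite opprK addNr (_ : c + c = 2 * c); last by ring.
exact: logbM.
Qed.

(** With [p] and [q] for the two summands, [(p + q)^2 = 2 (p^2 + q^2) - (p - q)^2]. The squares fold
    to [[0, 2 c]], and the squared difference is [Bk 2 (2 c)] by the polar substitution, a cubic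
    polynomial. *)
Lemma itg_lsin_sum_sqr c : 0 < c < pi / 2 ->
  itg 0 c (fun x => (lsin (c - x) + lsin (x + c)) ^+ 2) = itg 0 c h2.
Proof.
move=> cp; have [lm lp] := logb_lsin_sum cp; have l2 := lsin2_logb cp.
have ls : logb 0 (2 * c) (@lsin R) by apply: lsin_logb; lra.
have e1 : itg 0 c (fun x => lsin (c - x) ^+ 2 + lsin (x + c) ^+ 2) = 2 * itg 0 c (fun t => lsin (2 * t) ^+ 2).
  rewrite -(@fold_half c (fun x => lsin x ^+ 2)); [|lra|by logb_auto].
  have l0 : logb (2 * 0) (2 * c) (fun x : R => lsin x ^+ 2) by rewrite mulr0; logb_auto.
  by rewrite (itg_scale _ l0)// mulr0 mulVKf.
have e2 : itg 0 c (fun x => (lsin (c - x) - lsin (x + c)) ^+ 2) = Bk 2 (2 * c).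
  have sp : 0 < 2 * c < pi by lra.
  have s2 : 2 * c / 2 = c by field.
  have lz := logb_lsin_refl sp; rewrite s2 in lz.
  have lc : logb 0 c (@lsin R) by apply: lsin_logb; lra.
  have lg : logb 0 c (fun t => (lsin t - lsin (2 * c - t)) ^+ 2) by logb_auto.
  have := @itg_polar _ _ (fun t => (lsin t - lsin (2 * c - t)) ^+ 2) (fun r => ln r ^+ 2) sp (@logb_Bk _ 2 _ isT).
  rewrite s2 -/(Bk 2 (2 * c)) => <- //; last by move=> t tc; rewrite ln_polar// s2.
  have := itg_refl c lg; rewrite subrr subr0 => <-; apply: itg_ext => x _.
  by rewrite (_ : 2 * c - (c - x) = x + c); last by ring.
have e3 : itg 0 c (fun t => 4 * t ^+ 2 - pi ^+ 2 / 3) = - Bk 2 (2 * c).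
  rewrite B2E; last by lra.
  rewrite (@FTC_logb _ _ _ _ (fun t => 4 / 3 * t ^+ 3 - pi ^+ 2 / 3 * t) 0 (4 / 3 * c ^+ 3 - pi ^+ 2 / 3 * c)) ?subr0; [by field|lra|by logb_auto| | |].
  - by move=> x _; dv_auto; rewrite /=; field.
  - by apply: cvg_at_right_filter; cvg_auto; rewrite expr0n /= !mulr0 subr0.
  - by apply: cvg_at_left_filter; cvg_auto.
transitivity (itg 0 c (fun x => 2 * (lsin (c - x) ^+ 2 + lsin (x + c) ^+ 2) - (lsin (c - x) - lsin (x + c)) ^+ 2)).
  by apply: itg_ext => x _; ring.
rewrite itgB; [|by apply: integ_logb; logb_auto..].
rewrite itgZ; last by apply: integ_logb; logb_auto.
rewrite e1 e2 -e3 mulrA -itgZ; last by apply: integ_logb; logb_auto.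
rewrite -itgD; [|by apply: integ_logb; logb_auto..].
by apply: itg_ext => t _; rewrite /h2; ring.
Qed.

Lemma itg_lcos_ratio y : 0 < y < pi / 2 ->
  itg 0 y (fun x => lcos x * log_ratio x y) = itg 0 y h1 - 2 * itg 0 y (fun t => lcos t ^+ 2).
Proof.
move=> yp; have [lm lp] := logb_lsin_sum yp; have [_ _ _ lc] := lh yp.
rewrite -itg_lcos_lsin_sum// -itgZ; last by apply: integ_logb; logb_auto.
rewrite -itgB; [|by apply: integ_logb; logb_auto..].
by apply: itg_ext => x _; rewrite /log_ratio; ring.
Qed.

Lemma itg_ratio_sqr y : 0 < y < pi / 2 ->
  itg 0 y (fun x => log_ratio x y ^+ 2) = itg 0 y h2 - 4 * itg 0 y h1 + 4 * itg 0 y (fun t => lcos t ^+ 2).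
Proof.
move=> yp; have [lm lp] := logb_lsin_sum yp; have [_ _ _ lc] := lh yp.
rewrite -itg_lcos_lsin_sum// -itg_lsin_sum_sqr//.
rewrite -!itgZ; [|by apply: integ_logb; logb_auto..].
rewrite -itgB; [|by apply: integ_logb; logb_auto..].
rewrite -itgD; [|by apply: integ_logb; logb_auto..].
by apply: itg_ext => x _; rewrite /log_ratio; ring.
Qed.

(** Here [2 cos x > 1], so Jensen's formula passes to the inverse radius [cos (pi / 3) / cos x].
    After the exchange of order the inner integrals are primitives of [h1], [h2] and [lcos ^+ 2],
    and [tan] is integrated by parts as minus the derivative of [lcos]. *)
Lemma mom3_low : itg 0 (pi / 3) (fun x : R => mom 3 (2 * cos x)) =
  pi * itg 0 (pi / 3) (fun x => lcos x ^+ 3) + pi ^+ 3 / 4 * itg 0 (pi / 3) lcos + pi / 3 * mom 3 1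
  + pi / 2 * itg 0 (pi / 3) (fun x => lcos x * (3 * h2 x - 6 * h1 x)).
Proof.
have pp := @pi_gt0 R; have c3 := @cos_pi3 R.
pose J (A : R -> R) x := itg x (pi / 3) (fun y => tan y * A (log_ratio x y)).
have p3 : 0 < (pi / 3 : R) < pi / 2 by lra.
have [lh1 lh2 _ lc] := lh p3.
have lc2 : logb 0 (pi / 3) (fun t : R => lcos t ^+ 2) by logb_auto.
have lr x : 0 < x -> logb x (pi / 3) (log_ratio x) by move=> x0; apply: logb_ratio_r; lra.
have lt x : 0 <= x -> logb x (pi / 3) (@tan R) by move=> x0; apply: logb_tan; lra.
have inv x : 0 < x < pi / 3 -> [/\ 1 < 2 * cos x < 2, (2 * cos x)^-1 = cos (pi / 3) / cos x & 0 < cos x].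
  move=> xp; have c0 : 0 < cos x by apply: cos_pos; lra.
  have k1 : cos (pi / 3) < cos x by rewrite ltr_cos ?in_itv/=; lra.
  have k2 : cos x < cos 0 by rewrite ltr_cos ?in_itv/=; lra.
  rewrite cos0 c3 in k1 k2; split=> //; first by lra.
  by rewrite c3; field; rewrite gt_eqF.
have eJ2 x : 0 < x < pi / 3 -> mom 2 (2 * cos x)^-1 = pi ^+ 3 / 12 + pi * J id x.
  move=> xp; have [_ -> _] := inv x xp.
  rewrite (@mom_ratio_upper _ 2 id (- pi) _ _ (@dv_mom2 R)); [rewrite mom2_1 /J; ring|lra|lra|lra|].
  by apply: lr; lra.
have eJ3 x : 0 < x < pi / 3 -> mom 3 (2 * cos x)^-1 = mom 3 1 + 3 * pi / 2 * J (fun y => y ^+ 2) x.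
  move=> xp; have [_ -> _] := inv x xp.
  rewrite (@mom_ratio_upper _ 3 (fun y => y ^+ 2) (- (3 * pi / 2)) _ _ (@dv_mom3 R)); [rewrite /J; ring|lra|lra|lra|].
  by apply/logbX/lr; lra.
have lm n : logb 0 (pi / 3) (fun x : R => mom n (2 * cos x)^-1).
  apply: (@logb_mom_comp _ 0 (pi / 3) n (fun x => (2 * cos x)^-1)) => x xp; have [k1 _ k2] := inv x xp.
    by cvg_auto; rewrite gt_eqF//; lra.
  have i1 : (2 * cos x)^-1 < 1 by rewrite invf_lt1; lra.
  have i0 : 0 < (2 * cos x)^-1 by rewrite invr_gt0; lra.
  by lra.
have lJ2 : logb 0 (pi / 3) (J id).
  have k2 := lm 2%N; apply: (@logb_ext _ _ _ (fun x => pi^-1 * (mom 2 (2 * cos x)^-1 - pi ^+ 3 / 12))); last by logb_auto.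
  by move=> x xp; rewrite eJ2//; move: (J _ _) => z; gen_pi; fld.
have lJ3 : logb 0 (pi / 3) (J (fun y => y ^+ 2)).
  have k3 := lm 3%N; apply: (@logb_ext _ _ _ (fun x => (3 * pi / 2)^-1 * (mom 3 (2 * cos x)^-1 - mom 3 1))); last by logb_auto.
  by move=> x xp; rewrite eJ3//; move: (J _ _) (mom _ _) => z w; gen_pi; fld.
have e x : 0 < x < pi / 3 -> mom 3 (2 * cos x) =
   pi * lcos x ^+ 3 + pi ^+ 3 / 4 * lcos x + mom 3 1 + 3 * pi * (lcos x * J id x) + 3 * pi / 2 * J (fun y => y ^+ 2) x.
  move=> xp; have [k1 _ _] := inv x xp.
  by rewrite mom3_gt1// eJ2// eJ3// -/(lcos x); field.
have lt0 := lt 0 (lexx _).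
have P1 := logb_prim (integ_logb lh1); have P2 := logb_prim (integ_logb lh2); have P3 := logb_prim (integ_logb lc2).
have t2 : itg 0 (pi / 3) (J (fun y => y ^+ 2)) =
    itg 0 (pi / 3) (fun y => tan y * (itg 0 y h2 - 4 * itg 0 y h1 + 4 * itg 0 y (fun t => lcos t ^+ 2))).
  rewrite (@triangle_tan_upper _ 0 (pi / 3) (fun x y => log_ratio x y ^+ 2)); last first.
  - by move=> y yp; apply/integ_logb/logbX/logb_ratio_l; lra.
  - by move=> x xp; have k1 := lr x ltac:(lra); have k2 := lt x ltac:(lra); apply: integ_logb; logb_auto.
  - by move=> x y _ _ _; exact: sqr_ge0.
  - exact: measurable_funX measurable_log_ratio.
  - by lra.
  - by [].
  by apply: itg_ext => y yp; rewrite itg_ratio_sqr//; lra.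
have t1 : itg 0 (pi / 3) (fun x => lcos x * J id x) =
    itg 0 (pi / 3) (fun y => tan y * (itg 0 y h1 - 2 * itg 0 y (fun t => lcos t ^+ 2))).
  (* The exchange is for nonnegative integrands: below [pi / 3] one has [lcos >= 0] and
     [log_ratio <= 0], so the sign is flipped first. *)
  apply: oppr_inj; rewrite -!itgN; [|by apply: integ_logb; logb_auto..].
  transitivity (itg 0 (pi / 3) (fun x => itg x (pi / 3) (fun y => tan y * - (lcos x * log_ratio x y)))).
    apply: itg_ext => x xp; rewrite /J -mulNr -itgZ.
      by apply: itg_ext => y _; rewrite /=; ring.
    by have k1 := lr x ltac:(lra); have k2 := lt x ltac:(lra); apply: integ_logb; logb_auto.
  have il y : 0 < y < pi / 3 -> integ 0 y (fun x => lcos x * log_ratio x y).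
    move=> yp; have k1 : logb 0 y (fun x => log_ratio x y) by apply: logb_ratio_l; lra.
    by have k2 : logb 0 y (@lcos R) by [apply: lcos_logb; lra]; apply: integ_logb; logb_auto.
  rewrite (@triangle_tan_upper _ 0 (pi / 3) (fun x y => - (lcos x * log_ratio x y))); last first.
  - by move=> y yp; apply: integN; exact: il.
  - by move=> x xp; have k1 := lr x ltac:(lra); have k2 := lt x ltac:(lra); apply: integ_logb; logb_auto.
  - move=> x y x0 xy yp; rewrite -mulrN mulr_ge0//; last by rewrite oppr_ge0 log_ratio_le0//; lra.
    by have [k _ _] := inv x ltac:(lra); apply: ln_ge0; lra.
  - exact: measurable_neg_lcos_ratio.
  - by lra.
  - by [].
  by apply: itg_ext => y yp; rewrite itgN ?itg_lcos_ratio; [ring|lra|exact: il].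
have lth : logb 0 (pi / 3) (fun x : R => 3 * h2 x - 6 * h1 x) by logb_auto.
(* The weights [3] and [6] are those of the two triangle terms; with them the integrals of
   [lcos ^+ 2] cancel. The boundary term at [pi / 3] vanishes because [lcos (pi / 3) = 0]. *)
have ibp : itg 0 (pi / 3) (fun x => lcos x * (3 * h2 x - 6 * h1 x)) =
    3 * itg 0 (pi / 3) (J (fun y => y ^+ 2)) + 6 * itg 0 (pi / 3) (fun x => lcos x * J id x).
  have Pt := logb_prim (integ_logb lth).
  transitivity (itg 0 (pi / 3) (fun y => tan y * itg 0 y (fun x => 3 * h2 x - 6 * h1 x))).
    apply/eqP; rewrite -subr_eq0 -itgB; [|by apply: integ_logb; logb_auto..]; apply/eqP.
    rewrite (@FTC_logb _ _ _ _ (fun y => lcos y * itg 0 y (fun x => 3 * h2 x - 6 * h1 x)) 0 0) ?subrr//; first by lra.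
    - by logb_auto.
    - move=> x xp; have d1 := dv_prim_logb xp lth; have d2 : dv lcos x (- tan x) by apply: dv_lcos0; lra.
      by apply: dv_eq (dvM d2 d1) _; ring.
    - by apply: (@logb_mul_prim0 _ 0 (pi / 3) lcos (fun x => 3 * h2 x - 6 * h1 x)) => //; lra.
    - have k1 : itg 0 y (fun x : R => 3 * h2 x - 6 * h1 x) @[y --> (pi / 3)^'-] --> itg 0 (pi / 3) (fun x : R => 3 * h2 x - 6 * h1 x).
        by apply: prim_left; [lra|exact: integ_logb].
      have k2 : lcos y @[y --> (pi / 3 : R)] --> lcos (pi / 3 : R) by cvg_auto; lra.
      have k3 : lcos y * itg 0 y (fun x => 3 * h2 x - 6 * h1 x) @[y --> (pi / 3)^'-] -->
          lcos (pi / 3) * itg 0 (pi / 3) (fun x => 3 * h2 x - 6 * h1 x) := cvgM (cvg_at_left_filter k2) k1.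
      by rewrite lcos_pi3 mul0r in k3; exact: (k3 ltac:(typeclasses eauto)).
  rewrite t1 t2 -!itgZ; [|by apply: integ_logb; logb_auto..].
  rewrite -itgD; [|by apply: integ_logb; logb_auto..].
  apply: itg_ext => y yp.
  have k1 : logb 0 y h1 by apply: logb_sub lh1; lra.
  have k2 : logb 0 y h2 by apply: logb_sub lh2; lra.
  by rewrite itgB ?itgZ; [ring|exact: integ_logb|exact: integ_logb|by apply: integ_logb; logb_auto..].
rewrite (itg_ext e).
rewrite itgD; [|by apply: integ_logb; logb_auto..].
rewrite itgD; [|by apply: integ_logb; logb_auto..].
rewrite itgD; [|by apply: integ_logb; logb_auto..].
rewrite itgD; [|by apply: integ_logb; logb_auto..].
rewrite itg_cst; last by lra.
rewrite ibp (@itgZ _ _ _ pi (fun x => lcos x ^+ 3)); last by apply: integ_logb; logb_auto.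
rewrite (@itgZ _ _ _ (pi ^+ 3 / 4) lcos); last exact: integ_logb.
rewrite (@itgZ _ _ _ (3 * pi) (fun x => lcos x * J id x)); last by apply: integ_logb; logb_auto.
rewrite (@itgZ _ _ _ (3 * pi / 2) (J (fun y => y ^+ 2))); last exact: integ_logb.
by field.
Qed.

(** Here [2 cos y < 1], and the ratio formula applies directly with [cos (pi / 3)] as denominator.
    The complement [x -> pi / 2 - x] moves everything to [[0, pi / 6]], where the cotangent is
    integrated by parts as the derivative of [lsin]. *)
Lemma mom3_high : itg (pi / 3) (pi / 2) (fun x : R => mom 3 (2 * cos x)) =
  pi / 6 * mom 3 1 + pi / 2 * itg 0 (pi / 6) (fun x => 4 * lcos x ^+ 3 - 4 * lsin (2 * x) ^+ 3 + (pi ^+ 2 - 12 * x ^+ 2) * lsin x).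
Proof.
have pp := @pi_gt0 R; have c3 := @cos_pi3 R.
have p6 : 0 < (pi / 6 : R) < pi / 2 by lra.
have [_ lh2 lg2 lc] := lh p6; have ls : logb 0 (pi / 6) (@lsin R) by apply: lsin_logb; lra.
have l2 := lsin2_logb p6.
pose J y := itg (pi / 3) y (fun x => tan x * log_ratio x y ^+ 2).
have eJ y : pi / 3 < y < pi / 2 -> mom 3 (2 * cos y) = mom 3 1 + 3 * pi / 2 * J y.
  move=> yp; rewrite (_ : 2 * cos y = cos y / cos (pi / 3)); last by rewrite c3; field.
  rewrite (@mom_ratio_lower _ 3 (fun y => y ^+ 2) (- (3 * pi / 2)) _ _ (@dv_mom3 R)); [rewrite /J; ring|lra|lra|lra|].
  by apply/logbX/logb_ratio_l; lra.
have lm := @logb_mom_cos R (pi / 3) (pi / 2) 3 ltac:(lra) ltac:(lra).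
have lJ : logb (pi / 3) (pi / 2) J.
  apply: (@logb_ext _ _ _ (fun x => (3 * pi / 2)^-1 * (mom 3 (2 * cos x) - mom 3 1))); last by logb_auto.
  by move=> x xp; rewrite eJ//; move: (J _) (mom _ _) => z w; gen_pi; fld.
rewrite (itg_ext eJ) itgD; [|exact: integ_cst|by apply: integ_logb; logb_auto].
rewrite itg_cst ?itgZ; [|exact: integ_logb|lra].
(* After the complement [log_ratio] is [S - 2 lsin x], with [S] the symmetric sum of the densities
   above; [tau] is the integral of its square, expanded term by term. *)
pose tau x := itg 0 x h2 - 4 * lsin x * itg 0 x g2 + 4 * lsin x ^+ 2 * itg 0 x (fun=> 1).
have l1 : logb 0 (pi / 6) (fun=> 1 : R) by exact: logb_cst.
have q6 : 0 < (pi / 6 : R) < pi by lra.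
have C1 := logb_cot_prim q6 lh2; have C2 := logb_cot_prim q6 lg2; have C3 := logb_cot_prim q6 l1.
have lct : logb 0 (pi / 6) (fun x => cos x / sin x * tau x).
  apply: (@logb_ext _ _ _ (fun x => cos x / sin x * itg 0 x h2 - 4 * lsin x * (cos x / sin x * itg 0 x g2)
     + 4 * lsin x ^+ 2 * (cos x / sin x * itg 0 x (fun=> 1)))); last by logb_auto.
  by move=> x _; rewrite /tau; ring.
have tauE x : 0 < x < pi / 6 ->
    itg (pi / 2 - x) (pi / 2) (fun y => log_ratio (pi / 2 - x) y ^+ 2) = tau x.
  move=> xp; have xp' : 0 < x < pi / 2 by lra.
  have [k1 k2] := logb_lsin_sum xp'; have lr := @logb_ratio_r R (pi / 2 - x) (pi / 2) ltac:(lra) (lexx _).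
  have := itg_refl (pi / 2) (logbX 2 lr); rewrite subrr subKr => <-.
  have -> : tau x = itg 0 x (fun y => (lsin (x - y) + lsin (y + x)) ^+ 2) - 4 * lsin x * itg 0 x (fun y => lsin (x - y) + lsin (y + x))
      + 4 * lsin x ^+ 2 * itg 0 x (fun=> 1) by rewrite itg_lsin_sum_sqr// itg_lsin_sum.
  rewrite -!itgZ; [|exact: integ_cst|by apply: integ_logb; logb_auto].
  rewrite -itgB; [|by apply: integ_logb; logb_auto..].
  rewrite -itgD; [|by apply: integ_logb; logb_auto..].
  apply: itg_ext => y _; rewrite /log_ratio lcosB_pihalf.
  rewrite (_ : pi / 2 - y - (pi / 2 - x) = x - y); last by ring.
  rewrite (_ : pi / 2 - x + (pi / 2 - y) = pi - (y + x)); last by field.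
  by rewrite lsinBpi; ring.
have -> : itg (pi / 3) (pi / 2) J = itg 0 (pi / 6) (fun x => cos x / sin x * tau x).
  rewrite (@triangle_tan_lower _ (pi / 3) (pi / 2) (fun x y => log_ratio x y ^+ 2)); last first.
  - move=> y yp; have k1 : logb (pi / 3) y (@tan R) by apply: logb_tan; lra.
    have k2 : logb (pi / 3) y (fun x => log_ratio x y) by apply: logb_ratio_l; lra.
    by apply: integ_logb; logb_auto.
  - by move=> x xp; apply/integ_logb/logbX/logb_ratio_r; lra.
  - by move=> x y _ _ _; exact: sqr_ge0.
  - exact: measurable_funX measurable_log_ratio.
  - by [].
  - by lra.
  have := itg_refl (pi / 2) lct; rewrite subr0 (_ : pi / 2 - pi / 6 = pi / 3); last by field.
  move=> <-; apply: itg_ext => x xp; rewrite -tauE; last by lra.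
  by rewrite subKr /tan cosB sinB sin_pihalf cos_pihalf !mul1r !mul0r subr0 add0r.
suff -> : itg 0 (pi / 6) (fun x => cos x / sin x * tau x) = 1 / 3 * itg 0 (pi / 6) (fun x => 4 * lcos x ^+ 3 - 4 * lsin (2 * x) ^+ 3 + (pi ^+ 2 - 12 * x ^+ 2) * lsin x).
  by field.
rewrite -itgZ; last by apply: integ_logb; logb_auto.
apply/eqP; rewrite -subr_eq0 -itgB; [|by apply: integ_logb; logb_auto..]; apply/eqP.
(* The coefficients [1], [2] and [4 / 3] integrate the powers of [lsin] against [cot]. The leftover
   terms, with a density in place of its primitive, form the right-hand integrand. *)
rewrite (@FTC_logb _ _ _ _ (fun x => lsin x * itg 0 x h2 - 2 * lsin x ^+ 2 * itg 0 x g2 + 4 / 3 * lsin x ^+ 3 * itg 0 x (fun=> 1)) 0 0) ?subrr//.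
- by lra.
- by logb_auto.
- move=> x xp; have d1 := dv_prim_logb xp lh2; have d2 := dv_prim_logb xp lg2; have d3 := dv_prim_logb xp l1.
  have d0 : dv lsin x (cos x / sin x) by apply: dv_lsin0; lra.
  apply: dv_eq; first exact: dvD (dvD (dvM d0 d1) (dvN (dvM (dvM (dv_cst 2 x) (dvX 2 d0)) d2))) (dvM (dvM (dv_cst (4 / 3) x) (dvX 3 d0)) d3).
  rewrite /tau /h2 /g2 /= lsin_double; last by lra.
  by field; rewrite gt_eqF// sin_pos//; lra.
- rewrite -[X in _ --> X](_ : 0 - 0 + 0 = 0); last by rewrite subr0 addr0.
  have m1 : logb 0 (pi / 6) (fun x : R => 2 * lsin x ^+ 2) by logb_auto.
  have m2 : logb 0 (pi / 6) (fun x : R => 4 / 3 * lsin x ^+ 3) by logb_auto.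
  apply: cvgD; first apply: cvgB.
  + by apply: (@logb_mul_prim0 _ 0 (pi / 6) lsin h2) => //; lra.
  + by apply: (@logb_mul_prim0 _ 0 (pi / 6) (fun x => 2 * lsin x ^+ 2) g2) => //; lra.
  + by apply: (@logb_mul_prim0 _ 0 (pi / 6) (fun x => 4 / 3 * lsin x ^+ 3) (fun=> 1)) => //; lra.
(* Every term carries a positive power of [lsin], which is [0] at [pi / 6]. *)
- have pl K n (h : R -> R) : logb 0 (pi / 6) h -> K * lsin y ^+ n.+1 * itg 0 y h @[y --> (pi / 6)^'-] --> (0 : R).
    move=> l; have k1 : itg 0 y h @[y --> (pi / 6)^'-] --> itg 0 (pi / 6) h.
      by apply: prim_left; [lra|exact: integ_logb].
    have k2 : K * lsin y ^+ n.+1 @[y --> (pi / 6 : R)] --> (0 : R).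
      by cvg_auto; rewrite lsin_pi6 expr0n mulr0.
    have k3 : K * lsin y ^+ n.+1 * itg 0 y h @[y --> (pi / 6)^'-] --> 0 * itg 0 (pi / 6) h := cvgM (cvg_at_left_filter k2) k1.
    by rewrite mul0r in k3; exact: (k3 ltac:(typeclasses eauto)).
  have k0 := pl 1 0%N _ lh2; rewrite -[X in _ --> X](_ : 0 - 0 + 0 = 0); last by rewrite subr0 addr0.
  apply: cvgD; first apply: cvgB; [|exact: pl lg2|exact: pl l1].
  apply: cvg_trans k0; apply: near_eq_cvg; near=> x.
  by rewrite mul1r expr1.
Unshelve. all: end_near. Qed.

End jensen_integrals.

(** * Assembly of the linear relations *)

Section final.
Context {R : realType}.
Implicit Types (a b c t x y : R).

(** Complements and doubling express each cubic integral through [P], [q] and the full integral [z]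
    over [[0, pi / 2]], which is a multiple of [pi zeta(3)]; the lower-order parts combine into two
    quadratic moments. *)
Lemma mahler_lsin (P := itg 0 (pi / 3) (fun t : R => lsin t ^+ 3))
    (q := itg 0 (pi / 6) (fun t : R => lsin t ^+ 3)) :
  pi * higher_mahler 3 (fun x y : R[i]%C => 1 + x + y) =
    - 12 * P + 2 * q - 6 * pi * zeta (3 : R)
    + itg 0 (pi / 3) (fun x => (- (pi ^+ 2 / 2) + 0 * x + 6 * x ^+ 2) * lcos x)
    + itg 0 (pi / 6) (fun x => (pi ^+ 2 + 0 * x + - 12 * x ^+ 2) * lsin x).
Proof.
have pp := @pi_gt0 R.
pose L3 a b := itg a b (fun t : R => lcos t ^+ 3); pose z := itg 0 (pi / 2) (fun t : R => lcos t ^+ 3).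
have ls0 : logb 0 pi (@lsin R) by exact: lsin_logb.
have lc0 : logb 0 (pi / 2) (@lcos R) by apply: lcos_logb; lra.
have ls3 : logb 0 (pi / 3) (@lsin R) by apply: lsin_logb; lra.
have ls6 : logb 0 (pi / 6) (@lsin R) by apply: lsin_logb; lra.
have lc3 : logb 0 (pi / 3) (@lcos R) by apply: lcos_logb; lra.
have lc6 : logb 0 (pi / 6) (@lcos R) by apply: lcos_logb; lra.
have ls3c : logb 0 pi (fun t : R => lsin t ^+ 3) by logb_auto.
have lc3c : logb 0 (pi / 2) (fun t : R => lcos t ^+ 3) by logb_auto.
have p3 : 0 < (pi / 3 : R) < pi / 2 by lra.
have p6 : 0 < (pi / 6 : R) < pi / 2 by lra.
have l23 := lsin2_logb p3; have l26 := lsin2_logb p6.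
have comp c : 0 <= c <= pi / 2 -> itg 0 c (fun t : R => lcos t ^+ 3) = z - itg 0 (pi / 2 - c) (fun t : R => lsin t ^+ 3).
  move=> cp; have l : logb c (pi / 2) (fun t : R => lcos t ^+ 3) by apply: logb_sub lc3c; clear -pp cp; lra.
  have := itg_refl (pi / 2) l; rewrite subrr (@itg_ext _ _ _ _ (fun t : R => lsin t ^+ 3)); last first.
    by move=> x _; rewrite lcosB_pihalf.
  by move=> ->; rewrite /z (itg_split cp (integ_logb lc3c)) addrK.
have cP : itg 0 (pi / 6) (fun t : R => lcos t ^+ 3) = z - P.
  by rewrite comp; [rewrite (_ : pi / 2 - pi / 6 = pi / 3)//; field|lra].
have cq : itg 0 (pi / 3) (fun t : R => lcos t ^+ 3) = z - q.
  by rewrite comp; [rewrite (_ : pi / 2 - pi / 3 = pi / 6)//; field|lra].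
have zE : itg 0 (pi / 2) (fun t : R => lsin t ^+ 3) = z.
  have c0 := comp 0 ltac:(clear -pp; lra); rewrite itg_nil// subr0 in c0.
  by apply/eqP; rewrite eq_sym -subr_eq0 -c0.
(* Symmetry about [pi / 2] makes the integral over [[0, pi]] equal to [2 z]; the missing piece
   beyond [2 pi / 3] is a reflected copy of [P]. *)
have r23 : itg 0 (2 * pi / 3) (fun t : R => lsin t ^+ 3) = 2 * z - P.
  have half a : 0 <= a <= pi -> itg a pi (fun t : R => lsin t ^+ 3) = itg 0 (pi - a) (fun t : R => lsin t ^+ 3).
    move=> ap; have l : logb a pi (fun t : R => lsin t ^+ 3) by apply: logb_sub ls3c; clear -pp ap; lra.
    by have := itg_refl pi l; rewrite subrr => <-; apply: itg_ext => x _; rewrite lsinBpi.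
  have s1 : itg 0 pi (fun t : R => lsin t ^+ 3) = 2 * z.
    rewrite (@itg_split _ 0 pi (pi / 2)) ?(integ_logb ls3c)//; last by clear -pp; lra.
    rewrite half; last by clear -pp; lra.
    by rewrite (_ : pi - pi / 2 = pi / 2) ?zE; [ring|field].
  have s2 := @itg_split _ 0 pi (2 * pi / 3) _ ltac:(clear -pp; lra) (integ_logb ls3c).
  rewrite s1 half in s2; last by clear -pp; lra.
  rewrite (_ : pi - 2 * pi / 3 = pi / 3) in s2; last by field.
  by rewrite s2 /P addrK.
have dbl c : 0 < c < pi / 2 -> itg 0 c (fun t : R => lsin (2 * t) ^+ 3) = 1 / 2 * itg 0 (2 * c) (fun t : R => lsin t ^+ 3).
  move=> cp; have l : logb (2 * 0) (2 * c) (fun t : R => lsin t ^+ 3) by apply: logb_sub ls3c; clear -pp cp; lra.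
  by rewrite (itg_scale _ l)// mulr0 mul1r.
have lowE : itg 0 (pi / 3) (fun x : R => lcos x * (3 * (4 * lsin (2 * x) ^+ 2 + 4 * x ^+ 2 - pi ^+ 2 / 3) - 6 * (2 * lcos x * lsin (2 * x) + x ^+ 2))) =
   4 * itg 0 (pi / 3) (fun x : R => lsin (2 * x) ^+ 3) - 4 * P - 4 * (z - q)
   + (itg 0 (pi / 3) (fun x => (- (pi ^+ 2 / 2) + 0 * x + 6 * x ^+ 2) * lcos x) - pi ^+ 2 / 2 * itg 0 (pi / 3) lcos).
  rewrite -cq /P -!itgZ; [|by apply: integ_logb; logb_auto..].
  rewrite -!itgB; [|by apply: integ_logb; logb_auto..].
  rewrite -itgD; [|by apply: integ_logb; logb_auto..].
  by apply: itg_ext => x xp; rewrite lsin_double; [field|lra].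
have highE : itg 0 (pi / 6) (fun x : R => 4 * lcos x ^+ 3 - 4 * lsin (2 * x) ^+ 3 + (pi ^+ 2 - 12 * x ^+ 2) * lsin x) =
   4 * (z - P) - 4 * itg 0 (pi / 6) (fun x : R => lsin (2 * x) ^+ 3)
   + itg 0 (pi / 6) (fun x => (pi ^+ 2 + 0 * x + - 12 * x ^+ 2) * lsin x).
  rewrite -cP -!itgZ; [|by apply: integ_logb; logb_auto..].
  rewrite -itgB; [|by apply: integ_logb; logb_auto..].
  rewrite -itgD; [|by apply: integ_logb; logb_auto..].
  by apply: itg_ext => x xp; ring.
rewrite mahler_mom; have lm := @logb_mom_cos R 0 (pi / 2) 3 (lexx _) ltac:(clear -pp; lra).
rewrite (@itg_split _ 0 (pi / 2) (pi / 3)); [|by clear -pp; lra|exact: integ_logb].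
rewrite mom3_low mom3_high lowE highE !dbl//.
rewrite (_ : 2 * (pi / 3) = 2 * pi / 3); last by ring.
rewrite (_ : 2 * (pi / 6) = pi / 3); last by field.
rewrite r23 cq mom3_1.
have zz : z = - (3 / 4 * pi * zeta (3 : R)) := lcos_cube_pihalf.
rewrite zz /P /q; do 5! move: (itg _ _ _) => ?.
by move: (zeta _) => ?; gen_pi; fld.
Qed.

(** The log-sine integrals use the half angle on a closed range; the substitution produces the
    factor [2] in front of [itg 0 c f]. *)
Lemma itg_abs (f : R -> R) c : 0 < c -> logb 0 c f ->
  \int[@lebesgue_measure R]_(theta in `[0%R, 2 * c]) f (theta / 2) = 2 * itg 0 c f.
Proof.
move=> c0 lf; have l : logb 0 (2 * c) (fun x => f (x / 2)).
  apply: (@logb_ext _ _ _ (fun x => f (2^-1 * x))); first by move=> x _; rewrite mulrC.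
  by apply: logb_scale => //; rewrite mulr0 mulrA mulVf// mul1r.
rewrite (@integ_ends _ 0 (2 * c) _ true false (integ_logb l)).
rewrite (@itg_ext _ _ _ _ (fun x => f (2^-1 * x))); last by move=> x _; rewrite mulrC.
rewrite (@itg_scale _ 0 (2 * c) 2^-1 f)// ?mulr0 ?mulrA ?mulVf// ?mul1r ?invrK//.
Qed.

End final.

Theorem theorem6 (R : realType) :
  pi * higher_mahler 3 (fun x y : R[i]%C => 1 + x + y) =
    15 * Ls 4 (2 * pi / 3) - 18 * Lsc 2 3 (pi / 3) - 15 * Cl 4 (pi / 3)
    - 1 / 4 * pi ^+ 2 * Cl 2 (pi / 3) - 17 * pi * zeta 3 :> R.
Proof.
have pp := @pi_gt0 R.
have ls3 : logb 0 (pi / 3) (@lsin R) by apply: lsin_logb; lra.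
have ls6 : logb 0 (pi / 6) (@lsin R) by apply: lsin_logb; lra.
have lc6 : logb 0 (pi / 6) (@lcos R) by apply: lcos_logb; lra.
have la (x : R) : 0 <= x -> x <= pi / 3 -> `|2 * sin x| = 2 * sin x.
  by move=> x0 xp; rewrite ger0_norm// mulr_ge0// sin_ge0_pi//; lra.
have lb (x : R) : 0 <= x -> x <= pi / 3 -> `|2 * cos x| = 2 * cos x.
  by move=> x0 xp; rewrite ger0_norm// mulr_ge0// ltW// cos_pos; lra.
have eLs : Ls 4 (2 * pi / 3) = - (2 * itg 0 (pi / 3) (fun t : R => lsin t ^+ 3)).
  rewrite /Ls -(@itg_abs _ (fun t => lsin t ^+ 3)); [|lra|by logb_auto].
  rewrite (_ : 2 * (pi / 3) = 2 * pi / 3); last by ring.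
  congr (- _); apply: eq_Rintegral => t; rewrite inE/= in_itv/= => tp.
  by rewrite la//; lra.
have eLsc : Lsc 2 3 (pi / 3) = - (2 * itg 0 (pi / 6) (fun t : R => lsin t * lcos t ^+ 2)).
  rewrite /Lsc -(@itg_abs _ (fun t => lsin t * lcos t ^+ 2)); [|lra|by logb_auto].
  rewrite (_ : 2 * (pi / 6) = pi / 3); last by field.
  congr (- _); apply: eq_Rintegral => t; rewrite inE/= in_itv/= => tp.
  by rewrite la ?lb ?expr1//; lra.
(* The complement of the angle: [lcos ^+ 3] on [[0, pi / 6]] is the full integral minus [P]. *)
have comp : itg 0 (pi / 6) (fun t : R => lcos t ^+ 3) = - (3 / 4 * pi * zeta (3 : R)) - itg 0 (pi / 3) (fun t : R => lsin t ^+ 3).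
  have lc : logb 0 (pi / 2) (fun t : R => lcos t ^+ 3).
    by have h : logb 0 (pi / 2) (@lcos R) by [apply: lcos_logb; lra]; logb_auto.
  have l : logb (pi / 6) (pi / 2) (fun t : R => lcos t ^+ 3) by apply: logb_sub lc; lra.
  have := itg_refl (pi / 2) l; rewrite subrr (_ : pi / 2 - pi / 6 = pi / 3); last by field.
  rewrite (@itg_ext _ _ _ _ (fun t : R => lsin t ^+ 3)); last by move=> x _; rewrite lcosB_pihalf.
  move=> ->; rewrite -lcos_cube_pihalf (@itg_split _ 0 (pi / 2) (pi / 6)) ?addrK//; [lra|exact: integ_logb].
rewrite eLs eLsc mahler_lsin.
(* Relation [q] evaluates the cubic integral on [[0, pi / 6]]; relation [w] ties the mixed integral
   to [P] with leading part [6 * I = 3 * P]. All that is left are quadratic moments. *)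
have q := @lsin3_pi6 R; have w := @lsin_lcos2_pi6 R; rewrite polar_cubic_2pi3 comp in w.
have e6 : itg 0 (pi / 6) (fun t : R => (pi / 6 - t) ^+ 2 * lsin t) =
    itg 0 (pi / 6) (fun t => ((pi / 6) ^+ 2 + - (pi / 3) * t + 1 * t ^+ 2) * lsin t).
  by apply: itg_ext => t _; congr (_ * _); field.
rewrite e6 in q.
have M (b : R) : 0 < b <= pi / 2 -> 0 < b <= pi by lra.
have b6 : 0 < (pi / 6 : R) <= pi / 2 by lra.
have b3 : 0 < (pi / 3 : R) <= pi / 2 by lra.
have r1 : 2 * (pi / 3) = 2 * pi / 3 :> R by ring.
have r2 : 2 * (pi / 6) = pi / 3 :> R by field.
have r3 : pi - 2 * pi / 3 = pi / 3 :> R by field.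
have r4 : pi - pi / 3 = 2 * pi / 3 :> R by field.
(* Each moment becomes a combination of [Cl 2], [Cl 4] and [zeta 3] with powers of [pi] as
   coefficients, after which the identity is linear in the monomials. *)
rewrite !(lsin_moment _ _ _ (M _ b6)) r2 r4 B1_2pi3 B3_2pi3 Y2_2pi3 Y2pi_zeta in q *.
rewrite (lcos_moment _ _ _ b3) r1 B1_2pi3 B3_2pi3 Y2_2pi3 Y2_0.
rewrite (lcos_moment _ _ _ b6) r2 B1_pi3 B3_pi3 Y2_pi3 Y2_0 B3_2pi3 in w.
move: (itg _ _ _) (itg _ _ _) (itg _ _ _) (Cl 2 _) (Cl 4 _) (zeta _) q w => P q' w' C2 C4 Z.
gen_pi; lra.
Qed.
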